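(* The process $$\frac{1}{t\wedge\tau-\theta}\,\log|Y_{\gamma}(t\wedge\tau)|$$ is almost surely constant in $t\in(\theta,T]$.
   Context: Let $\theta\in\mathbb{R}$ and $T\in(\theta,+\infty)$ be given, together with a complete probability space $(\Omega,\mathcal{F},\mathbf{P})$ and a right-continuous filtration $\{\mathcal{F}_t\}_{t\in[\theta,T]}$ of complete $\sigma$-algebras of events. Let $w(t)$, $t\in[\theta,T]$, be a one-dimensional Wiener process with $w(\theta)=0$, adapted to $\{\mathcal{F}_t\}$, such that $\mathcal{F}_t$ is independent of $w(s)-w(q)$ whenever $s>q\ge t$. Let $\gamma\in[0,1]$, and let $\sigma>0$ be a constant. Let $f(s,t):C([\theta,T])\times[\theta,T]\to\mathbb{R}$ be a measurable (possibly random) function such that $f(s,t)$ is $\mathcal{F}_t$-adapted for any $s\in C([\theta,T])$, and $f(s_1,t)=f(s_2,t)$ if $(s_1-s_2)|_{[\theta,t]}\equiv 0$. For any $\delta>0$ there are constants $c_k=c_k(\delta)>0$, $k=1,2$, such that, almost surely, $|f(s_1,t)-f(s_2,t)|\le c_1\|s_1-s_2\|_{C([\theta,T])}$ and $|f(s,t)|\le c_2(\|s\|_{C([\theta,T])}+1)$ for all $t\in[\theta,T]$ and all $s,s_1,s_2\in C([\theta,T])$ whose infimum over $[\theta,T]$ is larger than $\delta$. The process $y$ is the real-valued almost surely continuous $\mathcal{F}_t$-adapted solution, with $y(\theta)>0$, of the Itô equation $$dy(t)=f(y(\cdot),t)\,dt+\sigma\,y(t)^{\gamma}\,dw(t)$$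 on $[\theta,\tau]$, where $\tau$ is a Markov time (stopping time) with respect to $\{\mathcal{F}_t\}$ such that $\tau\in(\theta,T]$ a.s. and $\inf_{s\in[\theta,\tau]}y(s)>0$ a.s. $Y_\gamma(s)$, $s\in[\theta,\tau]$, is the (continuous) complex-valued process satisfying the Itô equation (driven by the continuous semimartingale $y$, with $i=\sqrt{-1}$) $$dY_\gamma(s)=i\,Y_\gamma(s)\,\frac{dy(s)}{y(s)^\gamma},\quad s\in(\theta,\tau),\qquad Y_\gamma(\theta)=1.$$ Notation: $t\wedge\tau=\min(t,\tau)$. *)

(* Defs.v *)
From HB Require Import structures.
From mathcomp Require Import all_boot all_order all_algebra.
From mathcomp Require Import all_classical all_reals all_analysis.
From mathcomp Require Export complex.

Set Implicit Arguments.
Unset Strict Implicit.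
Unset Printing Implicit Defensive.

Import Order.TTheory GRing.Theory Num.Theory.
Import numFieldNormedType.Exports.

Local Open Scope classical_set_scope.
Local Open Scope ring_scope.

(* A real-valued process is a function [X : R -> Omega -> R] (time first), of  *)
(* which only the values at times in [theta, T] (or [theta, tau]) matter.      *)

Definition measurable_wrt (Omega : Type) (R : realType) (G : set (set Omega))
    (X : Omega -> R) : Prop :=
  forall B : set R, measurable B -> G (X @^-1` B).

Definition adapted (Omega : Type) (R : realType) (F : R -> set (set Omega))
    (theta T : R) (X : R -> Omega -> R) : Prop :=
  forall t, t \in `[theta, T] -> measurable_wrt (F t) (X t).

(* A process given on [theta, tau] only, extended by 0 after tau; it is        *)
(* adapted when this extension is.                                             *)
Definition upto (Omega : Type) (R : realType) (tau : Omega -> R)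
    (X : R -> Omega -> R) : R -> Omega -> R :=
  fun t omega => if t <= tau omega then X t omega else 0.

(* Right-continuous filtration of complete sigma-algebras of events.           *)
Record filtration d (Omega : measurableType d) (R : realType)
    (P : probability Omega R) (theta T : R) (F : R -> set (set Omega)) : Prop :=
  Filtration {
    filt_sigma : forall t, t \in `[theta, T] -> sigma_algebra setT (F t) ;
    filt_event : forall t, t \in `[theta, T] -> F t `<=` measurable ;
    filt_mono : forall s t, theta <= s -> s <= t -> t <= T -> F s `<=` F t ;
    filt_rcont : forall t, theta <= t -> t < T ->
      F t = \bigcap_(s in [set s | t < s <= T]) F s ;
    filt_complete : forall t, t \in `[theta, T] -> forall A N : set Omega,
      F t N -> P N = 0%E -> A `<=` N -> F t A }.

Definition stopping_time (Omega : Type) (R : realType) (theta T : R)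
    (F : R -> set (set Omega)) (tau : Omega -> R) : Prop :=
  forall t, t \in `[theta, T] -> F t [set omega | tau omega <= t].

(* Note that the second parameter of [normal_prob] is a standard deviation.    *)
Record wiener d (Omega : measurableType d) (R : realType)
    (P : probability Omega R) (theta T : R) (w : R -> Omega -> R) : Prop :=
  Wiener {
    wiener_meas : forall t, t \in `[theta, T] -> measurable_fun setT (w t) ;
    wiener_start : \forall omega \ae P, w theta omega = 0 ;
    wiener_cont : \forall omega \ae P,
      {within `[theta, T], continuous (w ^~ omega)} ;
    wiener_gauss : forall q s, theta <= q -> q < s -> s <= T ->
      forall B : set R, measurable B ->
      P ((w s \- w q) @^-1` B) = normal_prob 0 (Num.sqrt (s - q)) B ;
    wiener_indep : forall (n : nat) (t : nat -> R) (B : nat -> set R),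
      (forall k, (k <= n)%N -> t k \in `[theta, T]) ->
      (forall k, (k < n)%N -> t k <= t k.+1) ->
      (forall k, measurable (B k)) ->
      P (\bigcap_(k in `I_n) ((w (t k.+1) \- w (t k)) @^-1` B k)) =
      (\prod_(k < n) P ((w (t k.+1) \- w (t k))%R @^-1` B k))%E }.

Definition future_increments_independent d (Omega : measurableType d)
    (R : realType) (P : probability Omega R) (theta T : R)
    (F : R -> set (set Omega)) (w : R -> Omega -> R) : Prop :=
  forall t q s, theta <= t -> t <= q -> q < s -> s <= T ->
  forall (A : set Omega) (B : set R), F t A -> measurable B ->
    P (A `&` ((w s \- w q) @^-1` B)) = (P A * P ((w s \- w q)%R @^-1` B))%E.

(* C([theta, T]) is represented by the functions R -> R whose restriction to   *)
(* [theta, T] is continuous.                                                   *)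
Definition Cpath (R : realType) (theta T : R) : set (R -> R) :=
  [set s | {within `[theta, T], continuous s}].

Definition Cnorm (R : realType) (theta T : R) (s : R -> R) : R :=
  sup [set `|s t| | t in `[theta, T]].

Definition Copen (R : realType) (theta T : R) : set (set (R -> R)) :=
  [set U | U `<=` Cpath theta T /\ forall s, U s -> exists2 e : R, 0 < e &
     forall s', Cpath theta T s' -> Cnorm theta T (s' \- s) < e -> U s'].

(* The drift functional f(s, t), with the event omega as a third argument.     *)
Record drift_functional d (Omega : measurableType d) (R : realType)
    (P : probability Omega R) (theta T : R) (F : R -> set (set Omega))
    (f : (R -> R) -> R -> Omega -> R) : Prop := DriftFunctional {
  drift_meas :
    measurable_fun
      (Cpath theta T `*` `[theta, T] `*` [set: Omega]
        : set (g_sigma_algebraType (Copen theta T) * R * Omega))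
      (fun x : g_sigma_algebraType (Copen theta T) * R * Omega =>
         f x.1.1 x.1.2 x.2) ;
  drift_adapted : forall s, Cpath theta T s -> adapted F theta T (f s) ;
  drift_causal : forall s1 s2 t omega,
    Cpath theta T s1 -> Cpath theta T s2 -> t \in `[theta, T] ->
    (forall u, u \in `[theta, t] -> s1 u = s2 u) ->
    f s1 t omega = f s2 t omega ;
  drift_bounds : forall delta : R, 0 < delta ->
    exists c1 c2 : R, [/\ 0 < c1, 0 < c2 &
      \forall omega \ae P, forall t, t \in `[theta, T] ->
        (forall s1 s2, Cpath theta T s1 -> Cpath theta T s2 ->
           delta < inf (s1 @` `[theta, T]) -> delta < inf (s2 @` `[theta, T]) ->
           `|f s1 t omega - f s2 t omega| <= c1 * Cnorm theta T (s1 \- s2)) /\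
        (forall s, Cpath theta T s -> delta < inf (s @` `[theta, T]) ->
           `|f s t omega| <= c2 * (Cnorm theta T s + 1))] }.

(* The simple process  sum_(k < n) xi_k 1_[t_k, t_(k+1)[.                      *)
Record simple_process (Omega : Type) (R : realType) := SimpleProcess {
  sp_size : nat ;
  sp_time : nat -> R ;
  sp_val : nat -> Omega -> R }.

Record is_simple (Omega : Type) (R : realType) (F : R -> set (set Omega))
    (theta T : R) (phi : simple_process Omega R) : Prop := IsSimple {
  simple_time : forall k, (k <= sp_size phi)%N ->
    sp_time phi k \in `[theta, T] ;
  simple_mono : forall k, (k < sp_size phi)%N ->
    sp_time phi k <= sp_time phi k.+1 ;
  simple_adapted : forall k, (k < sp_size phi)%N ->
    measurable_wrt (F (sp_time phi k)) (sp_val phi k) ;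
  simple_bounded : forall k, (k < sp_size phi)%N ->
    exists c : R, forall omega, `|sp_val phi k omega| <= c }.

Definition sp_eval (Omega : Type) (R : realType) (phi : simple_process Omega R)
    (t : R) (omega : Omega) : R :=
  \sum_(k < sp_size phi)
    sp_val phi k omega * \1_(`[sp_time phi k, sp_time phi k.+1[%classic) t.

(* int_theta^t phi dw *)
Definition sp_integral (Omega : Type) (R : realType) (w : R -> Omega -> R)
    (phi : simple_process Omega R) (t : R) (omega : Omega) : R :=
  \sum_(k < sp_size phi) sp_val phi k omega *
    (w (Num.min (sp_time phi k.+1) t) omega -
     w (Num.min (sp_time phi k) t) omega).

Definition cvg_in_probability d (Omega : measurableType d) (R : realType)
    (P : probability Omega R) (X : nat -> Omega -> R) (Y : Omega -> R) : Prop :=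
  forall e : R, 0 < e ->
    (fun n => P [set omega | e <= `|X n omega - Y omega|]) @ \oo --> 0%E.

(* Only the measurability of almost all trajectories is asked for: joint       *)
(* measurability, up to modification on a null set, follows from adaptedness   *)
(* in the case of continuous paths and from approximability by simple          *)
(* processes in general.                                                       *)
Record ito_integrand d (Omega : measurableType d) (R : realType)
    (P : probability Omega R) (F : R -> set (set Omega)) (theta T : R)
    (H : R -> Omega -> R) : Prop := ItoIntegrand {
  ito_adapted : adapted F theta T H ;
  ito_path_meas : \forall omega \ae P,
    measurable_fun `[theta, T] (H ^~ omega) ;
  ito_L2 : \forall omega \ae P,
    (\int[lebesgue_measure]_(t in `[theta, T]) ((H t omega) ^+ 2)%:E < +oo)%E }.

(* I(t) = int_theta^t H dw: I is the continuous process that is the limit in   *)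
(* probability of the integrals of simple processes approximating H in         *)
(* L^2([theta, T]) almost surely (along a subsequence, this is the same as     *)
(* approximating H in L^2([theta, T]) in probability).                         *)
Definition is_ito_integral d (Omega : measurableType d) (R : realType)
    (P : probability Omega R) (F : R -> set (set Omega)) (theta T : R)
    (w : R -> Omega -> R) (H I : R -> Omega -> R) : Prop :=
  [/\ ito_integrand P F theta T H,
      forall t, t \in `[theta, T] -> measurable_fun setT (I t),
      \forall omega \ae P, {within `[theta, T], continuous (I ^~ omega)} &
      exists phi : nat -> simple_process Omega R,
        [/\ forall n, is_simple F theta T (phi n),
            \forall omega \ae P,
              (fun n => \int[lebesgue_measure]_(t in `[theta, T])
                 ((sp_eval (phi n) t omega - H t omega) ^+ 2)%:E)%E @ \oo
              --> 0%E &
            forall t, t \in `[theta, T] ->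
              cvg_in_probability P
                (fun n => sp_integral w (phi n) t) (I t)]].

(* dX(t) = a(t) dt + b(t) dw(t) on [theta, tau], that is, almost surely, for   *)
(* all t in [theta, tau],                                                      *)
(*   X(t) = X(theta) + int_theta^t a(s) ds + int_theta^t b(s) dw(s),           *)
(* the last integral being the one of 1_{s <= tau} b(s).                       *)
Definition ito_differential d (Omega : measurableType d) (R : realType)
    (P : probability Omega R) (F : R -> set (set Omega)) (theta T : R)
    (w : R -> Omega -> R) (tau : Omega -> R) (a b X : R -> Omega -> R) : Prop :=
  adapted F theta T (upto tau a) /\
  exists2 I : R -> Omega -> R,
    is_ito_integral P F theta T w (upto tau b) I &
    \forall omega \ae P,
      lebesgue_measure.-integrable `[theta, tau omega] (EFin \o (a ^~ omega)) /\
      forall t, t \in `[theta, tau omega] ->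
        X t omega = X theta omega
          + \int[lebesgue_measure]_(s in `[theta, t]) a s omega
          + I t omega.

(* dZ = H dX on [theta, tau], for a real Ito process X and complex-valued      *)
(* processes H and Z: if dX = a dt + b dw then dZ = H a dt + H b dw (real and  *)
(* imaginary parts being taken separately), which does not depend on the       *)
(* choice of a and b since these are unique up to null sets.                   *)
Definition complex_ito_differential d (Omega : measurableType d) (R : realType)
    (P : probability Omega R) (F : R -> set (set Omega)) (theta T : R)
    (w : R -> Omega -> R) (tau : Omega -> R) (X : R -> Omega -> R)
    (H Z : R -> Omega -> R[i]) : Prop :=
  exists a b : R -> Omega -> R,
    [/\ ito_differential P F theta T w tau a b X,
        ito_differential P F theta T w tau
          (fun t omega => complex.Re (H t omega) * a t omega)
          (fun t omega => complex.Re (H t omega) * b t omega)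
          (fun t omega => complex.Re (Z t omega)) &
        ito_differential P F theta T w tau
          (fun t omega => complex.Im (H t omega) * a t omega)
          (fun t omega => complex.Im (H t omega) * b t omega)
          (fun t omega => complex.Im (Z t omega))].

(* Main.v *)
(* Let U + iV = Y and N = U^2 + V^2. Formally dN = sigma^2 N dt, since Y       *)
(* rotates with speed dy / y^gamma, whose quadratic variation is sigma^2 dt;   *)
(* hence N(s) = exp(sigma^2 (s - theta)). Without Ito's formula, this is read  *)
(* off a partition t_k of [theta, b] of mesh D. Put z = dy / y^gamma over a    *)
(* cell, EU = dU + V z, EV = dV - U z. Then dN - sigma^2 D N equals            *)
(*   2 U EU + 2 V EV + EU^2 + EV^2 - 2 V z EU + 2 U z EV                       *)
(*     + N (z^2 - sigma^2 dw^2) + sigma^2 N (dw^2 - D).                        *)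
(* Up to drift terms, EU, EV and z - sigma dw are increments of int H2 dw      *)
(* minus H2/H1 at t_k times increments of int H1 dw, where H2/H1 is continuous.*)
(* Such an error is a sum of martingale differences whose energy is o(1) times *)
(* the integral of H1^2, so its weighted sums and its sum of squares tend to   *)
(* 0 in probability by Lenglart's inequality. The same holds for dw^2 - D.     *)
(* Along a subsequence everything converges almost surely, which gives N(b)    *)
(* for each b <= tau; rational b and continuity give N on ]theta, tau].        *)
(*   The Ito decomposition of y used for Y need not be the one of the equation *)
(* for y: both are integrated against the same y, and no uniqueness is needed. *)
(*   The value K of the second moment of the standard normal law plays no role *)
(* and is kept as a parameter, so the constant obtained is sigma^2 K / 2.      *)

Require Import Defs.
From HB Require Import structures.
From mathcomp Require Import all_boot all_order all_algebra.
From mathcomp Require Import all_classical all_reals all_analysis.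
From mathcomp Require Import complex.
From mathcomp Require Import measurable_realfun.
From mathcomp Require Import ring lra.

Set Implicit Arguments.
Unset Strict Implicit.
Unset Printing Implicit Defensive.

Import Order.TTheory GRing.Theory Num.Theory.
Import numFieldNormedType.Exports.

Local Open Scope classical_set_scope.
Local Open Scope ring_scope.

(** * Independence and Lenglart's inequality *)

(** Write [Y = U + iV] and [N = U^2 + V^2]. The increment [i Y dy / y^gamma] is orthogonal to [Y],
    so [N] has no first-order variation: it grows only through the quadratic variation of
    [dy / y^gamma], which is [sigma^2 dt] whatever the drift is. Hence [N] is an exponential of a
    multiple of [s - theta] up to [tau], and [ln |Y|], half the logarithm of [N], is linear in
    [s - theta].

    The deterministic core is [discrete_norm_cvg]: along a partition the quantities [c^k N(t_k)],
    with [c] the inverse of the expected growth factor per step, change in total by a combination of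
    error sums, and it suffices that these vanish. Two kinds of sums have to be controlled by
    probability. The first consists of increments of one Ito integral minus a frozen ratio times
    increments of another ([error_sum_cvg]), the second of squared Wiener increments minus their
    means ([qv_sum_cvg]). Both are sums of martingale differences, and no moment of the weights is
    available; [lenglart] therefore bounds them in probability by their predictable energy, which is
    estimated path by path.

    The definition of the Ito integral enters only through [ito_integral_diagonal], which provides
    simple integrals that are close to the true ones at all points of each grid. The passage from
    these to [U], [V] and [y] is made for each path separately, in [ito_error_cvg] and
    [pathwise_norm]. A single subsequence along which all error sums tend to 0 almost surely comes
    from [diagonal_small], and [sqr_norm_at] then gives [N(b)] on the event [b <= tau] for a fixed
    [b]. Countably many rational [b] share one null set, and [within_eq_dense] extends the formula
    to all times by continuity. *)

Section independence.
Context d (T : measurableType d) (R : realType) (P : probability T R).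
Implicit Types X Y : T -> R.

Definition indep_rv X Y := forall A B : set R, measurable A -> measurable B ->
  P (X @^-1` A `&` Y @^-1` B) = (P (X @^-1` A) * P (Y @^-1` B))%E.

Section joint_law.
Variables (X Y : {mfun T >-> R}).
Hypothesis XY : indep_rv X Y.

Let Z : T -> R * R := fun x => (X x, Y x).
Let mZ : measurable_fun setT Z. Proof. exact: measurable_fun_pair. Qed.
HB.instance Definition _ := isMeasurableFun.Build _ _ _ _ Z mZ.
Let ZRV : {RV P >-> (R * R)%type} := Z.

(** Independence says that the two measures agree on rectangles, and rectangles determine a measure
    on the product. *)
Lemma joint_lawE (S : set (R * R)) : measurable S ->
  (distribution P X \x distribution P Y)%E S = distribution P Z S.
Proof. by move=> mS; apply: product_measure_unique => // A B mA mB; exact: XY. Qed.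

(** Tonelli under the product law. With absolute values no integrability is required, so the
    identity serves both for products of squares and for proving that a product is integrable. *)
Lemma indep_integral_normM :
  (\int[P]_x (`|X x * Y x|%:E) =
   (\int[P]_x `|X x|%:E) * (\int[P]_x `|Y x|%:E))%E.
Proof.
pose g (z : R * R) : \bar R := (`|z.1 * z.2|)%:E.
have mg : measurable_fun setT g.
  by apply/measurable_EFinP; apply: measurableT_comp => //; exact: measurable_funM.
rewrite -(ge0_integral_distribution ZRV mg)//; last first.
  by move=> z; rewrite /g lee_fin.
rewrite (eq_measure_integral (distribution P X \x distribution P Y)%E); last first.
  by move=> S mS _; exact: (esym (joint_lawE mS)).
rewrite fubini_tonelli1//=; last by move=> z; rewrite /g lee_fin.
rewrite /fubini_F /=.
have mabs : measurable_fun setT (fun x : R => `|x|%:E : \bar R).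
  by apply/measurable_EFinP; exact: normr_measurable.
rewrite (eq_integral (fun x : R => `|x|%:E * \int[distribution P Y]_y `|y|%:E)%E); last first.
  move=> x _; rewrite -ge0_integralZl//.
  by apply: eq_integral => y _; rewrite /g /= normrM EFinM.
rewrite ge0_integralZr//; last exact: integral_ge0.
congr (_ * _)%E.
- rewrite (ge0_integral_distribution (P := P) X (f := (fun x : R => `|x|%:E)))//.
- rewrite (ge0_integral_distribution (P := P) Y (f := (fun x : R => `|x|%:E)))//.
Qed.

(** Fubini under the product law: the inner integral is [x] times the mean of [Y]. *)
Lemma indep_integralM0 :
  P.-integrable setT (EFin \o X) -> P.-integrable setT (EFin \o Y) ->
  (\int[P]_x (Y x)%:E = 0 -> \int[P]_x (X x * Y x)%:E = 0)%E.
Proof.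
move=> iX iY Y0.
pose g (z : R * R) : \bar R := (z.1 * z.2)%:E.
have mg : measurable_fun setT g.
  by apply/measurable_EFinP; exact: measurable_funM.
have iXY : P.-integrable setT (fun x => (X x * Y x)%:E).
  apply/integrableP; split.
    by apply/measurable_EFinP; apply: measurable_funM.
  rewrite (_ : \int[P]_x _ = \int[P]_x (`|X x * Y x|%:E))%E//.
  rewrite indep_integral_normM lte_mul_pinfty//.
  - exact: integral_ge0.
  - rewrite ge0_fin_numE; last exact: integral_ge0.
    by move/integrableP : iX => [].
  - by move/integrableP : iY => [].
rewrite -(integral_distribution (X := ZRV) mg)//.
have ig : (distribution P X \x distribution P Y)%E.-integrable setT g.
  apply/integrableP; split => //.
  rewrite (eq_measure_integral (distribution P ZRV)); last first.
    by move=> S mS _; exact: joint_lawE.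
  rewrite ge0_integral_distribution//; last exact: measurableT_comp.
  by move/integrableP : iXY => [].
rewrite (eq_measure_integral (distribution P X \x distribution P Y)%E); last first.
  by move=> S mS _; exact: (esym (joint_lawE mS)).
rewrite -(integral12_prod_meas1 ig)//.
rewrite integral0_eq//= => x _; rewrite /fubini_F /=.
rewrite (_ : \int[_]_y _ = \int[distribution P Y]_y (x%:E * y%:E))%E//.
have iid : (distribution P Y).-integrable setT (fun y => y%:E).
  apply/integrableP; split; first exact/measurable_EFinP.
  rewrite ge0_integral_distribution//; last exact/measurableT_comp/measurable_EFinP.
  by move/integrableP : iY => [].
rewrite integralZl//.
rewrite (integral_distribution (P := P) (X := Y) (f := (fun y : R => y%:E)))//=.
  by rewrite [X in (_ * X)%E]Y0 mule0.
exact/measurable_EFinP.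
Qed.

End joint_law.
End independence.

Section measurable_wrt_theory.
Context d (T : measurableType d) (R : realType).
Variable G : set (set T).
Hypothesis sG : sigma_algebra setT G.
Implicit Types X Y : T -> R.

(** A sigma-algebra generates itself, so measurability with respect to [G] is ordinary measurability
    on the type carrying [G], and the closure properties below are inherited. *)
Lemma measurable_wrtP X :
  measurable_wrt G X <-> measurable_fun setT (X : g_sigma_algebraType G -> R).
Proof.
have GE : (@measurable _ (g_sigma_algebraType G)) = G.
  by rewrite [LHS]sigma_algebra_id.
split=> [mX _ B mB|mX B mB]; first by rewrite setTI GE; exact: mX.
by have := mX measurableT B mB; rewrite setTI GE.
Qed.

Lemma measurable_wrtE X : G `<=` measurable -> measurable_wrt G X ->
  measurable_fun setT X.
Proof. by move=> GT mX _ B mB; rewrite setTI; apply: GT; exact: mX. Qed.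

Lemma measurable_wrt_cst c : measurable_wrt G (fun=> c : R).
Proof. exact/measurable_wrtP/measurable_cst. Qed.

Lemma measurable_wrtM X Y : measurable_wrt G X -> measurable_wrt G Y ->
  measurable_wrt G (fun x => X x * Y x).
Proof.
by move=> /measurable_wrtP mX /measurable_wrtP mY; apply/measurable_wrtP/measurable_funM.
Qed.

Lemma measurable_wrtD X Y : measurable_wrt G X -> measurable_wrt G Y ->
  measurable_wrt G (fun x => X x + Y x).
Proof.
by move=> /measurable_wrtP mX /measurable_wrtP mY; apply/measurable_wrtP/measurable_funD.
Qed.

Lemma measurable_wrtB X Y : measurable_wrt G X -> measurable_wrt G Y ->
  measurable_wrt G (fun x => X x - Y x).
Proof.
by move=> /measurable_wrtP mX /measurable_wrtP mY; apply/measurable_wrtP/measurable_funB.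
Qed.

Lemma measurable_wrt_comp (g : R -> R) X : measurable_fun setT g ->
  measurable_wrt G X -> measurable_wrt G (fun x => g (X x)).
Proof.
move=> mg mX B mB; apply: (mX (g @^-1` B)).
by rewrite -[X in measurable X]setTI; exact: mg.
Qed.

Lemma measurable_wrt_sum (I : Type) (s : seq I) (p : pred I) (X : I -> T -> R) :
  (forall i, p i -> measurable_wrt G (X i)) ->
  measurable_wrt G (fun x => \sum_(i <- s | p i) X i x).
Proof.
move=> mX; elim: s => [|i s ih].
  rewrite (_ : (fun x => _) = (fun=> 0)); first exact: measurable_wrt_cst.
  by apply/funext => x; rewrite big_nil.
case: (boolP (p i)) => [pi|npi].
  rewrite (_ : (fun x => _) = (fun x => X i x + \sum_(j <- s | p j) X j x)).
    by apply: measurable_wrtD => //; exact: mX.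
  by apply/funext => x; rewrite big_cons pi.
rewrite (_ : (fun x => _) = (fun x => \sum_(j <- s | p j) X j x))//.
by apply/funext => x; rewrite big_cons (negbTE npi).
Qed.

Lemma measurable_wrt_indic_le X c : measurable_wrt G X ->
  measurable_wrt G (fun x => if X x <= c then 1 else 0 : R).
Proof.
apply: (@measurable_wrt_comp (fun y => if y <= c then 1 else 0)).
apply: measurable_fun_ifT => //.
exact: measurable_fun_ler.
Qed.

End measurable_wrt_theory.

Lemma measurable_wrtS (T : Type) (R : realType) (G H : set (set T)) (X : T -> R) :
  G `<=` H -> measurable_wrt G X -> measurable_wrt H X.
Proof. by move=> GH mX B mB; apply/GH/mX. Qed.

Section centered_increments.
Context d (T : measurableType d) (R : realType) (P : probability T R).

(* [eta] plays the role of a Brownian increment over a step of a filtration *)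
(* that is [G] before and [H] after the step; [v] bounds its variance.      *)
Record increment (G H : set (set T)) (v : R) (eta : T -> R) : Prop := Increment {
  incr_var_gt0 : 0 < v ;
  incr_meas : measurable_wrt H eta ;
  incr_indep : forall A B, G A -> measurable B ->
    P (A `&` eta @^-1` B) = (P A * P (eta @^-1` B))%E ;
  incr_mean : (\int[P]_x (eta x)%:E = 0)%E ;
  incr_var : (\int[P]_x (eta x ^+ 2)%:E <= v%:E)%E }.

Variables (G H : set (set T)) (v : R) (eta : T -> R).
Hypotheses (GT : G `<=` measurable) (HT : H `<=` measurable).
Hypothesis eta_incr : increment G H v eta.

Let meta : measurable_fun setT eta.
Proof. exact: measurable_wrtE HT (incr_meas eta_incr). Qed.

Lemma sqr_integrable_integrable (X : T -> R) : measurable_fun setT X ->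
  (\int[P]_x (X x ^+ 2)%:E < +oo)%E -> P.-integrable setT (EFin \o X).
Proof.
move=> mX X2.
have i1 : P.-integrable setT (EFin \o (fun x => 1 + X x ^+ 2)).
  apply: (@integrableD _ _ _ P setT _ (EFin \o cst 1) (fun x => (X x ^+ 2)%:E)) => //.
    exact: finite_measure_integrable_cst.
  apply/integrableP; split.
    by apply/measurable_EFinP; exact: measurable_funX.
  by under eq_integral do rewrite /= ger0_norm ?sqr_ge0//.
apply: le_integrable i1 => //; first exact/measurable_EFinP.
move=> x _ /=; rewrite lee_fin [leRHS]ger0_norm ?addr_ge0 ?sqr_ge0//.
have := sqr_ge0 (`|X x| - 2^-1); rewrite -(real_normK (num_real (X x))).
have := normr_ge0 (X x); nra.
Qed.

Lemma increment_integrable : P.-integrable setT (EFin \o eta).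
Proof.
apply: sqr_integrable_integrable => //.
by rewrite (le_lt_trans (incr_var eta_incr))// ltry.
Qed.

Lemma increment_integralM0 (X : T -> R) : measurable_wrt G X ->
  P.-integrable setT (EFin \o X) -> (\int[P]_x (X x * eta x)%:E = 0)%E.
Proof.
move=> mX iX.
have mXT := measurable_wrtE GT mX.
pose X' : {mfun T >-> R} := HB.pack X (isMeasurableFun.Build _ _ _ _ X mXT).
pose eta' : {mfun T >-> R} := HB.pack eta (isMeasurableFun.Build _ _ _ _ eta meta).
apply: (@indep_integralM0 _ _ _ P X' eta') => //.
- by move=> A B mA mB; apply: (incr_indep eta_incr) => //; exact: mX.
- exact: increment_integrable.
- exact: incr_mean eta_incr.
Qed.

(** [X^2] and [eta^2] are independent, so the second moment of the product factors; both sides may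
    be infinite. *)
Lemma increment_integral_sqrM (X : T -> R) : measurable_wrt G X ->
  (\int[P]_x ((X x * eta x) ^+ 2)%:E <= \int[P]_x (X x ^+ 2 * v)%:E)%E.
Proof.
move=> mX.
have mXT := measurable_wrtE GT mX.
have mX2 : measurable_fun setT (fun x => X x ^+ 2) by exact: measurable_funX.
have me2 : measurable_fun setT (fun x => eta x ^+ 2) by exact: measurable_funX.
pose X' : {mfun T >-> R} := HB.pack (fun x => X x ^+ 2)
  (isMeasurableFun.Build _ _ _ _ (fun x => X x ^+ 2) mX2).
pose eta' : {mfun T >-> R} := HB.pack (fun x => eta x ^+ 2)
  (isMeasurableFun.Build _ _ _ _ (fun x => eta x ^+ 2) me2).
have XY : indep_rv P X' eta'.
  move=> A B mA mB.
  have sq : measurable_fun setT (fun x : R => x ^+ 2) by exact: measurable_funX.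
  apply: (@incr_indep _ _ _ _ eta_incr (X' @^-1` A) ((fun x => x ^+ 2) @^-1` B)).
    apply: (mX ((fun x => x ^+ 2) @^-1` A)).
    by rewrite -[X in measurable X]setTI; exact: sq.
  by rewrite -[X in measurable X]setTI; exact: sq.
rewrite (_ : (\int[P]_x ((X x * eta x) ^+ 2)%:E =
    (\int[P]_x (X x ^+ 2)%:E) * (\int[P]_x (eta x ^+ 2)%:E))%E); last first.
  have := indep_integral_normM XY.
  rewrite (eq_integral (fun x => ((X x * eta x) ^+ 2)%:E)); last first.
    by move=> x _ /=; rewrite -exprMn ger0_norm ?sqr_ge0.
  rewrite [X in (X * _)%E](eq_integral (fun x => (X x ^+ 2)%:E)); last first.
    by move=> x _ /=; rewrite ger0_norm ?sqr_ge0.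
  rewrite [X in (_ * X)%E](eq_integral (fun x => (eta x ^+ 2)%:E))//.
  by move=> x _ /=; rewrite ger0_norm ?sqr_ge0.
under [leRHS]eq_integral do rewrite EFinM.
rewrite ge0_integralZr//.
- apply: lee_wpmul2l; last exact: incr_var eta_incr.
  by apply: integral_ge0 => x _; rewrite lee_fin sqr_ge0.
- exact/measurable_EFinP.
- by move=> x _; rewrite lee_fin sqr_ge0.
- by rewrite lee_fin ltW// (incr_var_gt0 eta_incr).
Qed.

End centered_increments.

Lemma markov_ineq d (T : measurableType d) (R : realType) (P : probability T R)
    (S : T -> R) (e : R) : measurable_fun setT S -> (forall x, 0 <= S x) -> 0 < e ->
  (P [set x | (e <= S x)%R] <= (e^-1)%:E * \int[P]_x (S x)%:E)%E.
Proof.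
move=> mS S0 e0.
have mB : measurable [set x | e <= S x].
  by rewrite -[X in measurable X]setTI; apply: measurable_fun_ler => //; exact: measurable_cst.
rewrite -ge0_integralZl//; last 3 first.
- exact/measurable_EFinP.
- by move=> x _; rewrite lee_fin.
- by rewrite lee_fin invr_ge0 ltW.
rewrite -[X in P X]setIT -integral_indic//.
apply: ge0_le_integral => //.
- by apply/measurable_EFinP; exact: measurable_indic.
- by apply/measurable_EFinP; exact: measurable_funM.
move=> x _; rewrite -EFinM lee_fin indicE.
case: (boolP (x \in _)) => [/set_mem /= eS|_].
  by rewrite mulrC ler_pdivlMr// mul1r.
by rewrite mulr_ge0// invr_ge0 ltW.
Qed.

(** Partial sums of a nonnegative sequence are nondecreasing, so the indicator switches off once and
    for all: what survives is an initial segment with sum at most [delta]. *)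
Lemma killed_sum_le (R : realType) (q : nat -> R) (n : nat) (delta : R) :
  (forall i, 0 <= q i) -> 0 <= delta ->
  \sum_(i < n) (q i * (if \sum_(k < i.+1) q k <= delta then 1 else 0)) <= delta.
Proof.
move=> q0 d0; elim: n => [|n ih]; first by rewrite big_ord0.
have [le|gt] := leP (\sum_(k < n.+1) q k) delta.
  apply: le_trans le; apply: ler_sum => i _.
  by case: ifP => _; rewrite ?mulr1 ?mulr0.
by rewrite big_ord_recr /= ifF ?mulr0 ?addr0// leNgt gt.
Qed.

Section stochastic_sums.
Context d (T : measurableType d) (R : realType) (P : probability T R).
Variables (n : nat) (G : nat -> set (set T)) (eta : nat -> T -> R) (v : nat -> R).
Hypothesis sG : forall i, (i <= n)%N -> sigma_algebra setT (G i).
Hypothesis GT : forall i, (i <= n)%N -> G i `<=` measurable.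
Hypothesis GS : forall i, (i < n)%N -> G i `<=` G i.+1.
Hypothesis incr : forall i, (i < n)%N -> increment P (G i) (G i.+1) (v i) (eta i).

(** Orthogonality of martingale differences. The inequality comes from [v i] being only a bound of
    the variance; finite energies make every product in the expansion of the square integrable. *)
Lemma martingale_sum_L2 (xi : nat -> T -> R) (m : nat) : (m <= n)%N ->
  (forall i, (i < m)%N -> measurable_wrt (G i) (xi i)) ->
  (forall i, (i < m)%N -> (\int[P]_x (xi i x ^+ 2 * v i)%:E < +oo)%E) ->
  measurable_wrt (G m) (fun x => \sum_(i < m) xi i x * eta i x) /\
  (\int[P]_x ((\sum_(i < m) xi i x * eta i x) ^+ 2)%:E <=
    \sum_(i < m) \int[P]_x (xi i x ^+ 2 * v i)%:E)%E.
Proof.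
elim: m => [|m ih] mn mxi xi2.
  split.
    rewrite (_ : (fun x => _) = (fun=> 0)); first exact: measurable_wrt_cst (sG mn) _.
    by apply/funext => x; rewrite big_ord0.
  rewrite integral0_eq ?big_ord0// => x _.
  by rewrite big_ord0 expr0n.
have [|||mS S2] := ih; first exact: ltnW.
- by move=> i im; apply: mxi; exact: ltnW.
- by move=> i im; apply: xi2; exact: ltnW.
set S := fun x => _ in mS.
have mm : measurable_wrt (G m.+1) S by apply: measurable_wrtS mS; exact: GS.
have mxm := mxi _ (ltnSn m).
have mx' : measurable_wrt (G m.+1) (xi m) by apply: measurable_wrtS mxm; exact: GS.
have me := incr_meas (incr mn).
have vm := incr_var_gt0 (incr mn).
have SE x : \sum_(i < m.+1) xi i x * eta i x = S x + xi m x * eta m x.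
  by rewrite big_ord_recr.
split.
  under eq_fun do rewrite SE.
  apply: (measurable_wrtD (sG mn)) => //.
  exact: (measurable_wrtM (sG mn)).
have ST : measurable_fun setT S by exact: measurable_wrtE (GT mn) mm.
have xT : measurable_fun setT (xi m) by exact: measurable_wrtE (GT mn) mx'.
have eT : measurable_fun setT (eta m) by exact: measurable_wrtE (GT mn) me.
have S2oo : (\int[P]_x (S x ^+ 2)%:E < +oo)%E.
  apply: le_lt_trans S2 _; apply: lte_sum_pinfty => i _.
  by apply: xi2; exact: ltnW (ltn_ord i).
have x2 : (\int[P]_x (xi m x ^+ 2)%:E < +oo)%E.
  rewrite (eq_integral (fun x => ((v m)^-1%:E * (xi m x ^+ 2 * v m)%:E)%E)); last first.
    by move=> x _; rewrite -EFinM mulrC mulfK// gt_eqF.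
  rewrite ge0_integralZl//.
  - by rewrite lte_mul_pinfty ?lee_fin ?invr_ge0 ?ltW// xi2.
  - by apply/measurable_EFinP; apply: measurable_funM => //; exact: measurable_funX.
  - by move=> x _; rewrite lee_fin mulr_ge0 ?sqr_ge0// ltW.
  - by rewrite lee_fin invr_ge0 ltW.
have GTm := GT (ltnW mn).
have xe2 := increment_integral_sqrM GTm (GT mn) (incr mn) mxm.
have xe2oo := le_lt_trans xe2 (xi2 _ (ltnSn m)).
have iS2 : P.-integrable setT (fun x => (S x ^+ 2)%:E).
  apply/integrableP; split; first by apply/measurable_EFinP; exact: measurable_funX.
  by under eq_integral do rewrite /= ger0_norm ?sqr_ge0//.
have ixe2 : P.-integrable setT (fun x => ((xi m x * eta m x) ^+ 2)%:E).
  apply/integrableP; split.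
    by apply/measurable_EFinP; apply: measurable_funX; exact: measurable_funM.
  by under eq_integral do rewrite /= ger0_norm ?sqr_ge0//.
have ix2 : P.-integrable setT (fun x => (xi m x ^+ 2)%:E).
  apply/integrableP; split; first by apply/measurable_EFinP; exact: measurable_funX.
  by under eq_integral do rewrite /= ger0_norm ?sqr_ge0//.
have amgm (a b : R) : `|a * b| <= a ^+ 2 + b ^+ 2.
  rewrite normrM -(real_normK (num_real a)) -(real_normK (num_real b)).
  have := sqr_ge0 (`|a| - `|b|); have := normr_ge0 a; have := normr_ge0 b; nra.
have iSx : P.-integrable setT (EFin \o (fun x => S x * xi m x)).
  apply: (le_integrable _ _ _ (integrableD _ iS2 ix2)) => //.
    by apply/measurable_EFinP; exact: measurable_funM.
  by move=> x _ /=; rewrite lee_fin [leRHS]ger0_norm ?addr_ge0 ?sqr_ge0.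
(* [S * xi m] is known before step [m], and [eta m] is centered and independent of that past. *)
have cross : (\int[P]_x (S x * xi m x * eta m x)%:E = 0)%E.
  apply: (increment_integralM0 GTm (GT mn) (incr mn)) => //.
  exact: (measurable_wrtM (sG (ltnW mn))).
have iSxe : P.-integrable setT (fun x => (S x * xi m x * eta m x)%:E).
  apply: (le_integrable _ _ _ (integrableD _ iS2 ixe2)) => //.
    by apply/measurable_EFinP; apply: measurable_funM => //; exact: measurable_funM.
  by move=> x _ /=; rewrite lee_fin [leRHS]ger0_norm ?addr_ge0 ?sqr_ge0// -mulrA.
rewrite (eq_integral (fun x => ((S x ^+ 2)%:E + ((xi m x * eta m x) ^+ 2)%:E +
    2%:E * (S x * xi m x * eta m x)%:E)%E)); last first.
  by move=> x _; rewrite SE -EFinM -!EFinD; congr EFin; ring.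
rewrite integralD//; last 2 first.
- exact: integrableD.
- exact: integrableZl.
rewrite integralD// integralZl// cross mule0 adde0 big_ord_recr /=.
exact: leeD.
Qed.

(* The integrands are killed as soon as the predictable energy would exceed *)
(* [delta]: the killed sums have second moment at most [delta] and agree    *)
(* with the original ones where the energy is at most [delta].              *)
Lemma lenglart (J : nat) (xi : nat -> nat -> T -> R) (A : set T) (eps delta : R) :
  (forall j i, (j < J)%N -> (i < n)%N -> measurable_wrt (G i) (xi j i)) ->
  measurable A -> 0 < eps -> 0 <= delta ->
  (P (A `&` [set x | (eps <= \sum_(j < J) (\sum_(i < n) xi j i x * eta i x) ^+ 2)%R]) <=
   (delta / eps)%:E +
   P (A `&` [set x | (delta < \sum_(i < n) \sum_(j < J) xi j i x ^+ 2 * v i)%R]))%E.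
Proof.
move=> mxi mA e0 d0.
pose q i x := \sum_(j < J) xi j i x ^+ 2 * v i.
(* The sum runs up to and including [i]: the energy of step [i] is known before the step, so the
   killed integrand is still predictable. *)
pose xi' j i x := xi j i x * (if \sum_(k < i.+1) q k x <= delta then 1 else 0).
have xiT j i : (j < J)%N -> (i < n)%N -> measurable_fun setT (xi j i).
  by move=> jJ iN; apply: measurable_wrtE (mxi _ _ jJ iN); exact: GT (ltnW iN).
have mq k i : (k <= i)%N -> (i < n)%N -> measurable_wrt (G i) (q k).
  move=> ki iN.
  have GG : G k `<=` G i.
    elim: i ki iN => [|i ih]; first by rewrite leqn0 => /eqP -> _ B.
    rewrite leq_eqVlt => /predU1P[-> _ B//|]; rewrite ltnS => ki iN.
    by apply: subset_trans (ih ki (ltnW iN)) _; apply: GS; exact: ltnW.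
  apply: measurable_wrtS GG _.
  have kn := leq_ltn_trans ki iN.
  apply: (measurable_wrt_sum (sG (ltnW kn))) => j _.
  apply: (measurable_wrtM (sG (ltnW kn))); last exact: measurable_wrt_cst (sG (ltnW kn)) _.
  apply: (@measurable_wrt_comp _ _ _ _ (fun y : R => y ^+ 2)); first exact: measurable_funX.
  exact: mxi.
have mxi' j i : (j < J)%N -> (i < n)%N -> measurable_wrt (G i) (xi' j i).
  move=> jJ iN; apply: (measurable_wrtM (sG (ltnW iN))); first exact: mxi.
  apply: (measurable_wrt_indic_le (X := fun x => \sum_(k < i.+1) q k x)).
  by apply: (measurable_wrt_sum (sG (ltnW iN))) => k _; apply: mq => //; rewrite -ltnS.
have v0 i : (i < n)%N -> 0 <= v i by move=> iN; exact/ltW/(incr_var_gt0 (incr iN)).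
(* [v i] is known to be nonnegative only for [i < n], whereas [killed_sum_le] asks for a sequence
   that is nonnegative everywhere. *)
pose q' i x := if (i < n)%N then q i x else 0.
have q0 i x : 0 <= q' i x.
  rewrite /q'; case: ifP => // iN; apply: sumr_ge0 => j _.
  by rewrite mulr_ge0 ?sqr_ge0 ?v0.
have xi'E x : \sum_(i < n) \sum_(j < J) xi' j i x ^+ 2 * v i <= delta.
  apply: le_trans (killed_sum_le n (q0 ^~ x) d0).
  apply: ler_sum => i _; rewrite /q' ltn_ord /q mulr_suml.
  apply: ler_sum => j _; rewrite /xi' exprMn.
  have -> : \sum_(k < i.+1) (if (k < n)%N then q k x else 0) = \sum_(k < i.+1) q k x.
    by apply: eq_bigr => k _; rewrite ifT// (leq_ltn_trans _ (ltn_ord i))// -ltnS.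
  by case: ifP => _; rewrite ?expr1n ?expr0n/= ?mulr1 ?mulr0 ?mul0r.
have mxi'T j i : (j < J)%N -> (i < n)%N -> measurable_fun setT (xi' j i).
  by move=> jJ iN; apply: measurable_wrtE (mxi' _ _ jJ iN); exact: GT (ltnW iN).
have mxi'2 j i : (j < J)%N -> (i < n)%N ->
    measurable_fun setT (fun x => (xi' j i x ^+ 2 * v i)%:E).
  move=> jJ iN; apply/measurable_EFinP; apply: measurable_funM => //.
  by apply: measurable_funX; exact: mxi'T.
have xi'2 (j i : nat) : (j < J)%N -> (i < n)%N ->
    (\int[P]_x (xi' j i x ^+ 2 * v i)%:E < +oo)%E.
  move=> jJ iN; apply: (@le_lt_trans _ _ (\int[P]_x (cst delta%:E x))%E); last first.
    by rewrite integral_cst//=; rewrite probability_setT mule1 ltry.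
  apply: ge0_le_integral => //; last 2 first.
  - exact: mxi'2.
  - move=> x _; rewrite lee_fin; apply: le_trans (xi'E x).
    rewrite (bigD1 (Ordinal iN))//= (bigD1 (Ordinal jJ))//= -addrA lerDl addr_ge0//.
      by apply: sumr_ge0 => k _; rewrite mulr_ge0 ?sqr_ge0 ?v0.
    apply: sumr_ge0 => k _; apply: sumr_ge0 => l _.
    by rewrite mulr_ge0 ?sqr_ge0 ?v0.
  - by move=> x _; rewrite lee_fin mulr_ge0 ?sqr_ge0 ?v0.
pose S' x := \sum_(j < J) (\sum_(i < n) xi' j i x * eta i x) ^+ 2.
pose S x := \sum_(j < J) (\sum_(i < n) xi j i x * eta i x) ^+ 2.
have etaT i : (i < n)%N -> measurable_fun setT (eta i).
  by move=> iN; exact: measurable_wrtE (GT iN) (incr_meas (incr iN)).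
have mS'j (j : 'I_J) : measurable_fun setT (fun x => (\sum_(i < n) xi' j i x * eta i x) ^+ 2).
  apply: measurable_funX; apply: measurable_sum => i.
  by apply: measurable_funM; [exact: mxi'T|exact: etaT].
have mS' : measurable_fun setT S' by exact: measurable_sum.
have mS : measurable_fun setT S.
  apply: measurable_sum => j; apply: measurable_funX; apply: measurable_sum => i.
  by apply: measurable_funM; [exact: xiT|exact: etaT].
have S'0 x : 0 <= S' x by apply: sumr_ge0 => j _; exact: sqr_ge0.
have S'int : (\int[P]_x (S' x)%:E <= delta%:E)%E.
  rewrite (eq_integral (fun x => \sum_(j < J) ((\sum_(i < n) xi' j i x * eta i x) ^+ 2)%:E)%E); last first.
    by move=> x _; rewrite sumEFin.
  rewrite ge0_integral_sum//; last 2 first.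
  - by move=> j; exact/measurable_EFinP.
  - by move=> j x _; rewrite lee_fin sqr_ge0.
  apply: (@le_trans _ _ (\sum_(j < J) \sum_(i < n) \int[P]_x (xi' j i x ^+ 2 * v i)%:E)%E).
    apply: lee_sum => j _.
    have [||] := @martingale_sum_L2 (xi' j) n (leqnn n); last by [].
    - by move=> i iN; exact: mxi'.
    - by move=> i iN; exact: xi'2.
  rewrite exchange_big /=.
  under eq_bigr => i _.
    rewrite -ge0_integral_sum//; last 2 first.
    - by move=> j; exact: mxi'2.
    - by move=> j x _; rewrite lee_fin mulr_ge0 ?sqr_ge0 ?v0.
    over.
  rewrite -ge0_integral_sum//; last 2 first.
  - by move=> i; apply: emeasurable_sum => j; exact: mxi'2.
  - by move=> i x _; apply: sume_ge0 => j _; rewrite lee_fin mulr_ge0 ?sqr_ge0 ?v0.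
  apply: (@le_trans _ _ (\int[P]_x (cst delta%:E x))%E); last first.
    by rewrite integral_cst//=; rewrite probability_setT mule1.
  apply: ge0_le_integral => //.
  - move=> x _; apply: sume_ge0 => i _; apply: sume_ge0 => j _.
    by rewrite lee_fin mulr_ge0 ?sqr_ge0 ?v0.
  - by apply: emeasurable_sum => i; apply: emeasurable_sum => j; exact: mxi'2.
  - move=> x _; under eq_bigr do rewrite sumEFin.
    by rewrite sumEFin lee_fin.
have mEn : measurable [set x | delta < \sum_(i < n) q i x].
  rewrite -[X in measurable X]setTI; apply: measurable_fun_ltr => //.
  apply: measurable_sum => i; apply: measurable_sum => j.
  by apply: measurable_funM => //; apply: measurable_funX; exact: xiT.
have mlevel (Z : T -> R) : measurable_fun setT Z -> measurable [set x | eps <= Z x].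
  by move=> mZ; rewrite -[X in measurable X]setTI; exact: measurable_fun_ler.
(* On [A], either the energy exceeds [delta], or nothing has been killed and [S' = S]. Markov's
   inequality handles [S']. *)
apply: (@le_trans _ _ (P ([set x | eps <= S' x] `|` (A `&` [set x | delta < \sum_(i < n) q i x])))).
  apply: le_measure; rewrite ?inE.
  - by apply: measurableI => //; exact: mlevel.
  - by apply: measurableU; [exact: mlevel|exact: measurableI].
  move=> x [Ax /= eS].
  have [le|gt] := leP (\sum_(i < n) q i x) delta; last by right.
  left => /=; rewrite /S'.
  under eq_bigr => j _.
    under eq_bigr => i _.
      rewrite /xi' ifT; last first.
        apply: le_trans le.
        rewrite (big_ord_widen n (q ^~ x) (ltn_ord i)) [leRHS](bigID (fun k : 'I_n => (k < i.+1)%N)) /=.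
        rewrite lerDl; apply: sumr_ge0 => k _.
        by have := q0 k x; rewrite /q' ltn_ord.
      rewrite mulr1.
      over.
    over.
  exact: eS.
have mS'l := mlevel _ mS'; have mAE := measurableI _ _ mA mEn.
apply: (le_trans (measureU2 P mS'l mAE)).
apply: leeD => //.
apply: le_trans (markov_ineq P mS' S'0 e0) _.
rewrite mulrC EFinM; apply: lee_wpmul2l => //.
by rewrite lee_fin invr_ge0 ltW.
Qed.

End stochastic_sums.

(** * Gaussian moments and Wiener increments *)

Section normal_moments.
Context (R : realType).
Local Notation mu := (@lebesgue_measure R).
Implicit Types s : R.

(** The Radon-Nikodym derivative of the normal law agrees almost everywhere with its density, both
    having the same integral over every measurable set. *)
Lemma ge0_integral_normal_prob s (f : R -> R) :
  measurable_fun setT f -> (forall x, 0 <= f x) ->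
  (\int[normal_prob 0 s]_x (f x)%:E = \int[mu]_x (f x * normal_pdf 0 s x)%:E)%E.
Proof.
move=> mf f0.
pose nu : {finite_measure set _ -> \bar R} := normal_prob (0 : R) s.
have dom : nu `<< mu := normal_prob_dominates (0 : R) s.
have mpdf : measurable_fun setT (EFin \o normal_pdf (0 : R) s).
  by apply/measurable_EFinP; exact: measurable_normal_pdf.
have fi := Radon_Nikodym_SigmaFinite.f_integrable dom.
have /= <- := @Radon_Nikodym_SigmaFinite.change_of_variables _ _ _ nu mu dom
  (EFin \o f) setT (fun x => f0 x) measurableT (iffRL (measurable_EFinP _ _) mf).
apply: ae_eq_integral => //.
- apply: emeasurable_funM; first exact/measurable_EFinP.
  exact: measurable_int fi.
- apply/measurable_EFinP; apply: measurable_funM => //.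
  exact: measurable_normal_pdf.
under [X in ae_eq _ _ _ X]eq_fun do rewrite EFinM.
apply: ae_eqe_mul2l.
apply: integral_ae_eq => //.
by move=> E _ mE; rewrite -Radon_Nikodym_SigmaFinite.f_integral.
Qed.

Lemma normal_pdf_scale s (x : R) : 0 < s ->
  normal_pdf 0 s (s * x) * s = normal_pdf 0 1 x.
Proof.
move=> s0; rewrite !normal_pdfE ?gt_eqF ?oner_neq0//= /normal_peak /normal_fun.
rewrite !subr0 exprMn expr1n mulrAC; congr (_ * expR _).
  rewrite -!mulrnAr sqrtrM ?sqr_ge0// sqrtr_sqr gtr0_norm// mul1r.
  by rewrite invfM mulrAC mulVf ?mul1r// gt_eqF.
by field; rewrite gt_eqF.
Qed.

(** Substitution [x -> s x]. Even exponents keep the integrand nonnegative, as the substitution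
    theorem requires. *)
Lemma normal_moment_scale s (p : nat) : 0 < s ->
  (\int[mu]_x (x ^+ p.*2 * normal_pdf 0 s x)%:E =
   (s ^+ p.*2)%:E * \int[mu]_x (x ^+ p.*2 * normal_pdf 0 1 x)%:E)%E.
Proof.
move=> s0.
pose F (x : R^o) : R^o := s * x.
have F' : F^`()%classic = cst s.
  by apply/funext => x; rewrite /F derive1E deriveM// derive_id derive_cst scaler0 addr0 scaler1.
have ev (x : R) : 0 <= x ^+ p.*2 by rewrite -mul2n exprM exprn_ge0 ?sqr_ge0.
have scaleE (x : R) : (s * x) ^+ p.*2 * normal_pdf 0 s (s * x) * s =
    s ^+ p.*2 * (x ^+ p.*2 * normal_pdf 0 1 x).
  by rewrite -(normal_pdf_scale x s0) exprMn; ring.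
rewrite (@increasing_ge0_integration_by_substitutionT _ F).
- rewrite F' -ge0_integralZl//.
  + apply: eq_integral => x _; rewrite -EFinM; congr EFin.
    exact: scaleE.
  + apply/measurable_EFinP; apply: measurable_funM; first exact: measurable_funX.
    exact: measurable_normal_pdf.
  + by move=> x _; rewrite lee_fin mulr_ge0// normal_pdf_ge0.
  + by rewrite lee_fin.
- by move=> x y xy; rewrite /F ltr_pM2l.
- by rewrite F' => ?; exact: cvg_cst.
- by rewrite F'; exact: is_cvg_cst.
- by rewrite F'; exact: is_cvg_cst.
- by move=> x; rewrite /F.
- by apply/gt0_cvgMrNy.
- by apply/gt0_cvgMry.
- move=> x; apply: cvgM; first exact: exprn_continuous.
  by apply: continuous_normal_pdf; rewrite gt_eqF.
- by move=> x; rewrite mulr_ge0// normal_pdf_ge0.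
Qed.

(** Comparison with the normal density of standard deviation 2, whose total mass is 1. *)
Lemma normal_moment4_lty :
  (\int[mu]_x (x ^+ 4 * normal_pdf 0 1 x)%:E < +oo)%E.
Proof.
(* The two densities differ by [exp(3u/8)] with [u = x^2], up to the peaks. Since
   [(1 + 3u/16)^2 <= exp(3u/8)], [u^2] is at most [(16/3)^2 exp(3u/8)], and 64 exceeds
   [(16/3)^2]. *)
pose c : R := 64 * normal_peak 1 / normal_peak 2.
have n2 : (2 : R) != 0 by [].
apply: (@le_lt_trans _ _ (\int[mu]_x (c%:E * (normal_pdf 0 2 x)%:E))%E); last first.
  rewrite integralZl//; last exact: integrable_normal_pdf.
  by rewrite integral_normal_pdf mule1 ltry.
apply: ge0_le_integral => //.
- by move=> x _; rewrite lee_fin mulr_ge0 ?normal_pdf_ge0// exprn_even_ge0.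
- apply/measurable_EFinP; apply: measurable_funM; first exact: measurable_funX.
  exact: measurable_normal_pdf.
- apply/measurable_EFinP; apply: measurable_funM => //.
  exact: measurable_normal_pdf.
move=> x _; rewrite -EFinM lee_fin.
rewrite !normal_pdfE ?oner_neq0//=.
have -> : c * (normal_peak 2 * normal_fun 0 2 x) = normal_peak 1 * (64 * normal_fun 0 2 x).
  by rewrite /c; field; rewrite gt_eqF// normal_peak_gt0.
rewrite mulrCA ler_wpM2l ?normal_peak_ge0//.
rewrite /normal_fun !subr0.
have -> : - x ^+ 2 / (1 ^+ 2 *+ 2) = - (3 / 8 * x ^+ 2) + - x ^+ 2 / (2 ^+ 2 *+ 2).
  by field.
rewrite expRD mulrA ler_wpM2r ?expR_ge0// expRN ler_pdivrMr ?expR_gt0//.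
set u := x ^+ 2; have u0 : 0 <= u by exact: sqr_ge0.
have -> : 3 / 8 * u = 3 / 16 * u + 3 / 16 * u by field.
have e0 : 1 + 3 / 16 * u <= expR (3 / 16 * u) by exact: expR_ge1Dx.
rewrite expRD (_ : x ^+ 4 = u ^+ 2); last by rewrite /u -exprM.
have : (1 + 3 / 16 * u) * (1 + 3 / 16 * u) <= expR (3 / 16 * u) * expR (3 / 16 * u).
  by apply: ler_pM => //; nra.
nra.
Qed.

(** Indexed by half of the exponent: [normal_moment 1] and [normal_moment 2] are the second and
    fourth moments of the standard normal law. *)
Definition normal_moment (p : nat) : R :=
  fine (\int[mu]_x (x ^+ p.*2 * normal_pdf 0 1 x)%:E)%E.

Lemma normal_moment_ge0 p : 0 <= normal_moment p.
Proof.
apply: fine_ge0; apply: integral_ge0 => x _.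
by rewrite lee_fin mulr_ge0 ?normal_pdf_ge0// -mul2n exprM exprn_ge0 ?sqr_ge0.
Qed.

(** Finiteness follows from [x^(2p) <= 1 + x^4]. *)
Lemma normal_momentE p : (p <= 2)%N ->
  (\int[mu]_x (x ^+ p.*2 * normal_pdf 0 1 x)%:E = (normal_moment p)%:E)%E.
Proof.
move=> p2; have ev (x : R) q : 0 <= x ^+ q.*2 by rewrite -mul2n exprM exprn_ge0 ?sqr_ge0.
rewrite /normal_moment fineK// ge0_fin_numE; last first.
  by apply: integral_ge0 => x _; rewrite lee_fin mulr_ge0 ?normal_pdf_ge0.
have m q : measurable_fun setT (fun x : R => (x ^+ q.*2 * normal_pdf 0 1 x)%:E).
  apply/measurable_EFinP; apply: measurable_funM; first exact: measurable_funX.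
  exact: measurable_normal_pdf.
apply: (@le_lt_trans _ _ (\int[mu]_x ((normal_pdf 0 1 x)%:E + (x ^+ 4 * normal_pdf 0 1 x)%:E))%E).
  apply: ge0_le_integral => //.
  - by move=> x _; rewrite lee_fin mulr_ge0 ?normal_pdf_ge0.
  - exact: m.
  - apply: emeasurable_funD; last exact: (m 2%N).
    by apply/measurable_EFinP; exact: measurable_normal_pdf.
  move=> x _; rewrite -EFinD lee_fin.
  have -> : x ^+ 4 = (x ^+ 2) ^+ 2 by rewrite -exprM.
  rewrite -mul2n exprM; move: p2; have := sqr_ge0 x; have := normal_pdf_ge0 0 1 x.
  set u := x ^+ 2; set g := normal_pdf _ _ _ => g0 u0.
  case: p => [|[|[|//]]] _; rewrite ?expr0 ?expr1.
  + by rewrite mul1r lerDl mulr_ge0 ?sqr_ge0.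
  + have := sqr_ge0 (u - 2^-1); nra.
  + by rewrite lerDr.
rewrite ge0_integralD//.
- rewrite integral_normal_pdf lte_add_pinfty ?ltry//.
  exact: normal_moment4_lty.
- by move=> x _; rewrite lee_fin normal_pdf_ge0.
- by apply/measurable_EFinP; exact: measurable_normal_pdf.
- by move=> x _; rewrite lee_fin mulr_ge0 ?normal_pdf_ge0// (ev x 2%N).
- exact: (m 2%N).
Qed.

(** Reflection [x -> -x], applied to the positive and negative parts separately so that only
    nonnegative integrands occur. It yields the zero mean in [gaussian_mean]. *)
Lemma normal_symmetric s : 0 < s ->
  (\int[mu]_x (Num.max x 0 * normal_pdf 0 s x)%:E =
   \int[mu]_x (Num.max (- x) 0 * normal_pdf 0 s x)%:E)%E.
Proof.
move=> s0.
have pdfN (x : R) : normal_pdf 0 s (- x) = normal_pdf 0 s x.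
  by rewrite !normal_pdfE ?gt_eqF//= /normal_fun !subr0 sqrrN.
have cpdf : continuous (normal_pdf (0 : R) s).
  by apply: continuous_normal_pdf; rewrite gt_eqF.
have e1 : (\int[mu]_x (Num.max x 0 * normal_pdf 0 s x)%:E =
    \int[mu]_(x in `[0%R, +oo[) (x * normal_pdf 0 s x)%:E)%E.
  rewrite [RHS]integral_mkcond; apply: eq_integral => x _.
  rewrite patchE mem_setE in_itv /= andbT; case: ifPn => x0; first by rewrite max_l.
  by rewrite max_r ?mul0r// ltW// ltNge.
have e2 : (\int[mu]_x (Num.max (- x) 0 * normal_pdf 0 s x)%:E =
    \int[mu]_(x in `]-oo, (- 0)%R]) (- x * normal_pdf 0 s x)%:E)%E.
  rewrite [RHS]integral_mkcond; apply: eq_integral => x _.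
  rewrite patchE mem_setE in_itv /= oppr0; case: ifPn => x0.
    by rewrite max_l// oppr_ge0.
  by rewrite max_r ?mul0r// oppr_le0 ltW// ltNge.
rewrite e1 e2 (@ge0_integration_by_substitutionNy _ (fun x => - x * normal_pdf 0 s x)).
- by apply: eq_integral => x _ /=; rewrite opprK pdfN.
- apply: continuous_subspaceT => x; apply: cvgM; last exact: cpdf.
  by apply: cvgN.
- move=> x; rewrite in_itv /= oppr0 => x0.
  by rewrite mulr_ge0 ?normal_pdf_ge0// oppr_ge0 ltW.
Qed.

End normal_moments.

Section gaussian_variable.
Context d (T : measurableType d) (R : realType) (P : probability T R).
Variables (X : T -> R) (s : R).
Hypotheses (mX : measurable_fun setT X) (s0 : 0 < s).
Hypothesis lawX : forall B : set R, measurable B -> P (X @^-1` B) = normal_prob 0 s B.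

Lemma gaussian_integral (f : R -> R) : measurable_fun setT f -> (forall x, 0 <= f x) ->
  (\int[P]_x (f (X x))%:E = \int[lebesgue_measure]_x (f x * normal_pdf 0 s x)%:E)%E.
Proof.
move=> mf f0; rewrite -ge0_integral_normal_prob//.
pose X' : {mfun T >-> measurableTypeR R} :=
  HB.pack X (isMeasurableFun.Build _ _ T (measurableTypeR R) X mX).
rewrite -(ge0_integral_distribution (P := P) X' (f := (fun x : R => (f x)%:E)))//.
  have := @eq_measure_integral _ (measurableTypeR R) R setT (normal_prob (0 : R) s)
    (distribution P X') (EFin \o f).
  by apply => A mA _; exact: lawX.
exact/measurable_EFinP.
Qed.

Lemma gaussian_moment (p : nat) : (p <= 2)%N ->
  (\int[P]_x (X x ^+ p.*2)%:E = (s ^+ p.*2 * normal_moment R p)%:E)%E.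
Proof.
move=> p2; rewrite (@gaussian_integral (fun x => x ^+ p.*2)).
- by rewrite normal_moment_scale// normal_momentE.
- exact: measurable_funX.
- by move=> x; rewrite -mul2n exprM exprn_ge0 ?sqr_ge0.
Qed.

Lemma gaussian_mean : (\int[P]_x (X x)%:E = 0)%E.
Proof.
have iX : P.-integrable setT (EFin \o X).
  by apply: sqr_integrable_integrable => //; rewrite (gaussian_moment (p := 1))// ltry.
have Xp : (\int[P]_x ((fun x => (X x)%:E)^\+ x) = \int[P]_x (Num.max (X x) 0)%:E)%E.
  by apply: eq_integral => x _; rewrite funeposE /= EFin_max.
have Xn : (\int[P]_x ((fun x => (X x)%:E)^\- x) = \int[P]_x (Num.max (- X x) 0)%:E)%E.
  by apply: eq_integral => x _; rewrite funenegE /= EFin_max.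
rewrite integralE Xn (@gaussian_integral (fun x => Num.max (- x) 0)); last 2 first.
- by apply: measurable_maxr => //; exact: measurable_funN.
- by move=> x; rewrite le_max lexx orbT.
rewrite -normal_symmetric// -(@gaussian_integral (fun x => Num.max x 0)); last 2 first.
- exact: measurable_maxr.
- by move=> x; rewrite le_max lexx orbT.
by rewrite -Xp subee//; exact: integrable_pos_fin_num iX.
Qed.

End gaussian_variable.

Section wiener_increments.
Context d (Omega : measurableType d) (R : realType) (P : probability Omega R).
Variables (theta T : R) (F : R -> set (set Omega)) (w : R -> Omega -> R).
Hypotheses (hF : filtration P theta T F) (hw : wiener P theta T w).
Hypotheses (w_adapted : adapted F theta T w)
  (w_indep : future_increments_independent P theta T F w).

Lemma wiener_diff_wrt q s : theta <= q -> q <= s -> s <= T ->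
  measurable_wrt (F s) (fun x => w s x - w q x).
Proof.
move=> tq qs sT; have sin : s \in `[theta, T] by rewrite in_itv /= sT (le_trans tq).
apply: (measurable_wrtB (filt_sigma hF sin)); first exact: w_adapted.
apply: measurable_wrtS (w_adapted (_ : q \in _)); first exact: filt_mono hF _ _ tq qs sT.
by rewrite in_itv /= tq (le_trans qs).
Qed.

(** The [+ 1] makes the variance bound positive, knowing only that the moment is nonnegative. *)
Lemma wiener_increment q s : theta <= q -> q < s -> s <= T ->
  increment P (F q) (F s) ((normal_moment R 1 + 1) * (s - q)) (fun x => w s x - w q x).
Proof.
move=> tq qs sT.
have sin : s \in `[theta, T] by rewrite in_itv /= sT (le_trans tq)// ltW.
have m := wiener_diff_wrt tq (ltW qs) sT.
have mX := measurable_wrtE (filt_event hF sin) m.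
have sq0 : 0 < Num.sqrt (s - q) by rewrite sqrtr_gt0 subr_gt0.
have law := wiener_gauss hw tq qs sT.
split => //.
- by rewrite mulr_gt0 ?subr_gt0// ltr_wpDl// normal_moment_ge0.
- by move=> A B FA mB; exact: (w_indep tq (lexx q) qs sT FA mB).
- exact: gaussian_mean mX sq0 law.
- rewrite (gaussian_moment mX sq0 law (p := 1))// lee_fin.
  have h0 : 0 <= s - q by rewrite subr_ge0 ltW.
  by rewrite sqr_sqrtr// mulrC ler_wpM2r// lerDl.
Qed.

(** The compensated square is centered, and its variance is at most the fourth moment of the
    increment, hence of order [(s - q)^2]: one order smaller than the step, which is why its sums
    vanish. *)
Lemma wiener_qv_increment q s : theta <= q -> q < s -> s <= T ->
  increment P (F q) (F s) ((normal_moment R 2 + 1) * (s - q) ^+ 2)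
    (fun x => (w s x - w q x) ^+ 2 - normal_moment R 1 * (s - q)).
Proof.
move=> tq qs sT.
have sin : s \in `[theta, T] by rewrite in_itv /= sT (le_trans tq)// ltW.
have m := wiener_diff_wrt tq (ltW qs) sT.
have mX := measurable_wrtE (filt_event hF sin) m.
have sq0 : 0 < Num.sqrt (s - q) by rewrite sqrtr_gt0 subr_gt0.
have law := wiener_gauss hw tq qs sT.
set K := normal_moment R 1; set h := s - q.
have h0 : 0 < h by rewrite subr_gt0.
have mg : measurable_fun setT (fun x : R => x ^+ 2 - K * h).
  by apply: measurable_funB => //; exact: measurable_funX.
pose X x := w s x - w q x.
have X2 : (\int[P]_x (X x ^+ 2)%:E = (K * h)%:E)%E.
  by rewrite (gaussian_moment mX sq0 law (p := 1))// (sqr_sqrtr (ltW h0)) mulrC.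
have X4 : (\int[P]_x (X x ^+ 4)%:E = (normal_moment R 2 * h ^+ 2)%:E)%E.
  rewrite (gaussian_moment mX sq0 law (p := 2))// mulrC; congr (_ * _)%:E.
  by rewrite (_ : 2.*2 = (2 * 2)%N)// exprM (sqr_sqrtr (ltW h0)).
have iX2 : P.-integrable setT (fun x => (X x ^+ 2)%:E).
  apply/integrableP; split; first by apply/measurable_EFinP; exact: measurable_funX.
  by under eq_integral do rewrite /= ger0_norm ?sqr_ge0//; rewrite X2 ltry.
have iX4 : P.-integrable setT (fun x => (X x ^+ 4)%:E).
  apply/integrableP; split; first by apply/measurable_EFinP; exact: measurable_funX.
  under eq_integral do rewrite /= ger0_norm ?exprn_even_ge0//.
  by rewrite X4 ltry.
split => //.
- by rewrite mulr_gt0 ?exprn_gt0// ltr_wpDl// normal_moment_ge0.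
- exact: (measurable_wrt_comp mg m).
- move=> A B FA mB.
  apply: (w_indep tq (lexx q) qs sT FA (B := (fun x : R => x ^+ 2 - K * h) @^-1` B)).
  by rewrite -[X in measurable X]setTI; exact: mg.
- under eq_integral do rewrite EFinB.
  rewrite integralB//; last exact: finite_measure_integrable_cst.
  rewrite X2 integral_cst//=; rewrite probability_setT mule1.
  by rewrite -EFinB subrr.
- rewrite (eq_integral (fun x => ((X x ^+ 4)%:E +
      ((- (K * h) *+ 2)%:E * (X x ^+ 2)%:E + ((K * h) ^+ 2)%:E))%E)); last first.
    by move=> x _; rewrite -EFinM -!EFinD; congr EFin; rewrite /X; ring.
  rewrite integralD//; last first.
    apply: integrableD => //; first exact: integrableZl.
    exact: finite_measure_integrable_cst.
  rewrite integralD//; [|exact: integrableZl|exact: finite_measure_integrable_cst].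
  rewrite integralZl// X2 X4 integral_cst//=; rewrite probability_setT mule1.
  rewrite -EFinM -!EFinD lee_fin.
  have := sqr_ge0 (K * h); have := sqr_ge0 h; nra.
Qed.

End wiener_increments.

(** * Grids and integrals of simple processes *)

Section grids.
Variable R : realType.
Implicit Types (a b x : R) (r : nat -> R).

Record is_grid a b (N : nat) r : Prop := IsGrid {
  grid_left : r 0%N = a ;
  grid_right : r N = b ;
  grid_incr : forall i, (i < N)%N -> r i < r i.+1 }.

(** The point [x] is interior to no cell, so a step function that jumps only at such points is
    constant on each half-open cell. *)
Definition refines (N : nat) r x := forall i, (i < N)%N -> x <= r i \/ r i.+1 <= x.

Lemma grid_mono a b N r i j : is_grid a b N r -> (i <= j <= N)%N -> r i <= r j.
Proof.
move=> [_ _ rS] /andP[]; elim: j => [|j ih]; first by rewrite leqn0 => /eqP ->.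
rewrite leq_eqVlt => /predU1P[->//|]; rewrite ltnS => ij jN.
by apply: le_trans (ih ij (ltnW jN)) _; exact/ltW/rS.
Qed.

Lemma grid_itv a b N r i : is_grid a b N r -> (i <= N)%N -> a <= r i <= b.
Proof.
move=> g iN; rewrite -(grid_left g) -(grid_right g).
by rewrite !(grid_mono g) ?leq0n ?iN ?leqnn.
Qed.

(** Induction on the points: one that falls strictly inside cuts the interval in two, and the grids
    of both halves are concatenated. *)
Lemma grid_exists a b (s : seq R) : a < b ->
  exists N r, is_grid a b N r /\ {in s, forall x, refines N r x}.
Proof.
elim: s a b => [|x s ih] a b ab.
  by exists 1%N, (fun i => if i == 0%N then a else b); split => //; split => // -[].
have [xa|ax] := leP x a.
  have [N [r [g h]]] := ih _ _ ab; exists N, r; split => // z.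
  rewrite inE => /predU1P[->|]; last exact: h.
  by move=> i iN; left; apply: le_trans xa _; case/andP : (grid_itv g (ltnW iN)).
have [bx|xb] := leP b x.
  have [N [r [g h]]] := ih _ _ ab; exists N, r; split => // z.
  rewrite inE => /predU1P[->|]; last exact: h.
  by move=> i iN; right; apply: le_trans bx; case/andP : (grid_itv g iN).
have [N1 [r1 [g1 h1]]] := ih _ _ ax; have [N2 [r2 [g2 h2]]] := ih _ _ xb.
pose r i := if (i <= N1)%N then r1 i else r2 (i - N1)%N.
have rr i : (N1 <= i)%N -> r i = r2 (i - N1)%N.
  rewrite /r; case: ltngtP => // <- _.
  by rewrite subnn (grid_right g1) (grid_left g2).
exists (N1 + N2)%N, r; split.
  split; first by rewrite /r leq0n (grid_left g1).
    by rewrite rr ?leq_addr// addKn (grid_right g2).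
  move=> i iN; have [iN1|iN1] := ltnP i N1.
    by rewrite /r (ltnW iN1) iN1; exact: grid_incr g1 _ iN1.
  rewrite !rr ?(leqW iN1)// subSn//; apply: grid_incr g2 _ _.
  by rewrite ltn_subLR.
move=> z zs i iN; have [iN1|iN1] := ltnP i N1.
  rewrite /r (ltnW iN1) iN1; move: zs; rewrite inE => /predU1P[->|zs].
    by right; case/andP : (grid_itv g1 iN1).
  exact: h1.
have iN2 : (i - N1 < N2)%N by rewrite ltn_subLR.
rewrite !rr ?(leqW iN1)// subSn//; move: zs; rewrite inE => /predU1P[->|zs].
  by left; case/andP : (grid_itv g2 (ltnW iN2)).
exact: h2.
Qed.

Lemma step_integral a b N r (h : R -> R) : is_grid a b N r ->
  (forall x, 0 <= h x) ->
  (forall i x, (i < N)%N -> x \in `[r i, r i.+1[ -> h x = h (r i)) ->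
  measurable_fun `[a, b[ h /\
  (\int[lebesgue_measure]_(x in `[a, b[) (h x)%:E =
   (\sum_(i < N) h (r i) * (r i.+1 - r i))%:E)%E.
Proof.
move=> g h0 hc; rewrite -(grid_left g) -(grid_right g).
have : (N <= N)%N by [].
elim: {-2}N => [|n ih] nN.
  rewrite big_ord0 (_ : `[r 0%N, r 0%N[%classic = set0).
    by rewrite integral_set0; split => //; exact: measurable_fun_set0.
  by rewrite -subset0 => x /=; rewrite in_itv /= => /andP[/le_lt_trans/[apply]]; rewrite ltxx.
have [mn In] := ih (ltnW nN).
have rn := grid_incr g nN.
have r0n : r 0%N <= r n by apply: (grid_mono g); rewrite leq0n ltnW.
have itvE : `[r 0%N, r n.+1[%classic = `[r 0%N, r n[%classic `|` `[r n, r n.+1[%classic.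
  apply/seteqP; split=> x /=; rewrite !in_itv /=.
    move=> /andP[x0 xn]; have [xr|rx] := ltP x (r n); first by left; rewrite x0.
    by right; rewrite xn.
  by move=> [|] /andP[x0 xn]; [rewrite x0 (lt_trans xn)|rewrite xn (le_trans r0n)].
have mc : measurable_fun `[r n, r n.+1[ h.
  apply: (eq_measurable_fun (cst (h (r n)))) => //.
  by move=> x /set_mem xin; rewrite (hc n x nN).
have mh : measurable_fun `[r 0%N, r n.+1[ h by rewrite itvE measurable_funU.
split => //.
have disj : [disjoint `[r 0%N, r n[%classic & `[r n, r n.+1[%classic].
  rewrite disj_set2E; apply/eqP; rewrite -subset0 => x [] /=.
  by rewrite !in_itv /= => /andP[_ xn] /andP[/le_lt_trans /(_ xn)]; rewrite ltxx.
rewrite itvE ge0_integral_setU//; last 2 first.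
- by rewrite -itvE; exact/measurable_EFinP.
- by move=> x _; rewrite lee_fin.
rewrite In big_ord_recr /= EFinD; congr (_ + _)%E.
rewrite (eq_integral (cst (h (r n))%:E)); last first.
  by move=> x /set_mem xin; rewrite (hc n x nN).
rewrite integral_cst//= lebesgue_measure_itv /= lte_fin rn -EFinD -EFinM.
by [].
Qed.

End grids.

Section simple_process_theory.
Variables (Omega : Type) (R : realType).
Implicit Types (phi : simple_process Omega R) (X : R -> Omega -> R).

(** Isolated from [is_simple] because the step processes built on a grid from unbounded weights
    satisfy this part only. *)
Definition sp_mono phi := forall k, (k < sp_size phi)%N ->
  sp_time phi k <= sp_time phi k.+1.

(** On a cell free of jump times each summand is either completely active or constant. The
    integrator [X] is arbitrary, so that it can itself be a simple integral. *)
Lemma sp_integral_incr phi X (N : nat) (r : nat -> R) i omega :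
  sp_mono phi -> (forall k, (k <= sp_size phi)%N -> refines N r (sp_time phi k)) ->
  (i < N)%N -> r i < r i.+1 ->
  sp_integral X phi (r i.+1) omega - sp_integral X phi (r i) omega =
  sp_eval phi (r i) omega * (X (r i.+1) omega - X (r i) omega).
Proof.
move=> pm hr iN ri; rewrite /sp_integral /sp_eval -sumrB mulr_suml.
apply: eq_bigr => k _.
have k1 := hr k (ltnW (ltn_ord k)) i iN.
have k2 := hr k.+1 (ltn_ord k) i iN.
have kk := pm k (ltn_ord k).
rewrite indicE mem_setE in_itv /=.
case: k1 => [k1|k1].
  rewrite k1 (min_l k1) (min_l (le_trans k1 (ltW ri))).
  case: k2 => [k2|k2].
    rewrite (min_l k2) (min_l (le_trans k2 (ltW ri))) ltNge k2 /=; ring.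
  rewrite (min_r k2) (min_r (le_trans (ltW ri) k2)) (lt_le_trans ri k2) /=; ring.
have k3 := le_trans k1 kk.
rewrite (min_r k1) (min_r (le_trans (ltW ri) k1)).
rewrite (min_r k3) (min_r (le_trans (ltW ri) k3)).
rewrite leNgt (lt_le_trans ri k1) /=; ring.
Qed.

Lemma sp_eval_cst phi (N : nat) (r : nat -> R) i x omega :
  (forall k, (k <= sp_size phi)%N -> refines N r (sp_time phi k)) ->
  (i < N)%N -> x \in `[r i, r i.+1[ -> sp_eval phi x omega = sp_eval phi (r i) omega.
Proof.
move=> hr iN; rewrite in_itv /= => /andP[rx xr]; apply: eq_bigr => k _.
have ltE l : (l <= sp_size phi)%N -> (sp_time phi l <= x) = (sp_time phi l <= r i).
  move=> lp; case: (hr l lp i iN) => h; first by rewrite h (le_trans h rx).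
  by rewrite !leNgt (lt_le_trans xr h) (le_lt_trans rx (lt_le_trans xr h)).
congr (_ * _); rewrite !indicE !mem_setE !in_itv /=.
by rewrite !ltNge !ltE// ltnW.
Qed.

Lemma sp_integral_grid phi X a b (N : nat) (r : nat -> R) omega :
  is_grid a b N r ->
  sp_mono phi -> (forall k, (k <= sp_size phi)%N -> refines N r (sp_time phi k)) ->
  sp_integral X phi b omega - sp_integral X phi a omega =
  \sum_(i < N) sp_eval phi (r i) omega * (X (r i.+1) omega - X (r i) omega).
Proof.
move=> g pm hr; rewrite -{1}(grid_right g) -{1}(grid_left g).
rewrite -(telescope_sumr (fun i => sp_integral X phi (r i) omega) (leq0n N)).
rewrite big_mkord; apply: eq_bigr => i _.
by rewrite (sp_integral_incr X omega pm hr (ltn_ord i))//; exact: grid_incr g _ _.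
Qed.

End simple_process_theory.

Lemma sp_eval_wrt d (Omega : measurableType d) (R : realType) (P : probability Omega R)
    (theta T : R) (F : R -> set (set Omega)) (phi : simple_process Omega R) (r : R) :
  filtration P theta T F -> r \in `[theta, T] ->
  (forall k, (k < sp_size phi)%N -> theta <= sp_time phi k) ->
  (forall k, (k < sp_size phi)%N -> measurable_wrt (F (sp_time phi k)) (sp_val phi k)) ->
  measurable_wrt (F r) (sp_eval phi r).
Proof.
move=> hF rin ht hv; have sF := filt_sigma hF rin.
apply: (measurable_wrt_sum sF) => k _.
have [kr|rk] := leP (sp_time phi k) r.
  apply: (measurable_wrtM sF); last exact: measurable_wrt_cst.
  apply: measurable_wrtS (hv k (ltn_ord k)); apply: filt_mono hF _ _ _ _ _ => //.
    exact: ht.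
  by move: rin; rewrite in_itv /= => /andP[].
rewrite (_ : (fun x => _) = (fun=> 0)); first exact: measurable_wrt_cst.
apply/funext => x; rewrite indicE mem_setE in_itv /=.
by rewrite [_ <= r]leNgt rk /= mulr0.
Qed.

(** * Convergence in probability and Ito integrals *)

Section convergence_in_probability.
Context d (T : measurableType d) (R : realType) (P : probability T R).

Lemma ecvg0P (u : nat -> \bar R) : (forall n, 0 <= u n)%E ->
  (u @ \oo --> 0%E) <->
  (forall e : R, 0 < e -> \forall n \near \oo, (u n < e%:E)%E).
Proof.
move=> u0; split=> [/fine_cvgP[ufin /cvgrPdist_lt u_0] e e0|ue].
  near=> n; have un : u n \is a fin_num by near: n.
  rewrite -(fineK un) lte_fin -[X in X < _]ger0_norm ?fine_ge0//.
  rewrite -[X in `|X|]opprK normrN -sub0r.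
  by near: n; exact: u_0.
apply/fine_cvgP; split.
  near=> n; rewrite ge0_fin_numE//; apply: lt_le_trans (leey 1%:E).
  by near: n; exact: ue.
apply/cvgrPdist_lt => e e0; near=> n.
have une : (u n < e%:E)%E by near: n; exact: ue.
have un : u n \is a fin_num by rewrite ge0_fin_numE// (lt_le_trans une)// leey.
by rewrite sub0r normrN ger0_norm ?fine_ge0// -lte_fin fineK.
Unshelve. all: by end_near. Qed.

(** [P (B n)] is at most the probability of the union of the later events, which decreases to that
    of the limit superior, a null set here. *)
Lemma ae_near_prob0 (B : nat -> set T) : (forall n, measurable (B n)) ->
  (\forall x \ae P, \forall n \near \oo, ~ B n x) ->
  (fun n => P (B n)) @ \oo --> 0%E.
Proof.
move=> mB aeB.
have mL : measurable (lim_sup_set B).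
  by apply: bigcap_measurable => // k _; apply: bigcup_measurable => j _.
have L0 : P (lim_sup_set B) = 0%E.
  apply/(negligibleP _ mL); apply: negligibleS aeB => x Lx [N _ hN].
  by have [j /= Nj Bj] := Lx N I; exact: hN Nj Bj.
have h : (fun n => P (\bigcup_(k >= n) B k)) @ \oo --> P (lim_sup_set B).
  apply: lim_sup_set_cvg => //.
  by rewrite (le_lt_trans (probability_le1 _ _)) ?ltry//; exact: bigcup_measurable.
rewrite L0 in h.
apply: (squeeze_cvge _ (cvg_cst 0%E) h); apply: nearW => n.
rewrite measure_ge0 /= le_measure ?inE//; first exact: bigcup_measurable.
by move=> x Bx; exists n => /=.
Qed.

Lemma bigsetU_prob0 (K : nat) (B : nat -> nat -> set T) :
  (forall k n, measurable (B k n)) ->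
  (forall k, (k < K)%N -> (fun n => P (B k n)) @ \oo --> 0%E) ->
  (fun n => P (\big[setU/set0]_(k < K) B k n)) @ \oo --> 0%E.
Proof.
move=> mB; elim: K => [|K ih] h.
  by under eq_fun do rewrite big_ord0 measure0; exact: cvg_cst.
have ihK : (fun n => P (\big[setU/set0]_(k < K) B k n)) @ \oo --> 0%E.
  by apply: ih => k kK; apply: h; exact: ltnW.
have s : (fun n => P (\big[setU/set0]_(k < K) B k n) + P (B K n))%E @ \oo --> 0%E.
  by rewrite -[X in _ --> X]adde0; apply: cvgeD => //; exact: h.
apply: (squeeze_cvge _ (cvg_cst 0%E) s); apply: nearW => n.
rewrite measure_ge0 /= big_ord_recr; apply: measureU2 => //.
exact: bigsetU_measurable.
Qed.

(** Choose [n l] so that the [l]-th probability is below [2^-(l+1)] and apply the first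
    Borel-Cantelli lemma. The bound [l <= n l] lets limits in [n] be taken along the choice. *)
Lemma diagonal_borel_cantelli (B : nat -> nat -> set T) :
  (forall l n, measurable (B l n)) ->
  (forall l, (fun n => P (B l n)) @ \oo --> 0%E) ->
  exists2 n : nat -> nat, (forall l, (l <= n l)%N) &
    \forall x \ae P, \forall l \near \oo, ~ B l (n l) x.
Proof.
move=> mB B0.
have /choice[n hn] : forall l, exists n, (l <= n)%N /\ (P (B l n) < (1 / (2 ^ l.+1)%:R)%:E)%E.
  move=> l.
  have e0 : (0 : R) < 1 / (2 ^ l.+1)%:R by rewrite divr_gt0// ltr0n expn_gt0.
  have [N _ hN] := (ecvg0P (fun n => measure_ge0 P (B l n))).1 (B0 l) _ e0.
  by exists (maxn l N); rewrite leq_maxl; split => //; apply: hN; exact: leq_maxr.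
exists n => [l|]; first by have [] := hn l.
have mBn l : measurable (B l (n l)) by [].
have L0 := @lim_sup_set_cvg0 _ _ _ P _ mBn.
have {}L0 : P (lim_sup_set (fun l => B l (n l))) = 0%E.
  apply: L0.
  apply: (@le_lt_trans _ _ (1 : R)%:E); last exact: ltry.
  have h1 : (0 : R) <= 1 by [].
  apply: (le_trans _ (@epsilon_trick0 R 1 xpredT h1)).
  by apply: lee_nneseries => // l _; exact/ltW/(hn l).2.
have mL : measurable (lim_sup_set (fun l => B l (n l))).
  by apply: bigcap_measurable => // k _; apply: bigcup_measurable => j _.
apply: negligibleS (_ : P.-negligible (lim_sup_set (fun l => B l (n l)))); last exact/negligibleP.
move=> x /= nx k _; apply: contrapT => nex; apply: nx.
by exists k => // l /= kl Bx; apply: nex; exists l.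
Qed.

End convergence_in_probability.

Lemma sp_integral_measurable d (Omega : measurableType d) (R : realType)
    (P : probability Omega R) (theta T : R) (F : R -> set (set Omega))
    (w : R -> Omega -> R) (phi : simple_process Omega R) (t : R) :
  filtration P theta T F -> adapted F theta T w -> is_simple F theta T phi ->
  t \in `[theta, T] -> measurable_fun setT (sp_integral w phi t).
Proof.
move=> hF hw sphi tin; apply: measurable_sum => k.
have mw s : s \in `[theta, T] -> measurable_fun setT (w (Num.min s t)).
  move=> sin; have min : Num.min s t \in `[theta, T] by case: (leP s t).
  exact: measurable_wrtE (filt_event hF min) (hw _ min).
have kin := simple_time sphi (ltnW (ltn_ord k)).
apply: measurable_funM.
  exact: measurable_wrtE (filt_event hF kin) (simple_adapted sphi (ltn_ord k)).
apply: measurable_funB; apply: mw => //.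
exact: (simple_time sphi (ltn_ord k)).
Qed.

(* A diagonal choice of the approximating simple processes turns the          *)
(* convergence in probability at each fixed time into an almost sure rate,    *)
(* simultaneously at the finitely many times [t m k] of each stage [m].       *)
Lemma ito_integral_diagonal d (Omega : measurableType d) (R : realType)
    (P : probability Omega R) (theta T : R) (F : R -> set (set Omega))
    (w H I : R -> Omega -> R) (K : nat -> nat) (t : nat -> nat -> R) (e : nat -> R) :
  filtration P theta T F -> adapted F theta T w ->
  is_ito_integral P F theta T w H I ->
  (forall m k, (k < K m)%N -> t m k \in `[theta, T]) ->
  (forall m, 0 < e m) ->
  exists psi : nat -> simple_process Omega R,
    [/\ forall m, is_simple F theta T (psi m),
        \forall omega \ae P,
          (fun m => \int[lebesgue_measure]_(s in `[theta, T])
             ((sp_eval (psi m) s omega - H s omega) ^+ 2)%:E)%E @ \oo --> 0%E &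
        \forall omega \ae P, \forall m \near \oo, forall k, (k < K m)%N ->
          `|sp_integral w (psi m) (t m k) omega - I (t m k) omega| < e m].
Proof.
move=> hF hw [_ mI _ [phi [sphi phi2 phiI]]] tin e0.
(* Empty beyond [K m], where nothing is known about the times [t m k]. *)
pose E m k n := if (k < K m)%N then
  [set omega | e m <= `|sp_integral w (phi n) (t m k) omega - I (t m k) omega|] else set0.
have mE m k n : measurable (E m k n).
  rewrite /E; case: ifPn => // km.
  rewrite -[X in measurable X]setTI; apply: measurable_fun_ler => //.
  apply: measurableT_comp => //; apply: measurable_funB; last exact/mI/tin.
  exact: sp_integral_measurable hF hw (sphi n) (tin _ _ km).
pose B m n := \big[setU/set0]_(k < K m) E m k n.
have mB m n : measurable (B m n) by exact: bigsetU_measurable.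
have B0 m : (fun n => P (B m n)) @ \oo --> 0%E.
  apply: (@bigsetU_prob0 _ _ _ P (K m) (E m)) => // k km.
  by rewrite /E km; exact: phiI (tin _ _ km) _ (e0 m).
have [n nm hB] := diagonal_borel_cantelli mB B0.
exists (phi \o n); split => [m||]; first exact: sphi.
  apply: filterS phi2 => omega h.
  have ninf : n @ \oo --> \oo.
    move=> S [N _ hN]; exists N => // k Nk; apply: hN => /=.
    exact: leq_trans Nk (nm k).
  exact: cvg_comp ninf h.
apply: filterS hB => omega h; apply: filterS h => m nB k km.
rewrite ltNge; apply/negP => ele; apply: nB.
rewrite /B -(bigcup_mkord (K m) (fun k => E m k (n m))); exists k => //.
by rewrite /E km.
Qed.

Section grid_processes.
Variables (Omega : Type) (R : realType).
Implicit Types (c : nat -> Omega -> R) (X : R -> Omega -> R).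

Lemma grid_cell (a b : R) (n : nat) (t : nat -> R) (x : R) :
  is_grid a b n t -> x \in `[a, b[ -> exists2 k, (k < n)%N & x \in `[t k, t k.+1[.
Proof.
move=> g; rewrite in_itv /= -(grid_left g) -(grid_right g).
have : (n <= n)%N by [].
elim: {-2}n => [|m ih] mn /andP[x0 xm].
  by have := le_lt_trans x0 xm; rewrite ltxx.
have [xt|tx] := ltP x (t m).
  by have [||k km] := ih; rewrite ?(ltnW mn) ?x0 ?xt//; exists k => //; exact: ltnW.
by exists m => //; rewrite in_itv /= tx.
Qed.

Lemma step_eval (a b : R) (n : nat) (t : nat -> R) c (k : nat) (x : R) omega :
  is_grid a b n t -> (k < n)%N -> x \in `[t k, t k.+1[ ->
  sp_eval (SimpleProcess n t c) x omega = c k omega.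
Proof.
move=> g kn; rewrite in_itv /= => /andP[tx xt].
rewrite /sp_eval /= (bigD1 (Ordinal kn))//= big1 => [|l lk].
  by rewrite addr0 indicE mem_setE in_itv /= tx xt mulr1.
rewrite indicE mem_setE in_itv /=.
have [kl|lk'] := ltnP k l.
  have tl : t k.+1 <= t l by apply: (grid_mono g); rewrite kl ltnW.
  by rewrite [_ <= x]leNgt (lt_le_trans xt tl) mulr0.
have lk2 : (l < k)%N by rewrite ltn_neqAle lk' andbT; exact: lk.
have tl : t l.+1 <= t k by apply: (grid_mono g); rewrite lk2 ltnW.
by rewrite [x < _]ltNge (le_trans tl tx) andbF mulr0.
Qed.

Lemma step_sp_integral (a b : R) (n : nat) (t : nat -> R) c X omega :
  is_grid a b n t ->
  sp_integral X (SimpleProcess n t c) b omega - sp_integral X (SimpleProcess n t c) a omega =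
  \sum_(k < n) c k omega * (X (t k.+1) omega - X (t k) omega).
Proof.
move=> g; rewrite /sp_integral /= -sumrB; apply: eq_bigr => k _.
have /andP[ak kb] := grid_itv g (ltnW (ltn_ord k)).
have /andP[ak1 k1b] := grid_itv g (ltn_ord k).
by rewrite !(min_l kb) !(min_l k1b) !(min_r ak) !(min_r ak1) subrr mulr0 subr0.
Qed.

Lemma step_mono (a b : R) (n : nat) (t : nat -> R) c :
  is_grid a b n t -> sp_mono (SimpleProcess n t c).
Proof. by move=> g k kn; exact/ltW/(grid_incr g). Qed.

Lemma sp_eval_measurable (phi : simple_process Omega R) omega (D : set R) :
  measurable_fun D (fun s => sp_eval phi s omega).
Proof.
by apply: measurable_sum => k; exact: measurable_funM.
Qed.

End grid_processes.

Section energy_bound.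
Context (R : realType).
Variables (a b T : R) (h p1 p2 H1 H2 : R -> R) (C e : R).
Local Notation mu := (@lebesgue_measure R).

(** After integrating, the interval is enlarged to [[a, T]], where the simple processes converge in
    L2. *)
Lemma energy_bound : b <= T -> 0 <= C ->
  measurable_fun `[a, T] H1 -> measurable_fun `[a, T] H2 ->
  measurable_fun `[a, T] p1 -> measurable_fun `[a, T] p2 ->
  measurable_fun `[a, b[ h -> (forall s, 0 <= h s) ->
  (forall s, s \in `[a, b[ ->
    h s <= 3 * C * ((p2 s - H2 s) ^+ 2 + e ^+ 2 * H1 s ^+ 2 + C ^+ 2 * (p1 s - H1 s) ^+ 2)) ->
  (\int[mu]_(s in `[a, b[) (h s)%:E <=
   (3 * C)%:E * (\int[mu]_(s in `[a, T]) ((p2 s - H2 s) ^+ 2)%:E +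
     (e ^+ 2)%:E * \int[mu]_(s in `[a, T]) (H1 s ^+ 2)%:E +
     (C ^+ 2)%:E * \int[mu]_(s in `[a, T]) ((p1 s - H1 s) ^+ 2)%:E))%E.
Proof.
move=> bT C0 mH1 mH2 mp1 mp2 mh h0 hle.
have sub : `[a, b[%classic `<=` `[a, T]%classic.
  move=> x /=; rewrite !in_itv /= => /andP[-> xb].
  exact: le_trans (ltW xb) bT.
have m2 : measurable_fun `[a, T] (fun s => ((p2 s - H2 s) ^+ 2)%:E).
  by apply/measurable_EFinP; apply: measurable_funX; exact: measurable_funB.
have m1 : measurable_fun `[a, T] (fun s => ((p1 s - H1 s) ^+ 2)%:E).
  by apply/measurable_EFinP; apply: measurable_funX; exact: measurable_funB.
have m0 : measurable_fun `[a, T] (fun s => (H1 s ^+ 2)%:E).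
  by apply/measurable_EFinP; exact: measurable_funX.
have m0' : measurable_fun `[a, T] (fun s => (e ^+ 2)%:E * (H1 s ^+ 2)%:E)%E.
  exact: emeasurable_funM.
have m1' : measurable_fun `[a, T] (fun s => (C ^+ 2)%:E * ((p1 s - H1 s) ^+ 2)%:E)%E.
  exact: emeasurable_funM.
have C30 : 0 <= 3 * C by rewrite mulr_ge0.
pose f s := ((3 * C)%:E * (((p2 s - H2 s) ^+ 2)%:E + (e ^+ 2)%:E * (H1 s ^+ 2)%:E +
  (C ^+ 2)%:E * ((p1 s - H1 s) ^+ 2)%:E))%E.
have s2 (x y : R) : 0 <= x ^+ 2 * y ^+ 2 by exact: mulr_ge0 (sqr_ge0 _) (sqr_ge0 _).
have fE s : f s = (3 * C *
    ((p2 s - H2 s) ^+ 2 + e ^+ 2 * H1 s ^+ 2 + C ^+ 2 * (p1 s - H1 s) ^+ 2))%:E by [].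
have f0 s : (0 <= f s)%E.
  by rewrite fE lee_fin; apply: mulr_ge0 => //; rewrite !addr_ge0 ?s2 ?sqr_ge0.
have mf : measurable_fun `[a, T] f.
  apply: emeasurable_funM => //; apply: emeasurable_funD => //.
  exact: emeasurable_funD.
apply: (@le_trans _ _ (\int[mu]_(s in `[a, T]) f s)%E).
  apply: (@le_trans _ _ (\int[mu]_(s in `[a, b[) f s)%E).
    apply: ge0_le_integral => //.
    - by move=> s _; rewrite lee_fin.
    - exact/measurable_EFinP.
    - exact: measurable_funS mf.
  by apply: ge0_subset_integral.
rewrite /f ge0_integralZl//; last 2 first.
- by apply: emeasurable_funD => //; exact: emeasurable_funD.
- by move=> s _; rewrite lee_fin !addr_ge0 ?s2 ?sqr_ge0.
rewrite ge0_integralD//; last 3 first.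
- by move=> s _; rewrite lee_fin !addr_ge0 ?s2 ?sqr_ge0.
- exact: emeasurable_funD.
- by move=> s _; rewrite lee_fin s2.
rewrite ge0_integralD//; last 2 first.
- by move=> s _; rewrite lee_fin sqr_ge0.
- by move=> s _; rewrite lee_fin s2.
rewrite ge0_integralZl//; last 2 first.
- by move=> s _; rewrite lee_fin sqr_ge0.
- by rewrite lee_fin sqr_ge0.
rewrite ge0_integralZl//.
- by move=> s _; rewrite lee_fin sqr_ge0.
- by rewrite lee_fin sqr_ge0.
Qed.

End energy_bound.

(** [p2 - g p1] is the sum of the error of [p2], the defect of the ratio [H2 - g H1], and [-g] times
    the error of [p1]; the square of three terms is at most three times the sum of their squares. *)
Lemma sqr_norm3_le (R : realType) (z p2 H2 g H1 p1 e C : R) :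
  0 <= C -> 0 <= z -> z <= C -> `|g| <= C -> `|H2 - g * H1| <= e * `|H1| ->
  z * (p2 - g * p1) ^+ 2 <=
  3 * C * ((p2 - H2) ^+ 2 + e ^+ 2 * H1 ^+ 2 + C ^+ 2 * (p1 - H1) ^+ 2).
Proof.
move=> C0 z0 zC gC He.
have He2 : (H2 - g * H1) ^+ 2 <= e ^+ 2 * H1 ^+ 2.
  rewrite -(real_normK (num_real (H2 - _))) -(real_normK (num_real H1)) -exprMn.
  by rewrite lerXn2r// ?nnegrE// (le_trans _ He).
have g2 : g ^+ 2 <= C ^+ 2.
  by rewrite -(real_normK (num_real g)) lerXn2r// nnegrE.
set A := p2 - H2; set B := H2 - g * H1; set D := p1 - H1.
have -> : p2 - g * p1 = A + B - g * D by rewrite /A /B /D; ring.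
have sq3 (x y v : R) : (x + y - v) ^+ 2 <= 3 * (x ^+ 2 + y ^+ 2 + v ^+ 2).
  have := sqr_ge0 (x - y); have := sqr_ge0 (x + v); have := sqr_ge0 (y + v); nra.
apply: (@le_trans _ _ (C * (A + B - g * D) ^+ 2)); first by rewrite ler_wpM2r ?sqr_ge0.
rewrite [3 * C]mulrC -mulrA ler_wpM2l//.
apply: le_trans (sq3 _ _ _) _.
rewrite ler_wpM2l// lerD ?lerD//.
by rewrite exprMn ler_wpM2r ?sqr_ge0.
Qed.

(** * Increments of two Ito integrals with proportional integrands *)

Section ito_increment_sums.
Context d (Omega : measurableType d) (R : realType) (P : probability Omega R).
Variables (theta T : R) (F : R -> set (set Omega)) (w : R -> Omega -> R).
Hypotheses (hF : filtration P theta T F) (hw : wiener P theta T w).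
Hypotheses (w_adapted : adapted F theta T w)
  (w_indep : future_increments_independent P theta T F w).
Variable (b : R).
Hypotheses (theta_b : theta < b) (bT : b <= T).
Local Notation mu := (@lebesgue_measure R).

Section one_partition.
Variables (n : nat) (t : nat -> R).
Hypothesis gt : is_grid theta b n t.
Variables (phi1 phi2 : simple_process Omega R).
Hypotheses (sphi1 : is_simple F theta T phi1) (sphi2 : is_simple F theta T phi2).
Variables (g : R -> Omega -> R) (J : nat) (zeta : nat -> nat -> Omega -> R).
Hypothesis mg : forall k, (k < n)%N -> measurable_wrt (F (t k)) (g (t k)).
Hypothesis mzeta : forall j k, (j < J)%N -> (k < n)%N -> measurable_wrt (F (t k)) (zeta j k).

Definition increment_error k omega :=
  (sp_integral w phi2 (t k.+1) omega - sp_integral w phi2 (t k) omega) -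
  g (t k) omega * (sp_integral w phi1 (t k.+1) omega - sp_integral w phi1 (t k) omega).

Definition error_sum omega :=
  \sum_(j < J) (\sum_(k < n) zeta j k omega * increment_error k omega) ^+ 2.

Let zstep j := SimpleProcess n t (zeta j).
Let gstep := SimpleProcess n t (fun k => g (t k)).
Let zgstep j := SimpleProcess n t (fun k omega => zeta j k omega * g (t k) omega).

(** The density of the predictable quadratic variation of the sums in [error_sum], added over the
    rows [j]. *)
Definition error_density omega s :=
  \sum_(j < J) (sp_eval (zstep j) s omega *
    (sp_eval phi2 s omega - sp_eval gstep s omega * sp_eval phi1 s omega)) ^+ 2.

Definition error_energy omega :=
  fine ((normal_moment R 1 + 1)%:E * \int[mu]_(s in `[theta, b[) (error_density omega s)%:E)%E.

Let tin k : (k <= n)%N -> t k \in `[theta, T].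
Proof.
by move=> kn; have /andP[tk kb] := grid_itv gt kn; rewrite in_itv /= tk (le_trans kb).
Qed.

(** On a common refinement [r] of the grid and of the jump times of [phi1] and [phi2], each row of
    [error_sum] is a sum of predictable factors times increments of [w], and [lenglart] applies. The
    third clause says that [fine] loses nothing in [error_energy]. *)
Lemma error_sum_lenglart :
  [/\ measurable_fun setT error_sum, measurable_fun setT error_energy,
    (forall omega, (error_energy omega)%:E = ((normal_moment R 1 + 1)%:E *
      \int[mu]_(s in `[theta, b[) (error_density omega s)%:E))%E &
    forall (A : set Omega) (eps delta : R), measurable A -> 0 < eps -> 0 <= delta ->
    (P (A `&` [set omega | (eps <= error_sum omega)%R]) <=
     (delta / eps)%:E + P (A `&` [set omega | (delta < error_energy omega)%R]))%E].
Proof.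
set K := normal_moment R 1 + 1.
pose times (phi : simple_process Omega R) := [seq sp_time phi k | k <- iota 0 (sp_size phi).+1].
have tP (phi : simple_process Omega R) k : (k <= sp_size phi)%N -> sp_time phi k \in times phi.
  by move=> kp; apply/mapP; exists k => //; rewrite mem_iota.
have [N [r [gr hr]]] := grid_exists (times phi1 ++ times phi2 ++ [seq t k | k <- iota 0 n.+1]) theta_b.
have r1 k : (k <= sp_size phi1)%N -> refines N r (sp_time phi1 k).
  by move=> kp; apply: hr; rewrite mem_cat tP.
have r2 k : (k <= sp_size phi2)%N -> refines N r (sp_time phi2 k).
  by move=> kp; apply: hr; rewrite !mem_cat tP ?orbT.
have rt k : (k <= n)%N -> refines N r (t k).
  move=> kp; apply: hr; rewrite !mem_cat; apply/orP; right; apply/orP; right.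
  by apply/mapP; exists k => //; rewrite mem_iota.
have rin i : (i <= N)%N -> r i \in `[theta, T].
  by move=> iN; have /andP[tk kb] := grid_itv gr iN; rewrite in_itv /= tk (le_trans kb).
have rib i : (i < N)%N -> r i \in `[theta, b[.
  move=> iN; have /andP[tk _] := grid_itv gr (ltnW iN); rewrite in_itv /= tk.
  apply: lt_le_trans (grid_incr gr iN) _.
  by have /andP[] := grid_itv gr iN.
pose xi j i omega := sp_eval (zstep j) (r i) omega *
  (sp_eval phi2 (r i) omega - sp_eval gstep (r i) omega * sp_eval phi1 (r i) omega).
pose eta i omega := w (r i.+1) omega - w (r i) omega.
(* Associativity of integration: both halves are step processes integrated against a simple
   integral, and on the cells of [r] they become multiples of increments of [w]. *)
have sumE j omega : \sum_(k < n) zeta j k omega * increment_error k omega =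
    \sum_(i < N) xi j i omega * eta i omega.
  have e2 : \sum_(k < n) zeta j k omega *
      (sp_integral w phi2 (t k.+1) omega - sp_integral w phi2 (t k) omega) =
      \sum_(i < N) sp_eval (zstep j) (r i) omega * (sp_eval phi2 (r i) omega * eta i omega).
    rewrite -(step_sp_integral (zeta j) _ _ gt) (sp_integral_grid _ _ gr)//.
      by apply: eq_bigr => i _; rewrite (sp_integral_incr w omega _ r2)//;
        [exact: simple_mono sphi2|exact: grid_incr gr _ _].
    exact: step_mono gt.
  have e1 : \sum_(k < n) (zeta j k omega * g (t k) omega) *
      (sp_integral w phi1 (t k.+1) omega - sp_integral w phi1 (t k) omega) =
      \sum_(i < N) sp_eval (zgstep j) (r i) omega * (sp_eval phi1 (r i) omega * eta i omega).
    rewrite -(step_sp_integral (fun k omega => zeta j k omega * g (t k) omega) _ _ gt).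
    rewrite (sp_integral_grid _ _ gr)//.
      by apply: eq_bigr => i _; rewrite (sp_integral_incr w omega _ r1)//;
        [exact: simple_mono sphi1|exact: grid_incr gr _ _].
    exact: step_mono gt.
  have -> : \sum_(k < n) zeta j k omega * increment_error k omega =
      \sum_(k < n) zeta j k omega *
        (sp_integral w phi2 (t k.+1) omega - sp_integral w phi2 (t k) omega) -
      \sum_(k < n) (zeta j k omega * g (t k) omega) *
        (sp_integral w phi1 (t k.+1) omega - sp_integral w phi1 (t k) omega).
    by rewrite -sumrB; apply: eq_bigr => k _; rewrite /increment_error mulrBr mulrA.
  rewrite e1 e2 -sumrB; apply: eq_bigr => i _.
  have [k kn kin] := grid_cell gt (rib i (ltn_ord i)).
  rewrite /xi !(step_eval _ omega gt kn kin) /=; ring.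
have densE i omega : (i < N)%N ->
    error_density omega (r i) = \sum_(j < J) xi j i omega ^+ 2 by [].
have dens0 omega s : 0 <= error_density omega s by apply: sumr_ge0 => j _; exact: sqr_ge0.
have denscst omega i s : (i < N)%N -> s \in `[r i, r i.+1[ ->
    error_density omega s = error_density omega (r i).
  move=> iN sin; apply: eq_bigr => j _; congr (_ ^+ 2).
  rewrite (sp_eval_cst omega r1 iN sin) (sp_eval_cst omega r2 iN sin).
  by rewrite !(sp_eval_cst (N := N) (r := r) omega _ iN sin).
have intE omega := (step_integral gr (dens0 omega) (denscst omega)).2.
have enE omega : error_energy omega =
    \sum_(i < N) \sum_(j < J) xi j i omega ^+ 2 * (K * (r i.+1 - r i)).
  rewrite /error_energy intE /= mulr_sumr; apply: eq_bigr => i _.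
  by rewrite densE// -mulr_suml mulrCA.
pose G i := F (r i).
have sG i : (i <= N)%N -> sigma_algebra setT (G i) by move=> iN; exact: (filt_sigma hF (rin i iN)).
have GT i : (i <= N)%N -> G i `<=` measurable by move=> iN; exact: (filt_event hF (rin i iN)).
have rT i : (i <= N)%N -> r i <= T by move=> iN; have := rin i iN; rewrite in_itv /= => /andP[].
have tr i : (i <= N)%N -> theta <= r i by move=> iN; have := rin i iN; rewrite in_itv /= => /andP[].
have GS i : (i < N)%N -> G i `<=` G i.+1.
  move=> iN; apply: filt_mono hF _ _ (tr i (ltnW iN)) _ (rT _ iN).
  exact/ltW/(grid_incr gr iN).
have incr i : (i < N)%N -> increment P (G i) (G i.+1) (K * (r i.+1 - r i)) (eta i).
  move=> iN.
  exact: (wiener_increment hF hw w_adapted w_indep (tr i (ltnW iN)) (grid_incr gr iN) (rT _ iN)).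
have mstep c i : (i < N)%N -> (forall k, (k < n)%N -> measurable_wrt (F (t k)) (c k)) ->
    measurable_wrt (G i) (sp_eval (SimpleProcess n t c) (r i)).
  move=> iN mc; apply: (sp_eval_wrt hF (rin i (ltnW iN))) => // k kn /=.
  by have /andP[] := grid_itv gt (ltnW kn).
have msimple phi i : (i < N)%N -> is_simple F theta T phi ->
    measurable_wrt (G i) (sp_eval phi (r i)).
  move=> iN sphi; apply: (sp_eval_wrt hF (rin i (ltnW iN))) => k kn.
    by have := simple_time sphi (ltnW kn); rewrite in_itv /= => /andP[].
  exact: (simple_adapted sphi kn).
have mxi j i : (j < J)%N -> (i < N)%N -> measurable_wrt (G i) (xi j i).
  move=> jJ iN; have sGi := sG i (ltnW iN).
  apply: (measurable_wrtM sGi); first by apply: mstep => // k; exact: mzeta.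
  apply: (measurable_wrtB sGi); first exact: msimple.
  by apply: (measurable_wrtM sGi); [exact: mstep|exact: msimple].
have mxiT j i : (j < J)%N -> (i < N)%N -> measurable_fun setT (xi j i).
  by move=> jJ iN; apply: measurable_wrtE (mxi _ _ jJ iN); exact: GT (ltnW iN).
have etaT i : (i < N)%N -> measurable_fun setT (eta i).
  by move=> iN; exact: measurable_wrtE (GT _ iN) (incr_meas (incr _ iN)).
have errE : error_sum = fun omega => \sum_(j < J) (\sum_(i < N) xi j i omega * eta i omega) ^+ 2.
  by apply/funext => omega; apply: eq_bigr => j _; rewrite sumE.
split.
- rewrite errE; apply: measurable_sum => j; apply: measurable_funX.
  apply: measurable_sum => i; apply: measurable_funM; first exact: mxiT.
  exact: etaT.
- rewrite (funext enE); apply: measurable_sum => i; apply: measurable_sum => j.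
  by apply: measurable_funM => //; apply: measurable_funX; exact: mxiT.
- by move=> omega; rewrite /error_energy intE /=.
move=> A eps delta mA e0 d0; rewrite errE (funext enE).
exact: (lenglart sG GT GS incr mxi mA e0 d0).
Qed.

End one_partition.

Section refining_partitions.
Variables (n : nat -> nat) (t : nat -> nat -> R).
Hypothesis gt : forall m, is_grid theta b (n m) (t m).
Variables (psi1 psi2 : nat -> simple_process Omega R).
Hypotheses (spsi1 : forall m, is_simple F theta T (psi1 m))
  (spsi2 : forall m, is_simple F theta T (psi2 m)).
Variables (g : R -> Omega -> R) (J : nat -> nat) (zeta : nat -> nat -> nat -> Omega -> R).
Hypothesis mg : forall m k, (k < n m)%N -> measurable_wrt (F (t m k)) (g (t m k)).
Hypothesis mzeta : forall m j k, (j < J m)%N -> (k < n m)%N ->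
  measurable_wrt (F (t m k)) (zeta m j k).
Variables (H1 H2 : R -> Omega -> R) (A : set Omega).
Hypothesis mA : measurable A.
Hypothesis mH1 : \forall omega \ae P, measurable_fun `[theta, T] (H1 ^~ omega).
Hypothesis mH2 : \forall omega \ae P, measurable_fun `[theta, T] (H2 ^~ omega).
Hypothesis H1_L2 : \forall omega \ae P,
  (\int[mu]_(s in `[theta, T]) (H1 s omega ^+ 2)%:E < +oo)%E.
Hypothesis psi1_cvg : \forall omega \ae P,
  (fun m => \int[mu]_(s in `[theta, T])
    ((sp_eval (psi1 m) s omega - H1 s omega) ^+ 2)%:E)%E @ \oo --> 0%E.
Hypothesis psi2_cvg : \forall omega \ae P,
  (fun m => \int[mu]_(s in `[theta, T])
    ((sp_eval (psi2 m) s omega - H2 s omega) ^+ 2)%:E)%E @ \oo --> 0%E.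
Hypothesis bounded : \forall omega \ae P, A omega -> exists C : R, forall m k, (k < n m)%N ->
  `|g (t m k) omega| <= C /\ \sum_(j < J m) zeta m j k omega ^+ 2 <= C.
Hypothesis close : \forall omega \ae P, A omega -> forall e, 0 < e -> \forall m \near \oo,
  forall k s, (k < n m)%N -> s \in `[t m k, t m k.+1[ ->
    `|H2 s omega - g (t m k) omega * H1 s omega| <= e * `|H1 s omega|.

Let S m := error_sum (n m) (t m) (psi1 m) (psi2 m) g (J m) (zeta m).
Let En m := error_energy (n m) (t m) (psi1 m) (psi2 m) g (J m) (zeta m).

(** Path by path, the density is bounded through [sqr_norm3_le] by the errors of the two
    approximations and the error of freezing the ratio; the integrals of all three tend to 0. *)
Let energy_small : \forall omega \ae P, forall delta : R, 0 < delta ->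
  \forall m \near \oo, ~ (A omega /\ delta < En m omega).
Proof.
apply: filterS (filterI mH1 (filterI mH2 (filterI H1_L2
  (filterI psi1_cvg (filterI psi2_cvg (filterI bounded close)))))).
move=> omega [mH1o [mH2o [L2 [c1 [c2 [bd cl]]]]]] delta d0.
have [Ao|nA] := pselect (A omega); last by apply: nearW => m [].
have [C0 hC0] := bd Ao; have {}cl := cl Ao.
pose C := `|C0|; have C_ge0 : 0 <= C by exact: normr_ge0.
have hC m k : (k < n m)%N ->
    `|g (t m k) omega| <= C /\ \sum_(j < J m) zeta m j k omega ^+ 2 <= C.
  by move=> /hC0[h1 h2]; split; apply: le_trans (ler_norm _).
set L := (\int[mu]_(s in `[theta, T]) (H1 s omega ^+ 2)%:E)%E in L2.
have L0 : (0 <= L)%E by apply: integral_ge0 => s _; rewrite lee_fin sqr_ge0.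
have Lfin : L \is a fin_num by rewrite ge0_fin_numE.
have Lr0 : 0 <= fine L by exact: fine_ge0.
set K := normal_moment R 1 + 1.
have K0 : 0 <= K by rewrite addr_ge0// normal_moment_ge0.
pose M := K * (3 * C) * (1 + fine L + C ^+ 2).
have M0 : 0 <= M by rewrite !mulr_ge0// !addr_ge0// sqr_ge0.
(* Once both approximation errors are below [rho] and the ratio is within [sqrt rho], the energy is
   at most [M rho], hence at most [delta]. *)
pose rho := delta / (M + 1).
have M1 : 0 < M + 1 by rewrite ltr_wpDl.
have rho0 : 0 < rho by rewrite divr_gt0.
have srho0 : 0 < Num.sqrt rho by rewrite sqrtr_gt0.
have int0 (p H : R -> R) : (0 <= \int[mu]_(s in `[theta, T]) ((p s - H s) ^+ 2)%:E)%E.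
  by apply: integral_ge0 => s _; rewrite lee_fin sqr_ge0.
have e1 := (ecvg0P (fun m => int0 (fun s => sp_eval (psi1 m) s omega) (H1 ^~ omega))).1 c1 _ rho0.
have e2 := (ecvg0P (fun m => int0 (fun s => sp_eval (psi2 m) s omega) (H2 ^~ omega))).1 c2 _ rho0.
apply: filterS3 e1 e2 (cl _ srho0) => m e1 e2 cm [_].
apply/negP; rewrite -leNgt.
have mgm k : (k < n m)%N -> measurable_wrt (F (t m k)) (g (t m k)) by exact: mg.
have mzm j k : (j < J m)%N -> (k < n m)%N -> measurable_wrt (F (t m k)) (zeta m j k).
  exact: mzeta.
have [_ _ EnE _] := error_sum_lenglart (gt m) (spsi1 m) (spsi2 m) mgm mzm.
rewrite -lee_fin EnE -/K.
set dens := error_density _ _ _ _ _ _ _.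
have mdens : measurable_fun `[theta, b[ (dens omega).
  apply: measurable_sum => j; apply: measurable_funX; apply: measurable_funM.
    exact: sp_eval_measurable.
  apply: measurable_funB; first exact: sp_eval_measurable.
  by apply: measurable_funM; exact: sp_eval_measurable.
have dens0 s : 0 <= dens omega s by apply: sumr_ge0 => j _; exact: sqr_ge0.
have densle s : s \in `[theta, b[ -> dens omega s <=
    3 * C * ((sp_eval (psi2 m) s omega - H2 s omega) ^+ 2 +
      Num.sqrt rho ^+ 2 * H1 s omega ^+ 2 +
      C ^+ 2 * (sp_eval (psi1 m) s omega - H1 s omega) ^+ 2).
  move=> sin; have [k kn sk] := grid_cell (gt m) sin.
  rewrite /dens /error_density.
  under eq_bigr do rewrite !(step_eval _ omega (gt m) kn sk) exprMn.
  rewrite -mulr_suml; have [gC zC] := hC m k kn.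
  apply: sqr_norm3_le => //; last exact: cm.
  by apply: sumr_ge0 => j _; exact: sqr_ge0.
have mp (phi : simple_process Omega R) : measurable_fun `[theta, T] (fun s => sp_eval phi s omega).
  exact: sp_eval_measurable.
have := energy_bound bT C_ge0 mH1o mH2o (mp (psi1 m)) (mp (psi2 m)) mdens dens0 densle.
rewrite -/L (sqr_sqrtr (ltW rho0)) => ub.
apply: (@le_trans _ _ (K%:E * ((3 * C)%:E * (rho%:E + rho%:E * L + (C ^+ 2)%:E * rho%:E)))%E).
  apply: lee_wpmul2l; first by rewrite lee_fin.
  apply: le_trans ub _; apply: lee_wpmul2l; first by rewrite lee_fin mulr_ge0.
  apply: leeD; last first.
    by apply: lee_wpmul2l; [rewrite lee_fin sqr_ge0|exact: ltW].
  by apply: leeD => //; exact: ltW.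
rewrite -(fineK Lfin).
have -> : (K%:E * ((3 * C)%:E *
    (rho%:E + rho%:E * (fine L)%:E + (C ^+ 2)%:E * rho%:E)) = (M * rho)%:E)%E.
  transitivity ((K * (3 * C * (rho + rho * fine L + C ^+ 2 * rho)))%:E)%E; first by [].
  by congr EFin; rewrite /M; ring.
rewrite lee_fin.
rewrite /rho mulrA ler_pdivrMr// mulrC; apply: ler_wpM2l; first exact: ltW.
by rewrite lerDl.
Qed.

Lemma error_sum_measurable m : measurable_fun setT (S m).
Proof.
have mgm k : (k < n m)%N -> measurable_wrt (F (t m k)) (g (t m k)) by exact: mg.
have mzm j k : (j < J m)%N -> (k < n m)%N -> measurable_wrt (F (t m k)) (zeta m j k).
  exact: mzeta.
by have [] := error_sum_lenglart (gt m) (spsi1 m) (spsi2 m) mgm mzm.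
Qed.

(** With [delta = e eps / 2], Lenglart's bound is [e / 2] plus the probability of a large energy,
    which vanishes by [energy_small]. *)
Lemma error_sum_cvg eps : 0 < eps ->
  (fun m => P (A `&` [set omega | eps <= S m omega])) @ \oo --> 0%E.
Proof.
move=> eps0; apply/ecvg0P => // e e0.
pose delta := e / 2 * eps; have d0 : 0 < delta by rewrite !mulr_gt0.
have mgm m k : (k < n m)%N -> measurable_wrt (F (t m k)) (g (t m k)) by exact: mg.
have mzm m j k : (j < J m)%N -> (k < n m)%N -> measurable_wrt (F (t m k)) (zeta m j k).
  exact: mzeta.
have mEn m : measurable_fun setT (En m).
  by have [] := error_sum_lenglart (gt m) (spsi1 m) (spsi2 m) (@mgm m) (@mzm m).
have mAE m : measurable (A `&` [set omega | delta < En m omega]).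
  apply: measurableI => //.
  by rewrite -[X in measurable X]setTI; exact: measurable_fun_ltr.
have E0 : (fun m => P (A `&` [set omega | delta < En m omega])) @ \oo --> 0%E.
  apply: ae_near_prob0 => //; apply: filterS energy_small => omega h.
  by apply: filterS (h _ d0) => m.
have e20 : 0 < e / 2 by rewrite divr_gt0.
have := (ecvg0P (fun m => measure_ge0 P _)).1 E0 _ e20; apply: filterS => m Em.
have [_ _ _ le] := error_sum_lenglart (gt m) (spsi1 m) (spsi2 m) (@mgm m) (@mzm m).
apply: le_lt_trans (le A eps delta mA eps0 (ltW d0)) _.
rewrite [X in (_ < X%:E)%E](splitr e) EFinD lee_ltD//.
by rewrite lee_fin /delta mulfK// gt_eqF.
Qed.

End refining_partitions.
End ito_increment_sums.

(** * Uniform partitions and quadratic variation *)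

Section segment_continuity.
Context (R : realType).
Variables (a b : R) (u : R -> R).
Hypotheses (ab : a <= b) (cu : {within `[a, b], continuous u}).

(** Heine-Cantor, with compactness used as a covering property: a [delta] that works near each point
    works on the whole segment. *)
Lemma within_unif_continuous (e : R) : 0 < e -> exists2 delta : R, 0 < delta &
  forall x y, x \in `[a, b] -> y \in `[a, b] -> `|x - y| < delta -> `|u x - u y| < e.
Proof.
move=> e0.
have /compact_near_coveringP cov := @segment_compact R a b.
pose Q (delta x : R) := x \in `[a, b] ->
  forall y, y \in `[a, b] -> `|x - y| < delta -> `|u x - u y| < e.
have h : \forall delta \near 0^'+, `[a, b] `<=` Q delta.
  apply: cov => x xab.
  have /cvgrPdist_lt cx := (subspace_continuousP _ _).1 cu x xab.
  have /nbhs_ballP[r /= r0 hr] := cx (e / 2) (divr_gt0 e0 (ltr0Sn _ 1)).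
  have r2 : 0 < r / 2 by rewrite divr_gt0.
  exists (ball x (r / 2), [set delta | 0 < delta < r / 2]).
    split => /=; first exact: nbhsx_ballx.
    by near=> delta; apply/andP; split; near: delta; [exact: nbhs_right_gt|exact: nbhs_right_lt].
  move=> [z delta] /= [xz /andP[d0 dr]] zab y yab zy.
  have xzr : `|x - z| < r / 2 by exact: xz.
  have hz : `|u x - u z| < e / 2.
    by apply: hr => //; rewrite /ball /= (lt_trans xzr)// ltr_pdivrMr// ltr_pMr// ltr1n.
  have hy : `|u x - u y| < e / 2.
    apply: hr => //; rewrite /ball /= (_ : x - y = (x - z) + (z - y)); last by ring.
    rewrite (le_lt_trans (ler_normD _ _))// [r]splitr ltrD//.
    exact: lt_trans zy dr.
  rewrite (_ : u z - u y = (u x - u y) - (u x - u z)); last by ring.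
  by rewrite (le_lt_trans (ler_normB _ _))// [e]splitr ltrD.
have [delta [d0 hd]] : exists delta, 0 < delta /\ `[a, b] `<=` Q delta.
  have : \forall delta \near 0^'+, 0 < delta /\ `[a, b] `<=` Q delta.
    by apply: filterI h; exact: nbhs_right_gt.
  by move=> /filter_ex.
by exists delta => // x y xab yab; exact: hd.
Unshelve. all: by end_near. Qed.

Lemma within_bounded : exists2 C : R, 0 <= C & forall x, x \in `[a, b] -> `|u x| <= C.
Proof.
have [c cab hc] := EVT_max ab cu; have [c' cab' hc'] := EVT_min ab cu.
exists (`|u c| + `|u c'|) => [|x xab]; first by rewrite addr_ge0.
have := hc x xab; have := hc' x xab.
have := ler_norm (u c); have := ler_norm (- u c'); rewrite normrN.
have := normr_ge0 (u c); have := normr_ge0 (u c').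
by rewrite ler_norml => *; apply/andP; split; lra.
Qed.

End segment_continuity.

Lemma within_powR (R : realType) (a b p : R) (y : R -> R) :
  {within `[a, b], continuous y} -> (forall s, s \in `[a, b] -> 0 < y s) ->
  {within `[a, b], continuous (fun s => y s `^ p)}.
Proof.
move=> cy y0; apply/subspace_continuousP => s sin.
have cp : {for y s, continuous (@powR R ^~ p)}.
  apply/differentiable_continuous/derivable1_diffP; apply: derivable_powR.
  by rewrite in_itv /= andbT; exact: y0.
exact: (cvg_comp y (@powR R ^~ p) ((subspace_continuousP _ _).1 cy s sin) cp).
Qed.

Lemma withinM (R : realType) (D : set R) (u v : R -> R) :
  {within D, continuous u} -> {within D, continuous v} ->
  {within D, continuous (fun s => u s * v s)}.
Proof.
move=> cu cv; apply/subspace_continuousP => s sin; apply: cvgM.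
  exact: (subspace_continuousP _ _).1 cu s sin.
exact: (subspace_continuousP _ _).1 cv s sin.
Qed.

Lemma withinD (R : realType) (D : set R) (u v : R -> R) :
  {within D, continuous u} -> {within D, continuous v} ->
  {within D, continuous (fun s => u s + v s)}.
Proof.
move=> cu cv; apply/subspace_continuousP => s sin; apply: cvgD.
  exact: (subspace_continuousP _ _).1 cu s sin.
exact: (subspace_continuousP _ _).1 cv s sin.
Qed.

Lemma withinN (R : realType) (D : set R) (u : R -> R) :
  {within D, continuous u} -> {within D, continuous (fun s => - u s)}.
Proof.
move=> cu; apply/subspace_continuousP => s sin; apply: cvgN.
exact: (subspace_continuousP _ _).1 cu s sin.
Qed.

Lemma within_cst (R : realType) (D : set R) (c : R) :
  {within D, continuous (fun=> c)}.
Proof. by apply/subspace_continuousP => s sin; exact: cvg_cst. Qed.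

Section uniform_partition.
Context (R : realType).
Variables (a b : R).
Hypothesis ab : a < b.

(** Stage [m] has [m + 1] cells, so the denominator never vanishes. *)
Definition upart (m k : nat) : R := a + (b - a) * k%:R / m.+1%:R.

Lemma upart_step m k : upart m k.+1 - upart m k = (b - a) / m.+1%:R.
Proof. by rewrite /upart -natr1; ring. Qed.

Lemma upart_grid m : is_grid a b m.+1 (upart m).
Proof.
split; first by rewrite /upart mulr0 mul0r addr0.
  by rewrite /upart mulfK ?pnatr_eq0// addrC subrK.
move=> k _; rewrite -subr_gt0 upart_step divr_gt0// ?ltr0n//.
by rewrite subr_gt0.
Qed.

Lemma upart_mesh (delta : R) : 0 < delta ->
  \forall m \near \oo, (b - a) / m.+1%:R < delta.
Proof.
move=> d0; near=> m.
rewrite ltr_pdivrMr ?ltr0n// -ltr_pdivrMl//.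
near: m; exists (Num.bound (delta^-1 * (b - a))) => // m /= hm.
apply: lt_le_trans (_ : (Num.bound (delta^-1 * (b - a)))%:R <= _); last by rewrite ler_nat leqW.
by apply: archi_boundP; rewrite mulr_ge0// ?invr_ge0 ?subr_ge0; exact: ltW.
Unshelve. all: by end_near. Qed.

Lemma upart_osc (u : R -> R) (e : R) : {within `[a, b], continuous u} -> 0 < e ->
  \forall m \near \oo, forall k s, (k < m.+1)%N -> s \in `[upart m k, upart m k.+1] ->
    `|u s - u (upart m k)| < e.
Proof.
move=> cu e0; have [delta d0 hd] := within_unif_continuous cu e0.
apply: filterS (upart_mesh d0) => m mesh k s km.
rewrite in_itv /= => /andP[ts st].
have /andP[a1 b1] := grid_itv (upart_grid m) (ltnW km).
have /andP[a2 b2] := grid_itv (upart_grid m) km.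
apply: hd; rewrite ?in_itv /= ?a1 ?b1 ?(le_trans a1 ts) ?(le_trans st b2)//.
rewrite ger0_norm ?subr_ge0//; apply: le_lt_trans mesh.
by rewrite -(upart_step m k) lerD2r.
Qed.

End uniform_partition.

Section quadratic_variation.
Context d (Omega : measurableType d) (R : realType) (P : probability Omega R).
Variables (theta T : R) (F : R -> set (set Omega)) (w : R -> Omega -> R).
Hypotheses (hF : filtration P theta T F) (hw : wiener P theta T w).
Hypotheses (w_adapted : adapted F theta T w)
  (w_indep : future_increments_independent P theta T F w).
Variable (b : R).
Hypotheses (theta_b : theta < b) (bT : b <= T).
Local Notation t := (upart theta b).
Local Notation K := (normal_moment R 1).
Variables (J : nat) (zeta : nat -> nat -> nat -> Omega -> R).
Hypothesis mzeta : forall m j k, (j < J)%N -> (k < m.+1)%N ->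
  measurable_wrt (F (t m k)) (zeta m j k).

Definition qv_sum m omega :=
  \sum_(j < J) (\sum_(k < m.+1) zeta m j k omega *
    ((w (t m k.+1) omega - w (t m k) omega) ^+ 2 - K * (t m k.+1 - t m k))) ^+ 2.

Let gt m := upart_grid theta_b m.

Let tin m k : (k <= m.+1)%N -> t m k \in `[theta, T].
Proof.
by move=> kn; have /andP[tk kb] := grid_itv (gt m) kn; rewrite in_itv /= tk (le_trans kb).
Qed.

Let incr m k : (k < m.+1)%N -> increment P (F (t m k)) (F (t m k.+1))
  ((normal_moment R 2 + 1) * (t m k.+1 - t m k) ^+ 2)
  (fun x => (w (t m k.+1) x - w (t m k) x) ^+ 2 - K * (t m k.+1 - t m k)).
Proof.
move=> km; have /andP[a1 _] := grid_itv (gt m) (ltnW km).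
have /andP[_ b2] := grid_itv (gt m) km.
exact: (wiener_qv_increment hF hw w_adapted w_indep a1 (grid_incr (gt m) km) (le_trans b2 bT)).
Qed.

Lemma qv_sum_measurable m : measurable_fun setT (qv_sum m).
Proof.
apply: measurable_sum => j; apply: measurable_funX; apply: measurable_sum => k.
apply: measurable_funM.
  by apply: measurable_wrtE (mzeta (ltn_ord j) (ltn_ord k)); exact: (filt_event hF (tin (ltnW (ltn_ord k)))).
by apply: measurable_wrtE (incr_meas (incr (ltn_ord k))); exact: (filt_event hF (tin (ltn_ord k))).
Qed.

(** The energy is a sum of bounded weights times [h^2] over cells of length [h], hence at most a
    constant times [h]. *)
Lemma qv_sum_cvg (A : set Omega) (eps : R) : measurable A ->
  (\forall omega \ae P, A omega -> exists C : R, forall m k, (k < m.+1)%N ->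
     \sum_(j < J) zeta m j k omega ^+ 2 <= C) ->
  0 < eps ->
  (fun m => P (A `&` [set omega | eps <= qv_sum m omega])) @ \oo --> 0%E.
Proof.
move=> mA bd eps0; apply/ecvg0P => // e e0.
pose delta := e / 2 * eps; have d0 : 0 < delta by rewrite !mulr_gt0.
pose K4 := normal_moment R 2 + 1.
have K40 : 0 < K4 by rewrite ltr_wpDl// normal_moment_ge0.
pose En m omega := \sum_(k < m.+1) \sum_(j < J) zeta m j k omega ^+ 2 *
  (K4 * (t m k.+1 - t m k) ^+ 2).
have mz m j k : (j < J)%N -> (k < m.+1)%N -> measurable_fun setT (zeta m j k).
  by move=> jJ km; apply: measurable_wrtE (mzeta jJ km); exact: (filt_event hF (tin (ltnW km))).
have mAE m : measurable (A `&` [set omega | delta < En m omega]).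
  apply: measurableI => //.
  rewrite -[X in measurable X]setTI; apply: measurable_fun_ltr => //.
  apply: measurable_sum => k; apply: measurable_sum => j.
  by apply: measurable_funM => //; apply: measurable_funX; exact: mz.
have E0 : (fun m => P (A `&` [set omega | delta < En m omega])) @ \oo --> 0%E.
  apply: ae_near_prob0 => //; apply: filterS bd => omega bd.
  have [Ao|nA] := pselect (A omega); last by apply: nearW => m [].
  have [C hC] := bd Ao; have C0 : 0 <= C.
    by apply: le_trans (hC 0%N 0%N isT); apply: sumr_ge0 => j _; exact: sqr_ge0.
  pose B := C * K4 * (b - theta) + 1.
  have bt0 : 0 <= b - theta by rewrite subr_ge0 ltW.
  have B0 : 0 < B by rewrite ltr_wpDl// !mulr_ge0// ltW.
  have dB : 0 < delta / B by rewrite divr_gt0.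
  apply: filterS (upart_mesh theta_b dB) => m mesh [_].
  apply/negP; rewrite -leNgt.
  set h := (b - theta) / m.+1%:R in mesh.
  have h0 : 0 <= h by rewrite divr_ge0// subr_ge0 ltW.
  apply: (@le_trans _ _ (\sum_(k < m.+1) C * (K4 * h ^+ 2))).
    apply: ler_sum => k _; rewrite -mulr_suml upart_step -/h; apply: ler_wpM2r; last exact: hC.
    by apply: mulr_ge0; [exact: ltW|exact: sqr_ge0].
  rewrite sumr_const card_ord -mulr_natr.
  have -> : C * (K4 * h ^+ 2) * m.+1%:R = C * K4 * (b - theta) * h.
    have hm : h * m.+1%:R = b - theta by rewrite /h divfK// pnatr_eq0.
    by rewrite -hm; ring.
  apply: (@le_trans _ _ (B * h)); first by rewrite ler_wpM2r// lerDl.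
  by rewrite mulrC -ler_pdivlMr// ltW.
have e20 : 0 < e / 2 by rewrite divr_gt0.
have := (ecvg0P (fun m => measure_ge0 P _)).1 E0 _ e20; apply: filterS => m Em.
pose G k := F (t m k).
have := @lenglart _ _ _ P m.+1 G (fun k x => (w (t m k.+1) x - w (t m k) x) ^+ 2 - K * (t m k.+1 - t m k))
  (fun k => K4 * (t m k.+1 - t m k) ^+ 2) _ _ _ (@incr m) J (zeta m) A eps delta (@mzeta m) mA eps0 (ltW d0).
move=> /(_ _ _ _)/le_lt_trans; apply.
- by move=> k km; exact: (filt_sigma hF (tin km)).
- by move=> k km; exact: (filt_event hF (tin km)).
- move=> k km; have /andP[a1 _] := grid_itv (gt m) (ltnW km).
  have /andP[_ b2] := grid_itv (gt m) km.
  exact: filt_mono hF _ _ a1 (ltW (grid_incr (gt m) km)) (le_trans b2 bT).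
rewrite [X in (_ < X%:E)%E](splitr e) EFinD lee_ltD//.
by rewrite lee_fin /delta mulfK// gt_eqF.
Qed.

End quadratic_variation.

(** * The discrete norm identity *)

Section discrete_norm.
Context (R : realType).
Implicit Types (x y : nat -> nat -> R) (N : nat -> nat).

Lemma cvg0_le (u v : nat -> R) : (\forall l \near \oo, `|u l| <= v l) ->
  v @ \oo --> (0 : R) -> u @ \oo --> (0 : R).
Proof.
move=> uv v0; apply/cvgr0Pnorm_lt => e e0; move/cvgr0Pnorm_lt : v0 => /(_ e e0).
by apply: filterS2 uv => l uv ve; exact: le_lt_trans uv (le_lt_trans (ler_norm _) ve).
Qed.

(** Young's inequality with parameter [q = e / B']: the bounded sum contributes at most [e / 2] and
    the vanishing one eventually less than [e / 2]. *)
Lemma sum_normM_cvg0 x y N (B : R) :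
  (\forall l \near \oo, \sum_(k < N l) x l k ^+ 2 <= B) ->
  (fun l => \sum_(k < N l) y l k ^+ 2) @ \oo --> (0 : R) ->
  (fun l => \sum_(k < N l) `|x l k * y l k|) @ \oo --> (0 : R).
Proof.
move=> xB y0; apply/cvgr0Pnorm_lt => e e0.
pose B' := `|B| + 1; have B'0 : 0 < B' by rewrite ltr_wpDl.
pose q := e / B'; have q0 : 0 < q by rewrite divr_gt0.
have eq0 : 0 < e * q by rewrite mulr_gt0.
move/cvgr0Pnorm_lt : y0 => /(_ _ eq0); apply: filterS2 xB => l xB ye.
rewrite ger0_norm ?sumr_ge0//.
have amgm (u v : R) : `|u * v| <= 2^-1 * (q * u ^+ 2 + q^-1 * v ^+ 2).
  have -> : 2^-1 * (q * u ^+ 2 + q^-1 * v ^+ 2) =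
      2^-1 * q * (`|u| - q^-1 * `|v|) ^+ 2 + `|u * v|.
    rewrite normrM -(real_normK (num_real u)) -(real_normK (num_real v)); field.
    by rewrite gt_eqF.
  by rewrite lerDr mulr_ge0 ?sqr_ge0// mulr_ge0// ltW.
apply: (@le_lt_trans _ _ (\sum_(k < N l) 2^-1 * (q * x l k ^+ 2 + q^-1 * y l k ^+ 2))).
  by apply: ler_sum => k _; exact: amgm.
rewrite -mulr_sumr big_split /= -!mulr_sumr.
have h1 : q * \sum_(k < N l) x l k ^+ 2 <= e.
  rewrite /q mulrAC ler_pdivrMr//; apply: ler_wpM2l; first exact: ltW.
  by rewrite (le_trans xB)// (le_trans (ler_norm _))// lerDl.
have h2 : q^-1 * \sum_(k < N l) y l k ^+ 2 < e.
  rewrite mulrC ltr_pdivrMr//; exact: le_lt_trans (ler_norm _) ye.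
by lra.
Qed.

Variables (N : nat -> nat) (U V z dW : nat -> nat -> R) (D : nat -> R) (sigma K C T0 : R).
Hypotheses (D0 : forall l, 0 <= D l) (ND : forall l, (N l)%:R * D l = T0).
Hypothesis K0 : 0 <= K.
Hypothesis UC : forall l k, (k <= N l)%N -> `|U l k| <= C.
Hypothesis VC : forall l k, (k <= N l)%N -> `|V l k| <= C.

Let EU l k := U l k.+1 - U l k + V l k * z l k.
Let EV l k := V l k.+1 - V l k - U l k * z l k.
Let NN l k := U l k ^+ 2 + V l k ^+ 2.
(** The inverse of the factor by which [NN] is expected to grow over one step. *)
Let c l := (1 + sigma ^+ 2 * K * D l)^-1.

Hypothesis a1 : (fun l => \sum_(k < N l) c l ^+ k.+1 * U l k * EU l k) @ \oo --> (0 : R).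
Hypothesis a2 : (fun l => \sum_(k < N l) c l ^+ k.+1 * V l k * EV l k) @ \oo --> (0 : R).
Hypothesis b1 : (fun l => \sum_(k < N l) EU l k ^+ 2) @ \oo --> (0 : R).
Hypothesis b2 : (fun l => \sum_(k < N l) EV l k ^+ 2) @ \oo --> (0 : R).
Hypothesis e1 : (fun l => \sum_(k < N l) (z l k - sigma * dW l k) ^+ 2) @ \oo --> (0 : R).
Hypothesis d1 : (fun l => \sum_(k < N l) c l ^+ k.+1 * NN l k * (dW l k ^+ 2 - K * D l))
  @ \oo --> (0 : R).
Hypothesis d2 : (fun l => \sum_(k < N l) (dW l k ^+ 2 - K * D l)) @ \oo --> (0 : R).

Let den_ge1 l : 1 <= 1 + sigma ^+ 2 * K * D l.
Proof. by rewrite lerDl; apply: mulr_ge0 => //; exact: mulr_ge0 (sqr_ge0 _) K0. Qed.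

Let c01 l k : 0 <= c l ^+ k <= 1.
Proof.
have den0 : 0 < 1 + sigma ^+ 2 * K * D l by exact: lt_le_trans (den_ge1 l).
have c0 : 0 <= c l by rewrite invr_ge0 ltW.
have c1 : c l <= 1 by rewrite invf_le1.
by rewrite exprn_ge0//= exprn_ile1.
Qed.

Let bounded_dW2 : \forall l \near \oo, \sum_(k < N l) dW l k ^+ 2 <= K * T0 + 1.
Proof.
move/cvgr0Pnorm_lt : d2 => /(_ 1 ltr01); apply: filterS => l h.
have -> : \sum_(k < N l) dW l k ^+ 2 =
    \sum_(k < N l) (dW l k ^+ 2 - K * D l) + K * T0.
  by rewrite sumrB sumr_const card_ord -mulr_natl mulrCA ND subrK.
by rewrite addrC lerD2l (le_trans (ler_norm _))// ltW.
Qed.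

Let bounded_z2 : \forall l \near \oo,
  \sum_(k < N l) z l k ^+ 2 <= 2 * sigma ^+ 2 * (K * T0 + 1) + 2.
Proof.
move/cvgr0Pnorm_lt : e1 => /(_ 1 ltr01); apply: filterS2 bounded_dW2 => l hW he.
apply: (@le_trans _ _ (\sum_(k < N l)
    (2 * sigma ^+ 2 * dW l k ^+ 2 + 2 * (z l k - sigma * dW l k) ^+ 2))).
  apply: ler_sum => k _.
  have := sqr_ge0 (sigma * dW l k - (z l k - sigma * dW l k)); nra.
rewrite big_split /= -!mulr_sumr lerD//.
  by apply: ler_wpM2l => //; exact: mulr_ge0 (ler0n _ _) (sqr_ge0 _).
by rewrite -[leRHS]mulr1 ler_wpM2l// (le_trans (ler_norm _))// ltW.
Qed.

(* The weights [c^k] turn the compensated increments [NN (k+1) - (1 + s) NN k], *)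
(* [s = sigma^2 K D], into a telescoping sum.                                  *)
Lemma discrete_norm_cvg :
  (fun l => c l ^+ N l * NN l (N l) - NN l 0%N) @ \oo --> (0 : R).
Proof.
(* Substitute [dU = EU - V z] and [dV = EV + U z] in the increment of [NN]. The terms [2 U V z]
   cancel and [NN z^2] remains; [z^2] is then expanded around [sigma dW], and [dW^2] around
   [K D]. *)
have stepE l k : c l ^+ k.+1 * NN l k.+1 - c l ^+ k * NN l k =
    2 * (c l ^+ k.+1 * U l k * EU l k) + 2 * (c l ^+ k.+1 * V l k * EV l k) +
    c l ^+ k.+1 * (EU l k ^+ 2 + EV l k ^+ 2
      - 2 * V l k * (z l k * EU l k) + 2 * U l k * (z l k * EV l k)
      + NN l k * ((z l k - sigma * dW l k) ^+ 2
                  + 2 * sigma * (dW l k * (z l k - sigma * dW l k)))) +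
    sigma ^+ 2 * (c l ^+ k.+1 * NN l k * (dW l k ^+ 2 - K * D l)).
  have ck : c l ^+ k = c l ^+ k.+1 * (1 + sigma ^+ 2 * K * D l).
    rewrite exprSr -mulrA /c mulVf ?mulr1// gt_eqF//.
    exact: lt_le_trans ltr01 (den_ge1 l).
  by rewrite ck /NN /EU /EV; ring.
have sumE l : c l ^+ N l * NN l (N l) - NN l 0%N =
    \sum_(k < N l) (c l ^+ k.+1 * NN l k.+1 - c l ^+ k * NN l k).
  have := telescope_sumr (fun k => c l ^+ k * NN l k) (leq0n (N l)).
  by rewrite big_mkord expr0 mul1r => ->.
(* The signed weighted sums must be kept whole, since only their cancellations make them small;
   every other term is bounded summand by summand. *)
pose v l := 2 * `|\sum_(k < N l) c l ^+ k.+1 * U l k * EU l k| +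
  2 * `|\sum_(k < N l) c l ^+ k.+1 * V l k * EV l k| +
  (\sum_(k < N l) EU l k ^+ 2 + \sum_(k < N l) EV l k ^+ 2 +
   2 * C * \sum_(k < N l) `|z l k * EU l k| + 2 * C * \sum_(k < N l) `|z l k * EV l k| +
   2 * C ^+ 2 * (\sum_(k < N l) (z l k - sigma * dW l k) ^+ 2 +
     2 * `|sigma| * \sum_(k < N l) `|dW l k * (z l k - sigma * dW l k)|)) +
  sigma ^+ 2 * `|\sum_(k < N l) c l ^+ k.+1 * NN l k * (dW l k ^+ 2 - K * D l)|.
apply: (@cvg0_le _ v).
  apply: nearW => l; rewrite sumE.
  under eq_bigr do rewrite stepE.
  rewrite !big_split /= -!mulr_sumr /v.
  rewrite (le_trans (ler_normD _ _))// lerD//; last by rewrite normrM ger0_norm// sqr_ge0.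
  rewrite (le_trans (ler_normD _ _))// lerD//.
    rewrite (le_trans (ler_normD _ _))// lerD// normrM ger0_norm//.
  rewrite (le_trans (ler_norm_sum _ _ _))// !mulr_sumr -!big_split /= mulr_sumr -!big_split /=.
  apply: ler_sum => k _.
  rewrite normrM; have /andP[c0 c1] := c01 l k.+1; rewrite (ger0_norm c0).
  apply: le_trans (ler_piMl (normr_ge0 _) c1) _.
  have kN := ltnW (ltn_ord k).
  have Uk := UC kN; have Vk := VC kN.
  have NC : 0 <= NN l k <= 2 * C ^+ 2.
    rewrite addr_ge0 ?sqr_ge0//= /NN -(real_normK (num_real (U l k))).
    rewrite -(real_normK (num_real (V l k))).
    have := normr_ge0 (U l k); have := normr_ge0 (V l k); nra.
  rewrite (le_trans (ler_normD _ _))// lerD//.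
    rewrite (le_trans (ler_normD _ _))// lerD//.
      rewrite (le_trans (ler_normB _ _))// lerD//.
        by rewrite ger0_norm// addr_ge0 ?sqr_ge0.
      by rewrite normrM ler_wpM2r// normrM ger0_norm// ler_wpM2l.
    by rewrite normrM ler_wpM2r// normrM ger0_norm// ler_wpM2l.
  case/andP : NC => N0 NC.
  rewrite normrM (ger0_norm N0) ler_pM// (le_trans (ler_normD _ _))// lerD//.
    by rewrite ger0_norm// sqr_ge0.
  by rewrite normrM normrM (ger0_norm (ler0n R 2)).
have n0 (u : nat -> R) : u @ \oo --> (0 : R) -> (fun l => `|u l|) @ \oo --> (0 : R).
  by move=> /cvg_norm; rewrite normr0.
have k0 (r : R) (u : nat -> R) : u @ \oo --> (0 : R) -> (fun l => r * u l) @ \oo --> (0 : R).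
  by move=> u0; rewrite -[X in _ --> X](mulr0 r); apply: cvgM => //; exact: cvg_cst.
have s0 (u u' : nat -> R) : u @ \oo --> (0 : R) -> u' @ \oo --> (0 : R) ->
    (fun l => u l + u' l) @ \oo --> (0 : R).
  by move=> u0 u'0; rewrite -[X in _ --> X](addr0 0); exact: cvgD.
apply: (s0 (fun l => _ + _ + _)); last exact/k0/n0.
apply: (s0 (fun l => _ + _)).
  by apply: s0; exact/k0/n0.
apply: (s0 _ _ _ _).
  apply: (s0 _ _ _ _); last exact/k0/(sum_normM_cvg0 bounded_z2 b2).
  apply: (s0 _ _ _ _); last exact/k0/(sum_normM_cvg0 bounded_z2 b1).
  exact: s0.
apply/k0/s0 => //.
apply: (k0 _ _).
exact: (@sum_normM_cvg0 _ (fun l k => z l k - sigma * dW l k) _ _ bounded_dW2 e1).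
Qed.

End discrete_norm.

(** * From increments of Ito processes to the norm *)

Section compound_interest.
Context (R : realType).

(* From [1 + u <= exp u] at [u = x / n] and at [u = - x / (n + x)]. *)
Lemma cvg_compound (x : R) : 0 <= x ->
  (fun n : nat => (1 + x / n.+1%:R) ^+ n.+1) @ \oo --> expR x.
Proof.
move=> x0.
have lo (n : nat) : expR (x - x ^+ 2 / n.+1%:R) <= (1 + x / n.+1%:R) ^+ n.+1.
  have n0 : 0 < n.+1%:R :> R by rewrite ltr0n.
  have [m mE] : exists m : R, n.+1%:R = m by exists n.+1%:R.
  rewrite mE in n0 *.
  have mx0 : 0 < m + x by rewrite ltr_wpDr.
  have h : expR (x / (m + x)) <= 1 + x / m.
    have := expR_ge1Dx (- (x / (m + x))).
    have -> : 1 + - (x / (m + x)) = (1 + x / m)^-1.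
      have m0 : m != 0 by rewrite gt_eqF.
      have mx : m + x != 0 by rewrite gt_eqF.
      rewrite (_ : 1 + x / m = (m + x) / m); last by rewrite mulrDl divff.
      by rewrite invf_div -[1](divff mx) -mulrBl addrK.
    rewrite expRN lef_pV2 ?posrE ?expR_gt0//.
    by rewrite ltr_wpDr// divr_ge0// ltW.
  apply: (@le_trans _ _ (expR (x / (m + x)) ^+ n.+1)); last first.
    by rewrite lerXn2r// ?nnegrE ?expR_ge0// addr_ge0// divr_ge0// ltW.
  rewrite -expRM_natr ler_expR mE.
  have -> : x / (m + x) * m = x - x ^+ 2 / (m + x) by field; rewrite gt_eqF.
  rewrite lerD2l lerN2; apply: ler_wpM2l; first exact: sqr_ge0.
  by rewrite lef_pV2 ?posrE// lerDl.
have hi (n : nat) : (1 + x / n.+1%:R) ^+ n.+1 <= expR x.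
  have -> : expR x = expR (x / n.+1%:R) ^+ n.+1.
    by rewrite -expRM_natr divfK// pnatr_eq0.
  by rewrite lerXn2r// ?nnegrE ?expR_ge0 ?addr_ge0 ?divr_ge0// expR_ge1Dx.
have lim : (fun n : nat => expR (x - x ^+ 2 / n.+1%:R)) @ \oo --> expR x.
  have l1 : (fun n : nat => x - x ^+ 2 / n.+1%:R) @ \oo --> x.
    rewrite -[X in _ --> X]subr0; apply: cvgB; first exact: cvg_cst.
    rewrite -[X in _ --> X](mulr0 (x ^+ 2)); apply: cvgM; first exact: cvg_cst.
    exact: cvg_harmonic.
  exact: (cvg_comp _ expR l1 (@continuous_expR R x)).
apply: (squeeze_cvgr _ lim (cvg_cst (expR x))); apply: nearW => n.
by rewrite lo hi.
Qed.

End compound_interest.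

Section pathwise_errors.
Context (R : realType).
Variables (theta b : R).
Hypothesis theta_b : theta < b.
Local Notation mu := (@lebesgue_measure R).
Local Notation t := (upart theta b).
Implicit Types (a p X IX : R -> R) (s : nat -> nat -> R).

Let tab m k : (k <= m.+1)%N -> t m k \in `[theta, b].
Proof. by move=> km; rewrite in_itv /= (grid_itv (upart_grid theta_b m) km). Qed.

Let tS m k : (k < m.+1)%N -> t m k <= t m k.+1.
Proof. by move=> km; exact/ltW/(grid_incr (upart_grid theta_b m) km). Qed.

Lemma Rintegral_incr a (x z : R) : mu.-integrable `[theta, b] (EFin \o a) ->
  theta <= x -> x <= z -> z <= b ->
  \int[mu]_(u in `[theta, z]) a u - \int[mu]_(u in `[theta, x]) a u =
  \int[mu]_(u in `]x, z]) a u.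
Proof.
move=> ia tx xz zb; apply: Rintegral_itvB; rewrite ?bnd_simp//.
apply: integrableS ia => // u /=; rewrite !in_itv /= => /andP[-> uz].
exact: le_trans uz zb.
Qed.

Lemma frozen_drift_error p a (x z e : R) :
  mu.-integrable `[theta, b] (EFin \o a) ->
  mu.-integrable `[theta, b] (EFin \o (fun u => p u * a u)) ->
  theta <= x -> x <= z -> z <= b ->
  (forall u, u \in `[x, z] -> `|p u - p x| <= e) ->
  `|\int[mu]_(u in `]x, z]) (p u * a u) - p x * \int[mu]_(u in `]x, z]) a u| <=
  e * \int[mu]_(u in `]x, z]) `|a u|.
Proof.
move=> ia ipa tx xz zb hp.
have sub : `]x, z]%classic `<=` `[theta, b]%classic.
  move=> u /=; rewrite !in_itv /= => /andP[xu uz].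
  by rewrite (le_trans tx (ltW xu)) (le_trans uz zb).
have ia' : mu.-integrable `]x, z] (EFin \o a) by exact: integrableS ia.
have ipa' : mu.-integrable `]x, z] (EFin \o (fun u => p u * a u)) by exact: integrableS ipa.
have iza : mu.-integrable `]x, z] (EFin \o (fun u => p x * a u)).
  have -> : EFin \o (fun u => p x * a u) = (fun u => (p x)%:E * (a u)%:E)%E by [].
  exact: integrableZl.
rewrite -RintegralZl// -RintegralB//.
have idiff : mu.-integrable `]x, z] (EFin \o (fun u => p u * a u - p x * a u)).
  have -> : EFin \o (fun u => p u * a u - p x * a u) =
    (fun u => (p u * a u)%:E - (p x * a u)%:E)%E by [].
  exact: integrableB.
apply: le_trans (le_normr_Rintegral _ idiff) _ => //.
rewrite -RintegralZl//; last first.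
  by have := integrable_abse ia'.
apply: le_Rintegral => //.
- by have := integrable_abse idiff.
- have -> : EFin \o (fun u => e * `|a u|) = (fun u => e%:E * (abse \o (EFin \o a)) u)%E by [].
  by apply: integrableZl => //; exact: integrable_abse.
move=> u uin; rewrite -mulrBl normrM ler_wpM2r// hp//.
by move: uin; rewrite /= !in_itv /= => /andP[/ltW -> ->].
Qed.

Lemma Rintegral_partition_sum a m : mu.-integrable `[theta, b] (EFin \o a) ->
  \sum_(k < m.+1) \int[mu]_(u in `]t m k, t m k.+1]) a u <=
  \int[mu]_(u in `[theta, b]) a u.
Proof.
move=> ia.
have -> : \sum_(k < m.+1) \int[mu]_(u in `]t m k, t m k.+1]) a u =
    \sum_(0 <= k < m.+1) (\int[mu]_(u in `[theta, t m k.+1]) a u -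
      \int[mu]_(u in `[theta, t m k]) a u).
  rewrite big_mkord; apply: eq_bigr => k _; rewrite Rintegral_incr//.
  - by have := tab (ltnW (ltn_ord k)); rewrite in_itv /= => /andP[].
  - exact: tS.
  - by have := tab (ltn_ord k); rewrite in_itv /= => /andP[].
rewrite telescope_sumr//.
rewrite (grid_right (upart_grid theta_b m)) (grid_left (upart_grid theta_b m)).
by rewrite set_itv1 Rintegral_set1 subr0.
Qed.

(** The rate is such that the errors of [m + 1] increments still add up to [O(1 / m)]. *)
Definition small_increment_errors s IX := \forall m \near \oo, forall k, (k <= m.+1)%N ->
  `|s m k - IX (t m k)| <= m.+1%:R ^- 2.

Lemma diffusion_error_cvg s1 s2 I1 I2 p (C : R) : 0 <= C ->
  (forall u, u \in `[theta, b] -> `|p u| <= C) ->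
  small_increment_errors s1 I1 -> small_increment_errors s2 I2 ->
  (fun m => \sum_(k < m.+1) `|((I2 (t m k.+1) - I2 (t m k)) - p (t m k) * (I1 (t m k.+1) - I1 (t m k)))
     - ((s2 m k.+1 - s2 m k) - p (t m k) * (s1 m k.+1 - s1 m k))|) @ \oo --> (0 : R).
Proof.
move=> C0 pC h1 h2.
apply: (@cvg0_le _ _ (fun m => (2 + 2 * C) * m.+1%:R^-1)); last first.
  rewrite -[X in _ --> X](mulr0 (2 + 2 * C)); apply: cvgM; first exact: cvg_cst.
  exact: cvg_harmonic.
apply: filterS2 h1 h2 => m h1 h2.
rewrite ger0_norm ?sumr_ge0//.
apply: (@le_trans _ _ (\sum_(k < m.+1) (2 + 2 * C) * m.+1%:R ^- 2)).
  apply: ler_sum => k _.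
  have a1 := h1 k (ltnW (ltn_ord k)); have a2 := h1 k.+1 (ltn_ord k).
  have a3 := h2 k (ltnW (ltn_ord k)); have a4 := h2 k.+1 (ltn_ord k).
  have pk := pC _ (tab (ltnW (ltn_ord k))).
  set e := _ ^- 2 in a1 a2 a3 a4 *.
  have e0 : 0 <= e by exact: le_trans (normr_ge0 _) a1.
  rewrite (_ : _ - _ = - ((s2 m k.+1 - I2 (t m k.+1)) - (s2 m k - I2 (t m k)) -
    p (t m k) * ((s1 m k.+1 - I1 (t m k.+1)) - (s1 m k - I1 (t m k))))); last by ring.
  rewrite normrN (le_trans (ler_normB _ _))// mulrDl lerD//.
    by rewrite (le_trans (ler_normB _ _))// mulr2n mulrDl mul1r lerD.
  rewrite normrM [2 * C]mulrC -mulrA ler_pM//.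
  by rewrite (le_trans (ler_normB _ _))// mulr2n mulrDl mul1r lerD.
have m0 : m.+1%:R != 0 :> R by rewrite pnatr_eq0.
rewrite sumr_const card_ord -[leLHS]mulr_natr expr2 invfM mulrA.
by rewrite -[leLHS]mulrA mulVf// mulr1.
Qed.

(** By uniform continuity, freezing [p] on a fine grid costs at most [e / (L + 1)] times the
    integral of [|a|], which is [L]. *)
Lemma drift_error_cvg p a : {within `[theta, b], continuous p} ->
  mu.-integrable `[theta, b] (EFin \o a) ->
  mu.-integrable `[theta, b] (EFin \o (fun u => p u * a u)) ->
  (fun m => \sum_(k < m.+1) `|\int[mu]_(u in `]t m k, t m k.+1]) (p u * a u) -
     p (t m k) * \int[mu]_(u in `]t m k, t m k.+1]) a u|) @ \oo --> (0 : R).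
Proof.
move=> cp ia ipa; apply/cvgr0Pnorm_lt => e e0.
set L := \int[mu]_(u in `[theta, b]) `|a u|.
have L0 : 0 <= L by exact: Rintegral_ge0.
have L1 : 0 < L + 1 by rewrite ltr_wpDl.
have q0 : 0 < e / (L + 1) by rewrite divr_gt0.
apply: filterS (upart_osc theta_b cp q0) => m osc.
rewrite ger0_norm ?sumr_ge0//.
apply: (@le_lt_trans _ _ (\sum_(k < m.+1) e / (L + 1) * \int[mu]_(u in `]t m k, t m k.+1]) `|a u|)).
  apply: ler_sum => k _.
  have := tab (ltnW (ltn_ord k)); have := tab (ltn_ord k).
  rewrite !in_itv /= => /andP[_ kb] /andP[tk _].
  by apply: frozen_drift_error => //; [exact: tS|move=> u uk; exact/ltW/osc].
rewrite -mulr_sumr; apply: (@le_lt_trans _ _ (e / (L + 1) * L)).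
  apply: ler_wpM2l; first exact: ltW.
  exact: (@Rintegral_partition_sum (fun u => `|a u|) m (integrable_abse ia)).
by rewrite mulrAC ltr_pdivrMr// ltr_pM2l// ltrDl.
Qed.

Lemma ito_error_cvg s1 s2 I1 I2 X y p a : {within `[theta, b], continuous p} ->
  mu.-integrable `[theta, b] (EFin \o a) ->
  mu.-integrable `[theta, b] (EFin \o (fun u => p u * a u)) ->
  (forall u, u \in `[theta, b] -> X u = X theta + \int[mu]_(v in `[theta, u]) (p v * a v) + I2 u) ->
  (forall u, u \in `[theta, b] -> y u = y theta + \int[mu]_(v in `[theta, u]) a v + I1 u) ->
  small_increment_errors s1 I1 -> small_increment_errors s2 I2 ->
  (fun m => \sum_(k < m.+1) `|((X (t m k.+1) - X (t m k)) - p (t m k) * (y (t m k.+1) - y (t m k)))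
     - ((s2 m k.+1 - s2 m k) - p (t m k) * (s1 m k.+1 - s1 m k))|) @ \oo --> (0 : R).
Proof.
move=> cp ia ipa Xe ye h1 h2.
have [C C0 pC] := within_bounded (ltW theta_b) cp.
have e1 := diffusion_error_cvg C0 pC h1 h2; have e2 := drift_error_cvg cp ia ipa.
have s0 (v v' : nat -> R) : v @ \oo --> (0 : R) -> v' @ \oo --> (0 : R) ->
    (fun l => v l + v' l) @ \oo --> (0 : R).
  by move=> v0 v'0; rewrite -[X in _ --> X](addr0 0); exact: cvgD.
apply: cvg0_le (s0 _ _ e1 e2).
apply: nearW => m; rewrite ger0_norm ?sumr_ge0//= -big_split /=.
apply: ler_sum => k _.
have tk := tab (ltnW (ltn_ord k)); have tk1 := tab (ltn_ord k).
have := tk; have := tk1; rewrite !in_itv /= => /andP[_ kb] /andP[kt _].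
rewrite -!Rintegral_incr ?tS// (Xe _ tk) (Xe _ tk1) (ye _ tk) (ye _ tk1).
apply: le_trans (ler_normD _ _); rewrite le_eqVlt; apply/orP; left; apply/eqP.
by congr `|_|; ring.
Qed.

(** A continuous primitive has zero quadratic variation: the sum of squares is at most the largest
    increment times the integral of [|a|]. *)
Lemma sqr_increments_cvg0 a : mu.-integrable `[theta, b] (EFin \o a) ->
  {within `[theta, b], continuous (fun u => \int[mu]_(v in `[theta, u]) a v)} ->
  (fun m => \sum_(k < m.+1) (\int[mu]_(u in `]t m k, t m k.+1]) a u) ^+ 2) @ \oo --> (0 : R).
Proof.
move=> ia ca; apply/cvgr0Pnorm_lt => e e0.
set L := \int[mu]_(u in `[theta, b]) `|a u|.
have L0 : 0 <= L by exact: Rintegral_ge0.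
have L1 : 0 < L + 1 by rewrite ltr_wpDl.
have q0 : 0 < e / (L + 1) by rewrite divr_gt0.
apply: filterS (upart_osc theta_b ca q0) => m osc.
rewrite ger0_norm; last by apply: sumr_ge0 => k _; exact: sqr_ge0.
apply: (@le_lt_trans _ _ (\sum_(k < m.+1) e / (L + 1) * \int[mu]_(u in `]t m k, t m k.+1]) `|a u|)).
  apply: ler_sum => k _.
  have tk := tab (ltnW (ltn_ord k)); have tk1 := tab (ltn_ord k).
  have := tk; have := tk1; rewrite !in_itv /= => /andP[_ kb] /andP[kt _].
  have kk := tS (ltn_ord k).
  rewrite -(real_normK (num_real (\int[mu]_(u in _) a u))) expr2 ler_pM//.
    rewrite -Rintegral_incr//; apply/ltW/osc => //.
    by rewrite in_itv /= kk lexx.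
  apply: le_normr_Rintegral => //; apply: integrableS ia => //.
  move=> u /=; rewrite !in_itv /= => /andP[ku uk].
  by rewrite (le_trans kt (ltW ku)) (le_trans uk kb).
rewrite -mulr_sumr; apply: (@le_lt_trans _ _ (e / (L + 1) * L)).
  apply: ler_wpM2l; first exact: ltW.
  exact: (@Rintegral_partition_sum (fun u => `|a u|) m (integrable_abse ia)).
by rewrite mulrAC ltr_pdivrMr// ltr_pM2l// ltrDl.
Qed.

End pathwise_errors.

Section transfer.
Context (R : realType).
Variables (N : nat -> nat) (e E : nat -> nat -> R).
Hypothesis eE : (fun m => \sum_(k < N m) `|E m k - e m k|) @ \oo --> (0 : R).

Lemma sum_transfer (zeta : nat -> nat -> R) (C : R) :
  (forall m k, (k < N m)%N -> `|zeta m k| <= C) ->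
  (fun m => \sum_(k < N m) zeta m k * e m k) @ \oo --> (0 : R) ->
  (fun m => \sum_(k < N m) zeta m k * E m k) @ \oo --> (0 : R).
Proof.
move=> zC h.
have d0 : (fun m => \sum_(k < N m) zeta m k * (E m k - e m k)) @ \oo --> (0 : R).
  apply: (@cvg0_le _ _ (fun m => C * \sum_(k < N m) `|E m k - e m k|)); last first.
    by rewrite -[X in _ --> X](mulr0 C); apply: cvgM => //; exact: cvg_cst.
  apply: nearW => m; rewrite (le_trans (ler_norm_sum _ _ _))// mulr_sumr.
  by apply: ler_sum => k _; rewrite normrM ler_wpM2r// zC.
rewrite -[X in _ --> X](addr0 0).
rewrite (_ : (fun m => _) = (fun m => \sum_(k < N m) zeta m k * e m k) \+
  (fun m => \sum_(k < N m) zeta m k * (E m k - e m k))); first exact: cvgD.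
apply/funext => m /=; rewrite -big_split /=; apply: eq_bigr => k _; ring.
Qed.

(** [E^2 <= 2 e^2 + 2 (E - e)^2], and eventually every [|E - e|] is at most 1, so its square is at
    most itself. *)
Lemma sqr_sum_transfer :
  (fun m => \sum_(k < N m) e m k ^+ 2) @ \oo --> (0 : R) ->
  (fun m => \sum_(k < N m) E m k ^+ 2) @ \oo --> (0 : R).
Proof.
move=> h.
have h2 : (fun m => 2 * (\sum_(k < N m) e m k ^+ 2 + \sum_(k < N m) `|E m k - e m k|)) @ \oo --> (0 : R).
  rewrite -[X in _ --> X](mulr0 2); apply: cvgM; first exact: cvg_cst.
  by rewrite -[X in _ --> X](addr0 0); exact: cvgD.
apply: cvg0_le h2; move/cvgr0Pnorm_lt : eE => /(_ 1 ltr01); apply: filterS => m.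
rewrite ger0_norm ?sumr_ge0// => q1.
rewrite ger0_norm; last by apply: sumr_ge0 => k _; exact: sqr_ge0.
rewrite -big_split /= mulr_sumr; apply: ler_sum => k _.
have qk : `|E m k - e m k| <= 1.
  apply: le_trans (ltW q1); rewrite (bigD1 k)//= lerDl.
  by apply: sumr_ge0.
have := normr_ge0 (E m k - e m k).
have : (E m k - e m k) ^+ 2 = `|E m k - e m k| ^+ 2 by rewrite real_normK// num_real.
have := sqr_ge0 (E m k - 2 * e m k); nra.
Qed.

End transfer.

Lemma cvg_subseq0 (R : realType) (u : nat -> R) (n : nat -> nat) :
  (forall l, (l <= n l)%N) -> u @ \oo --> (0 : R) -> (fun l => u (n l)) @ \oo --> (0 : R).
Proof.
move=> ln u0; apply: (cvg_comp n u _ u0) => S [M _ hM]; exists M => // l Ml.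
by apply: hM; exact: leq_trans Ml (ln l).
Qed.

Lemma invDX_itv (R : realFieldType) (x : R) k : 0 <= x -> 0 <= (1 + x)^-1 ^+ k <= 1.
Proof.
move=> x0; have h1 : 1 <= 1 + x by rewrite lerDl.
have c0 : 0 <= (1 + x)^-1 by rewrite invr_ge0 (le_trans _ h1).
have c1 : (1 + x)^-1 <= 1 by rewrite invf_le1// (lt_le_trans _ h1).
by rewrite exprn_ge0//= exprn_ile1.
Qed.

Section pathwise_norm.
Context (R : realType).
Variables (theta b : R).
Hypothesis theta_b : theta < b.
Local Notation mu := (@lebesgue_measure R).
Local Notation t := (upart theta b).
Variables (U V y G a f Iu Iv Iy I0 w : R -> R) (sU sV sy s0 : nat -> nat -> R).
Variables (sigma K : R) (n : nat -> nat).
Hypotheses (K0 : 0 <= K) (ln : forall l, (l <= n l)%N).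
Hypotheses (cU : {within `[theta, b], continuous U})
  (cV : {within `[theta, b], continuous V})
  (cy : {within `[theta, b], continuous y})
  (cG : {within `[theta, b], continuous G})
  (cI0 : {within `[theta, b], continuous I0}).
Hypothesis G0 : forall s, s \in `[theta, b] -> 0 < G s.
Local Notation pU := (fun s => - V s / G s).
Local Notation pV := (fun s => U s / G s).
Hypotheses (ia : mu.-integrable `[theta, b] (EFin \o a))
  (iaU : mu.-integrable `[theta, b] (EFin \o (fun s => pU s * a s)))
  (iaV : mu.-integrable `[theta, b] (EFin \o (fun s => pV s * a s)))
  (if_ : mu.-integrable `[theta, b] (EFin \o f)).
Hypothesis Ue : forall s, s \in `[theta, b] ->
  U s = U theta + \int[mu]_(v in `[theta, s]) (pU v * a v) + Iu s.
Hypothesis Ve : forall s, s \in `[theta, b] ->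
  V s = V theta + \int[mu]_(v in `[theta, s]) (pV v * a v) + Iv s.
Hypothesis ye : forall s, s \in `[theta, b] ->
  y s = y theta + \int[mu]_(v in `[theta, s]) a v + Iy s.
Hypothesis yf : forall s, s \in `[theta, b] ->
  y s = y theta + \int[mu]_(v in `[theta, s]) f v + I0 s.
Hypotheses (hsU : small_increment_errors theta b sU Iu)
  (hsV : small_increment_errors theta b sV Iv)
  (hsy : small_increment_errors theta b sy Iy)
  (hs0 : small_increment_errors theta b s0 I0).

Let c (m : nat) := (1 + sigma ^+ 2 * K * ((b - theta) / m.+1%:R))^-1.
Let eU m k := (sU m k.+1 - sU m k) - pU (t m k) * (sy m k.+1 - sy m k).
Let eV m k := (sV m k.+1 - sV m k) - pV (t m k) * (sy m k.+1 - sy m k).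
Let e0 m k := (s0 m k.+1 - s0 m k) - (sigma * G (t m k)) * (w (t m k.+1) - w (t m k)).
Let NN s := U s ^+ 2 + V s ^+ 2.
Let q m k := (w (t m k.+1) - w (t m k)) ^+ 2 - K * (t m k.+1 - t m k).

Hypothesis hU : (fun l => \sum_(k < (n l).+1) c (n l) ^+ k.+1 * U (t (n l) k) * eU (n l) k)
  @ \oo --> (0 : R).
Hypothesis hU2 : (fun l => \sum_(k < (n l).+1) eU (n l) k ^+ 2) @ \oo --> (0 : R).
Hypothesis hV : (fun l => \sum_(k < (n l).+1) c (n l) ^+ k.+1 * V (t (n l) k) * eV (n l) k)
  @ \oo --> (0 : R).
Hypothesis hV2 : (fun l => \sum_(k < (n l).+1) eV (n l) k ^+ 2) @ \oo --> (0 : R).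
Hypothesis h0 : (fun l => \sum_(k < (n l).+1) e0 (n l) k ^+ 2) @ \oo --> (0 : R).
Hypothesis hq : (fun l => \sum_(k < (n l).+1) c (n l) ^+ k.+1 * NN (t (n l) k) * q (n l) k)
  @ \oo --> (0 : R).
Hypothesis hq1 : (fun l => \sum_(k < (n l).+1) q (n l) k) @ \oo --> (0 : R).

Let tab m k : (k <= m.+1)%N -> t m k \in `[theta, b].
Proof. by move=> km; rewrite in_itv /= (grid_itv (upart_grid theta_b m) km). Qed.

Let c01 m k : 0 <= c m ^+ k <= 1.
Proof.
apply: invDX_itv; apply: mulr_ge0; first exact: mulr_ge0 (sqr_ge0 _) K0.
by rewrite divr_ge0// subr_ge0 ltW.
Qed.

Let within_div (X : R -> R) : {within `[theta, b], continuous X} ->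
  {within `[theta, b], continuous (fun s => X s / G s)}.
Proof.
move=> cX; apply/subspace_continuousP => s sin; apply: cvgM.
  exact: (subspace_continuousP _ _).1 cX s sin.
apply: cvgV; first by rewrite gt_eqF// G0.
exact: (subspace_continuousP _ _).1 cG s sin.
Qed.

Let cpU : {within `[theta, b], continuous pU}.
Proof. by apply: within_div; exact: withinN. Qed.

Let cpV : {within `[theta, b], continuous pV}.
Proof. exact: within_div. Qed.

Let z m k := (y (t m k.+1) - y (t m k)) / G (t m k).

(** [G] stands for [y^gamma]. The pair [a, Iy] is the decomposition of [y] shared with [U] and [V];
    the pair [f, I0] is the one from which [z - sigma dw] is estimated. The sums known for the
    simple integrals [sU], [sV], [sy], [s0] are transferred to the true increments, and
    [discrete_norm_cvg] is applied along [n]. *)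
Lemma pathwise_norm : NN b = NN theta * expR (sigma ^+ 2 * K * (b - theta)).
Proof.
have [CU CU0 UC] := within_bounded (ltW theta_b) cU.
have [CV CV0 VC] := within_bounded (ltW theta_b) cV.
have qU := cvg_subseq0 ln (ito_error_cvg theta_b cpU ia iaU Ue ye hsy hsU).
have qV := cvg_subseq0 ln (ito_error_cvg theta_b cpV ia iaV Ve ye hsy hsV).
pose EU m k := U (t m k.+1) - U (t m k) + V (t m k) * z m k.
pose EV m k := V (t m k.+1) - V (t m k) - U (t m k) * z m k.
have EUE m k : EU m k = (U (t m k.+1) - U (t m k)) - pU (t m k) * (y (t m k.+1) - y (t m k)).
  by rewrite /EU /z; ring.
have EVE m k : EV m k = (V (t m k.+1) - V (t m k)) - pV (t m k) * (y (t m k.+1) - y (t m k)).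
  by rewrite /EV /z; ring.
have dU : (fun l => \sum_(k < (n l).+1) `|EU (n l) k - eU (n l) k|) @ \oo --> (0 : R).
  by apply: cvg_trans qU; apply: near_eq_cvg; apply: nearW => l; apply: eq_bigr => k _; rewrite EUE.
have dV : (fun l => \sum_(k < (n l).+1) `|EV (n l) k - eV (n l) k|) @ \oo --> (0 : R).
  by apply: cvg_trans qV; apply: near_eq_cvg; apply: nearW => l; apply: eq_bigr => k _; rewrite EVE.
have bdd (X : R -> R) (C : R) : (forall s, s \in `[theta, b] -> `|X s| <= C) ->
    forall l k, (k < (n l).+1)%N -> `|c (n l) ^+ k.+1 * X (t (n l) k)| <= C.
  move=> XC l k kn; rewrite normrM; have /andP[c0 c1] := c01 (n l) k.+1.
  rewrite (ger0_norm c0); apply: le_trans (ler_piMl (normr_ge0 _) c1) _.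
  by apply: XC; exact: tab (ltnW kn).
pose N' l := (n l).+1.
have a1 := @sum_transfer _ N' (fun l => eU (n l)) (fun l => EU (n l)) dU _ _ (bdd _ _ UC) hU.
have a2 := @sum_transfer _ N' (fun l => eV (n l)) (fun l => EV (n l)) dV _ _ (bdd _ _ VC) hV.
have b1 := @sqr_sum_transfer _ N' (fun l => eU (n l)) (fun l => EU (n l)) dU hU2.
have b2 := @sqr_sum_transfer _ N' (fun l => eV (n l)) (fun l => EV (n l)) dV hV2.
have cF : {within `[theta, b], continuous (fun s => \int[mu]_(v in `[theta, s]) f v)}.
  apply: (@subspace_eq_continuous _ _ _ (fun s => y s - y theta - I0 s)).
    by move=> s /set_mem sin /=; rewrite (yf sin) addrAC addrK addrAC subrr add0r.
  apply/subspace_continuousP => s sin; apply: cvgB.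
    apply: cvgB; last exact: cvg_cst.
    exact: (subspace_continuousP _ _).1 cy s sin.
  exact: (subspace_continuousP _ _).1 cI0 s sin.
have f2 := cvg_subseq0 ln (sqr_increments_cvg0 theta_b if_ cF).
have csG : {within `[theta, b], continuous (fun s => sigma * G s)}.
  by apply: withinM => //; exact: within_cst.
have [CG CG0 GC] := within_bounded (ltW theta_b) csG.
(* The Wiener path is its own approximation, with zero error. *)
have hw : small_increment_errors theta b (fun m k => w (t m k)) w.
  by apply: nearW => m k _; rewrite subrr normr0.
have q0 := cvg_subseq0 ln (diffusion_error_cvg theta_b CG0 GC hw hs0).
have I2 := @sqr_sum_transfer _ N' (fun l => e0 (n l)) (fun l k =>
  (I0 (t (n l) k.+1) - I0 (t (n l) k)) -
  (sigma * G (t (n l) k)) * (w (t (n l) k.+1) - w (t (n l) k))) q0 h0.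
have c1 : {within `[theta, b], continuous (cst 1 : R -> R)}.
  by apply: continuous_subspaceT => s; exact: cvg_cst.
have [Ci Ci0 iG] := within_bounded (ltW theta_b) (within_div c1).
(* [z - sigma dw] is [1 / G] times the increment of the drift plus [dI0 - sigma G dw]; [1 / G] is
   bounded, and both terms have vanishing sums of squares. *)
have e1 : (fun l => \sum_(k < (n l).+1)
    (z (n l) k - sigma * (w (t (n l) k.+1) - w (t (n l) k))) ^+ 2) @ \oo --> (0 : R).
  set v1 := (fun l => _) in f2; set v2 := (fun l => _) in I2.
  have lim : (fun l => Ci ^+ 2 * (2 * v1 l + 2 * v2 l)) @ \oo --> (0 : R).
    rewrite -[X in _ --> X](mulr0 (Ci ^+ 2)); apply: cvgM; first exact: cvg_cst.
    rewrite -[X in _ --> X](addr0 0).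
    by apply: cvgD; rewrite -[X in _ --> X](mulr0 2); apply: cvgM => //; exact: cvg_cst.
  apply: cvg0_le lim; apply: nearW => l.
  rewrite ger0_norm; last by apply: sumr_ge0 => k _; exact: sqr_ge0.
  rewrite /v1 /v2 !mulr_sumr -big_split /= mulr_sumr; apply: ler_sum => k _.
  have tk := tab (ltnW (ltn_ord k)); have tk1 := tab (ltn_ord k).
  have := tk; have := tk1; rewrite !in_itv /= => /andP[_ kb] /andP[kt _].
  have kk := ltW (grid_incr (upart_grid theta_b (n l)) (ltn_ord k)).
  rewrite -(Rintegral_incr if_ kt kk kb) /z (yf tk) (yf tk1).
  set F1 := \int[mu]_(v in `[theta, t (n l) k.+1]) f v.
  set F0 := \int[mu]_(v in `[theta, t (n l) k]) f v.
  set J1 := I0 (t (n l) k.+1); set J0 := I0 (t (n l) k).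
  set W := w (t (n l) k.+1) - w (t (n l) k).
  have g0 := G0 tk; have gC := iG _ tk; rewrite /= mul1r in gC.
  have gn : G (t (n l) k) != 0 by rewrite gt_eqF.
  have -> : (y theta + F1 + J1 - (y theta + F0 + J0)) / G (t (n l) k) - sigma * W =
      (G (t (n l) k))^-1 * ((F1 - F0) + ((J1 - J0) - sigma * G (t (n l) k) * W)).
    by field.
  rewrite exprMn ler_pM ?sqr_ge0//.
    by rewrite -(real_normK (num_real (G _)^-1)) lerXn2r// nnegrE.
  set A := F1 - F0; set B := _ - _ * _; have := sqr_ge0 (A - B); nra.
pose U' l k := U (t (n l) k); pose V' l k := V (t (n l) k).
pose z' l k := z (n l) k; pose W' l k := w (t (n l) k.+1) - w (t (n l) k).
pose D l := (b - theta) / (n l).+1%:R.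
have D0 l : 0 <= D l by rewrite divr_ge0// subr_ge0 ltW.
have ND l : (n l).+1%:R * D l = b - theta by rewrite mulrC divfK// pnatr_eq0.
pose C := CU + CV.
have C0 : 0 <= C by rewrite addr_ge0.
have UC' l k : (k <= (n l).+1)%N -> `|U' l k| <= C.
  by move=> kn; rewrite (le_trans (UC _ (tab kn)))// lerDl.
have VC' l k : (k <= (n l).+1)%N -> `|V' l k| <= C.
  by move=> kn; rewrite (le_trans (VC _ (tab kn)))// lerDr.
have qE l k : q (n l) k = W' l k ^+ 2 - K * D l by rewrite /q upart_step.
have d1 : (fun l => \sum_(k < (n l).+1) (1 + sigma ^+ 2 * K * D l)^-1 ^+ k.+1 *
    (U' l k ^+ 2 + V' l k ^+ 2) * (W' l k ^+ 2 - K * D l)) @ \oo --> (0 : R).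
  by apply: cvg_trans hq; apply: near_eq_cvg; apply: nearW => l; apply: eq_bigr => k _; rewrite qE.
have d2 : (fun l => \sum_(k < (n l).+1) (W' l k ^+ 2 - K * D l)) @ \oo --> (0 : R).
  by apply: cvg_trans hq1; apply: near_eq_cvg; apply: nearW => l; apply: eq_bigr => k _; rewrite qE.
have := @discrete_norm_cvg _ (fun l => (n l).+1) U' V' z' W' D sigma K C (b - theta)
  D0 ND K0 UC' VC' a1 a2 b1 b2 e1 d1 d2.
set x := sigma ^+ 2 * K * (b - theta).
have x0 : 0 <= x.
  by apply: mulr_ge0; [exact: mulr_ge0 (sqr_ge0 _) K0|rewrite subr_ge0 ltW].
have ninf : n @ \oo --> \oo.
  by move=> S [M _ hM]; exists M => // l Ml; apply: hM; exact: leq_trans Ml (ln l).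
(* The final weight tends to the inverse exponential by [cvg_compound]; the two limits of the same
   sequence then identify [NN b]. *)
have cc : (fun l => (1 + sigma ^+ 2 * K * D l)^-1 ^+ (n l).+1) @ \oo --> (expR x)^-1.
  have := cvg_comp n _ ninf (cvg_compound x0).
  move=> /(cvgV (lt0r_neq0 (expR_gt0 x))).
  apply: cvg_trans; apply: near_eq_cvg; apply: nearW => l /=.
  by rewrite exprVn /x /D -mulrA.
move=> lim.
have lim2 : (fun l => (1 + sigma ^+ 2 * K * D l)^-1 ^+ (n l).+1 * NN b - NN theta) @ \oo -->
    (expR x)^-1 * NN b - NN theta.
  by apply: cvgB; [apply: cvgM => //; exact: cvg_cst|exact: cvg_cst].
have lim3 : (fun l => (1 + sigma ^+ 2 * K * D l)^-1 ^+ (n l).+1 * NN b - NN theta) @ \oo --> (0 : R).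
  apply: cvg_trans lim; apply: near_eq_cvg; apply: nearW => l /=.
  rewrite /U' /V' /NN (grid_right (upart_grid theta_b (n l))).
  by rewrite (grid_left (upart_grid theta_b (n l))).
have lim_eq : (expR x)^-1 * NN b - NN theta = 0.
  exact: (cvg_unique (@norm_hausdorff _ _) lim2 lim3).
move/eqP: lim_eq; rewrite subr_eq0 => /eqP <-.
by rewrite mulrAC mulVf ?mul1r// gt_eqF// expR_gt0.
Qed.

End pathwise_norm.

(** * The squared modulus at a fixed time *)

(** Borel-Cantelli with thresholds [1 / (l + 1)], applied to the union over the finitely many [i],
    gives one subsequence that serves them all. *)
Lemma diagonal_small d (Omega : measurableType d) (R : realType) (P : probability Omega R)
    (A : set Omega) (N : nat) (X : nat -> nat -> Omega -> R) :
  measurable A -> (forall i m, (i < N)%N -> measurable_fun setT (X i m)) ->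
  (forall i m omega, (i < N)%N -> 0 <= X i m omega) ->
  (forall i eps, (i < N)%N -> 0 < eps ->
    (fun m => P (A `&` [set omega | eps <= X i m omega])) @ \oo --> 0%E) ->
  exists2 n : nat -> nat, (forall l, (l <= n l)%N) &
    \forall omega \ae P, A omega -> forall i, (i < N)%N ->
      (fun l => X i (n l) omega) @ \oo --> (0 : R).
Proof.
move=> mA mX X0 hX.
pose E l i m := if (i < N)%N then A `&` [set omega | l.+1%:R^-1 <= X i m omega] else set0.
have mE l i m : measurable (E l i m).
  rewrite /E; case: ifPn => // iN; apply: measurableI => //.
  by rewrite -[X in measurable X]setTI; apply: measurable_fun_ler => //; exact: mX.
pose B l m := \big[setU/set0]_(i < N) E l i m.
have mB l m : measurable (B l m) by exact: bigsetU_measurable.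
have B0 l : (fun m => P (B l m)) @ \oo --> 0%E.
  apply: (@bigsetU_prob0 _ _ _ P N (E l)) => // i iN.
  by rewrite /E iN; apply: hX => //; rewrite invr_gt0 ltr0n.
have [n ln hB] := diagonal_borel_cantelli mB B0; exists n => //.
apply: filterS hB => omega h Ao i iN; apply/cvgr0Pnorm_lt => e e0.
have e1 : \forall l \near \oo, (l.+1%:R^-1 : R) < e.
  move/cvgr0Pnorm_lt : (@cvg_harmonic R) => /(_ _ e0); apply: filterS => l.
  by rewrite ger0_norm ?invr_ge0.
apply: filterS2 h e1 => l nB le; rewrite ger0_norm ?X0//.
rewrite ltNge; apply/negP => ele; apply: nB.
rewrite /B -(bigcup_mkord N (fun i => E l i (n l))); exists i => //.
by rewrite /E iN; split => //=; exact: le_trans (ltW le) ele.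
Qed.

Lemma cvg_sqr0 (R : realType) (u : nat -> R) :
  (fun l => u l ^+ 2) @ \oo --> (0 : R) -> u @ \oo --> (0 : R).
Proof.
move=> /cvgr0Pnorm_lt u2; apply/cvgr0Pnorm_lt => e e0.
apply: filterS (u2 (e ^+ 2) (exprn_gt0 _ e0)) => l.
by rewrite normrX ltr_pXn2r// nnegrE ltW.
Qed.

Section continuous_ratio.
Context d (Omega : measurableType d) (R : realType) (P : probability Omega R).
Variables (theta T : R) (F : R -> set (set Omega)) (w : R -> Omega -> R).
Hypotheses (hF : filtration P theta T F) (hw : wiener P theta T w).
Hypotheses (w_adapted : adapted F theta T w)
  (w_indep : future_increments_independent P theta T F w).
Variable (b : R).
Hypotheses (theta_b : theta < b) (bT : b <= T).
Local Notation mu := (@lebesgue_measure R).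
Local Notation t := (upart theta b).
Variables (A : set Omega) (c : nat -> nat -> R).
Hypotheses (mA : measurable A) (c01 : forall m k, 0 <= c m k <= 1).

Let tin m k : (k <= m.+1)%N -> t m k \in `[theta, b].
Proof. by move=> km; rewrite in_itv /= (grid_itv (upart_grid theta_b m) km). Qed.

Let tinT m k : (k <= m.+1)%N -> t m k \in `[theta, T].
Proof. by move=> /tin; rewrite !in_itv /= => /andP[-> h2]; rewrite (le_trans h2). Qed.

Let sF m k : (k <= m.+1)%N -> sigma_algebra setT (F (t m k)).
Proof. by move=> km; exact: (filt_sigma hF (tinT km)). Qed.

(* Row [0] carries the weights [c X] of the discrete norm identity, the rows *)
(* [j + 1] isolate the individual increments, so that [error_sum] also       *)
(* controls the sum of their squares.                                        *)
Definition weights (X : R -> Omega -> R) m j k omega :=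
  if j is i.+1 then (i == k)%:R else c m k * X (t m k) omega.

Lemma weights_measurable X m j k : (k < m.+1)%N ->
  (forall s, s \in `[theta, b] -> measurable_wrt (F s) (X s)) ->
  measurable_wrt (F (t m k)) (weights X m j k).
Proof.
move=> km mX; have sG := sF (ltnW km); case: j => [|i] /=; last exact: measurable_wrt_cst.
apply: (measurable_wrtM sG); first exact: measurable_wrt_cst.
by apply: mX; exact: tin (ltnW km).
Qed.

(** Although the number of rows grows with [m], for each [k] only row 0 and one other row are
    nonzero, the latter equal to 1. *)
Lemma weights_bounded X omega : {within `[theta, b], continuous (X ^~ omega)} ->
  exists C : R, forall m k, (k < m.+1)%N -> \sum_(j < m.+2) weights X m j k omega ^+ 2 <= C.
Proof.
move=> cX; have [C C0 XC] := within_bounded (ltW theta_b) cX.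
exists (C ^+ 2 + 1) => m k km; rewrite big_ord_recl; apply: lerD => /=.
  have /andP[c0 c1] := c01 m k.
  rewrite -ler_sqrt ?sqr_ge0// !sqrtr_sqr (ger0_norm C0) normrM (ger0_norm c0).
  by rewrite -[leRHS]mul1r ler_pM// XC// tin// ltnW.
rewrite (bigD1 (Ordinal km))//= eqxx expr1n big1 ?addr0// => i.
by rewrite -val_eqE /= => /negbTE ->; rewrite expr0n.
Qed.

Section ratio.
Variables (psi1 psi2 : nat -> simple_process Omega R) (g X H1 H2 : R -> Omega -> R).
Hypotheses (spsi1 : forall m, is_simple F theta T (psi1 m))
  (spsi2 : forall m, is_simple F theta T (psi2 m)).
Hypotheses (mg : forall s, s \in `[theta, b] -> measurable_wrt (F s) (g s))
  (mX : forall s, s \in `[theta, b] -> measurable_wrt (F s) (X s)).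
Hypothesis mH1 : \forall omega \ae P, measurable_fun `[theta, T] (H1 ^~ omega).
Hypothesis mH2 : \forall omega \ae P, measurable_fun `[theta, T] (H2 ^~ omega).
Hypothesis H1_L2 : \forall omega \ae P,
  (\int[mu]_(s in `[theta, T]) (H1 s omega ^+ 2)%:E < +oo)%E.
Hypothesis psi1_cvg : \forall omega \ae P,
  (fun m => \int[mu]_(s in `[theta, T])
    ((sp_eval (psi1 m) s omega - H1 s omega) ^+ 2)%:E)%E @ \oo --> 0%E.
Hypothesis psi2_cvg : \forall omega \ae P,
  (fun m => \int[mu]_(s in `[theta, T])
    ((sp_eval (psi2 m) s omega - H2 s omega) ^+ 2)%:E)%E @ \oo --> 0%E.
Hypothesis cgX : \forall omega \ae P, A omega ->
  {within `[theta, b], continuous (g ^~ omega)} /\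
  {within `[theta, b], continuous (X ^~ omega)}.
Hypothesis ratio : \forall omega \ae P, A omega -> forall s, s \in `[theta, b[ ->
  H2 s omega = g s omega * H1 s omega.

Definition ratio_error_sum m :=
  error_sum w m.+1 (t m) (psi1 m) (psi2 m) g m.+2 (weights X m).

Lemma ratio_error_sum_measurable m : measurable_fun setT (ratio_error_sum m).
Proof.
apply: (error_sum_measurable hF hw w_adapted w_indep theta_b bT (n := succn) (t := t)
  (upart_grid theta_b) spsi1 spsi2 (J := fun m => m.+2) (zeta := weights X)) => [{}m k km|{}m j k _ km].
  by apply: mg; exact: tin (ltnW km).
exact: weights_measurable.
Qed.

Lemma ratio_error_sum_ge0 m omega : 0 <= ratio_error_sum m omega.
Proof. by apply: sumr_ge0 => j _; exact: sqr_ge0. Qed.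

(** On [A] the integrands satisfy [H2 = g H1] with [g] continuous, so the error of freezing [g] at
    the left end of a cell is at most its oscillation there. *)
Lemma ratio_error_sum_cvg eps : 0 < eps ->
  (fun m => P (A `&` [set omega | eps <= ratio_error_sum m omega])) @ \oo --> 0%E.
Proof.
apply: (error_sum_cvg hF hw w_adapted w_indep theta_b bT (n := succn) (t := t)
  (upart_grid theta_b) spsi1 spsi2 (J := fun m => m.+2) (zeta := weights X) _ _ mA mH1 mH2 H1_L2
  psi1_cvg psi2_cvg) => [m k km|m j k _ km| |].
- by apply: mg; exact: tin (ltnW km).
- exact: weights_measurable.
- apply: filterS cgX => omega h /h[cg /weights_bounded[C1 XC]].
  have [C C0 gC] := within_bounded (ltW theta_b) cg.
  exists (C + `|C1|) => m k km; split.
    by rewrite (le_trans (gC _ (tin (ltnW km))))// lerDl.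
  by rewrite (le_trans (XC m k km))// (le_trans (ler_norm _))// lerDr.
- apply: filterS (filterI cgX ratio) => omega [hc hr] Ao e e0.
  have [cg _] := hc Ao; apply: filterS (upart_osc theta_b cg e0) => m osc k s km sin.
  have sb : s \in `[theta, b[.
    move: (tin (ltnW km)) (tin km) sin; rewrite !in_itv /= => /andP[h1 _] /andP[_ h2] /andP[h3 h4].
    by rewrite (le_trans h1 h3) (lt_le_trans h4 h2).
  rewrite (hr Ao s sb) -mulrBl normrM ler_wpM2r//; apply/ltW/osc => //.
  by move: sin; rewrite !in_itv /= => /andP[-> /ltW].
Qed.

Lemma ratio_error_sumE m omega : ratio_error_sum m omega =
  (\sum_(k < m.+1) c m k * X (t m k) omega *
     increment_error w (t m) (psi1 m) (psi2 m) g k omega) ^+ 2 +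
  \sum_(k < m.+1) increment_error w (t m) (psi1 m) (psi2 m) g k omega ^+ 2.
Proof.
rewrite /ratio_error_sum /error_sum big_ord_recl /=; congr (_ + _).
apply: eq_bigr => k _; congr (_ ^+ 2).
rewrite (bigD1 k)//= eqxx mul1r big1 ?addr0// => i.
by rewrite eq_sym -val_eqE /= => /negbTE ->; rewrite mul0r.
Qed.

Lemma ratio_error_sum_split (n : nat -> nat) omega :
  (fun l => ratio_error_sum (n l) omega) @ \oo --> (0 : R) ->
  (fun l => \sum_(k < (n l).+1) c (n l) k * X (t (n l) k) omega *
     increment_error w (t (n l)) (psi1 (n l)) (psi2 (n l)) g k omega) @ \oo --> (0 : R) /\
  (fun l => \sum_(k < (n l).+1)
     increment_error w (t (n l)) (psi1 (n l)) (psi2 (n l)) g k omega ^+ 2) @ \oo --> (0 : R).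
Proof.
move=> h; split; [apply: cvg_sqr0|]; apply: cvg0_le h; apply: nearW => l;
  rewrite ratio_error_sumE ger0_norm ?sqr_ge0 ?lerDl ?lerDr ?sqr_ge0//;
  by apply: sumr_ge0 => k _; exact: sqr_ge0.
Qed.

End ratio.

Section quadratic_variation.
Variable X : R -> Omega -> R.
Hypothesis mX : forall s, s \in `[theta, b] -> measurable_wrt (F s) (X s).
Hypothesis cX : \forall omega \ae P, A omega -> {within `[theta, b], continuous (X ^~ omega)}.

(** Row 0 carries the weights of the norm identity; row 1 gives the plain sum, from which the sum of
    the squared Wiener increments is bounded. *)
Definition qv_weights m j k omega := if j is i.+1 then 1 else c m k * X (t m k) omega.
Let mz m j k : (j < 2)%N -> (k < m.+1)%N -> measurable_wrt (F (t m k)) (qv_weights m j k).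
Proof.
move=> _ km; have sG := sF (ltnW km); case: j => [|i] /=; last exact: measurable_wrt_cst.
apply: (measurable_wrtM sG); first exact: measurable_wrt_cst.
by apply: mX; exact: tin (ltnW km).
Qed.

Definition weighted_qv_sum := qv_sum theta w b 2 qv_weights.

Lemma weighted_qv_sum_measurable m : measurable_fun setT (weighted_qv_sum m).
Proof. exact: (qv_sum_measurable hF hw w_adapted w_indep theta_b bT mz). Qed.

Lemma weighted_qv_sum_ge0 m omega : 0 <= weighted_qv_sum m omega.
Proof. by apply: sumr_ge0 => j _; exact: sqr_ge0. Qed.

Lemma weighted_qv_sum_cvg eps : 0 < eps ->
  (fun m => P (A `&` [set omega | eps <= weighted_qv_sum m omega])) @ \oo --> 0%E.
Proof.
apply: (qv_sum_cvg hF hw w_adapted w_indep theta_b bT mz mA).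
apply: filterS cX => omega h /h cXo; have [C C0 XC] := within_bounded (ltW theta_b) cXo.
exists (C ^+ 2 + 1) => m k km; rewrite big_ord_recl big_ord1; apply: lerD => /=; last by rewrite expr1n.
have /andP[c0 c1] := c01 m k.
rewrite -ler_sqrt ?sqr_ge0// !sqrtr_sqr (ger0_norm C0) normrM (ger0_norm c0).
by rewrite -[leRHS]mul1r ler_pM// XC// tin// ltnW.
Qed.

Lemma weighted_qv_sum_split (n : nat -> nat) omega :
  let q m k := (w (t m k.+1) omega - w (t m k) omega) ^+ 2 -
    normal_moment R 1 * (t m k.+1 - t m k) in
  (fun l => weighted_qv_sum (n l) omega) @ \oo --> (0 : R) ->
  (fun l => \sum_(k < (n l).+1) c (n l) k * X (t (n l) k) omega * q (n l) k) @ \oo --> (0 : R) /\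
  (fun l => \sum_(k < (n l).+1) q (n l) k) @ \oo --> (0 : R).
Proof.
move=> q h.
have E m : weighted_qv_sum m omega =
    (\sum_(k < m.+1) c m k * X (t m k) omega * q m k) ^+ 2 + (\sum_(k < m.+1) q m k) ^+ 2.
  rewrite /weighted_qv_sum /qv_sum big_ord_recl big_ord1; congr (_ + _ ^+ 2).
  by apply: eq_bigr => k _ /=; rewrite mul1r.
by split; apply: cvg_sqr0; apply: cvg0_le h; apply: nearW => l;
  rewrite E ger0_norm ?sqr_ge0// ?lerDl ?lerDr sqr_ge0.
Qed.

End quadratic_variation.
End continuous_ratio.

(** Multiplication by [i] is a quarter turn. The case [r = 0] is covered too, since the inverse of 0
    is 0. *)
Lemma complex_drift_coef (R : rcfType) (Z : R[i]) (r : R) :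
  ((0 +i* 1) * Z / r%:C)%C = (- complex.Im Z / r +i* (complex.Re Z / r))%C.
Proof.
case: Z => U V; have [->|r0] := eqVneq r 0.
  by rewrite (_ : 0%:C%C = 0 :> R[i])// !invr0 !mulr0.
rewrite -(fmorphV (real_complex R)); apply/eqP.
rewrite eq_complex /=; apply/andP; split; apply/eqP; ring.
Qed.

Section unit_process.
Context d (Omega : measurableType d) (R : realType) (P : probability Omega R).
Variables (theta T : R) (F : R -> set (set Omega)) (w : R -> Omega -> R).
Hypotheses (hF : filtration P theta T F) (theta_T : theta <= T).

(** The integrand 1, whose integral is [w - w theta]: it lets [w] play the part of the reference Ito
    integral in the equation of [y]. *)
Definition unit_process :=
  @SimpleProcess Omega R 1 (fun k => if k is 0 then theta else T) (fun _ _ => 1).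

Lemma unit_process_simple : is_simple F theta T unit_process.
Proof.
split => /=.
- by case=> [|[|]]//= _; rewrite in_itv /= lexx ?theta_T.
- by case.
- case=> // _; apply: measurable_wrt_cst; apply: (filt_sigma hF).
  by rewrite in_itv /= lexx theta_T.
- by move=> k _; exists 1 => omega; rewrite normr1.
Qed.

Lemma unit_process_integral s omega : s \in `[theta, T] ->
  sp_integral w unit_process s omega = w s omega - w theta omega.
Proof.
by rewrite in_itv /= => /andP[h1 h2]; rewrite /sp_integral big_ord1 /= mul1r min_r// min_l.
Qed.

Lemma unit_process_eval s omega : s \in `[theta, T[ -> sp_eval unit_process s omega = 1.
Proof.
by move=> sin; rewrite /sp_eval big_ord1 /= mul1r indicE mem_set.
Qed.

Lemma unit_process_L2 omega : (\int[@lebesgue_measure R]_(s in `[theta, T])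
  (sp_eval unit_process s omega ^+ 2)%:E < +oo)%E.
Proof.
apply: (@le_lt_trans _ _ (\int[@lebesgue_measure R]_(s in `[theta, T]) (cst 1 s)))%E; last first.
  rewrite integral_cst//= mul1e lebesgue_measure_itv /=; case: ifP => _ //.
  by rewrite -EFinB ltry.
apply: ge0_le_integral => //.
- by move=> s _; rewrite lee_fin sqr_ge0.
- by apply/measurable_EFinP/measurable_funX; exact: sp_eval_measurable.
- move=> s _; rewrite lee_fin /sp_eval big_ord1 /= mul1r indicE.
  by case: (_ \in _); rewrite ?expr1n// expr0n.
Qed.

End unit_process.

Arguments unit_process {d} Omega {R}.

Lemma upto_eq (Omega : Type) (R : realType) (tau : Omega -> R) (X : R -> Omega -> R) s omega :
  s <= tau omega -> upto tau X s omega = X s omega.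
Proof. by rewrite /upto => ->. Qed.

Section stochastic_exponential.
Context d (Omega : measurableType d) (R : realType) (P : probability Omega R).
Variables (theta T : R) (F : R -> set (set Omega)) (w : R -> Omega -> R).
Hypotheses (hT : theta < T) (hF : filtration P theta T F) (hw : wiener P theta T w).
Hypotheses (w_adapted : adapted F theta T w)
  (w_indep : future_increments_independent P theta T F w).
Variables (gamma sigma : R) (tau : Omega -> R) (y phi : R -> Omega -> R) (Y : R -> Omega -> R[i]).
Hypothesis y_cont : \forall omega \ae P,
  {within `[theta, tau omega], continuous (y ^~ omega)}.
Hypothesis y_adapted : adapted F theta T (upto tau y).
Hypothesis y_gt0 : \forall omega \ae P, forall s, s \in `[theta, tau omega] -> 0 < y s omega.
Hypothesis y_eq : ito_differential P F theta T w tau phi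
  (fun t omega => sigma * y t omega `^ gamma) y.
Hypothesis Y_cont : \forall omega \ae P,
  {within `[theta, tau omega], continuous (fun t => complex.Re (Y t omega))} /\
  {within `[theta, tau omega], continuous (fun t => complex.Im (Y t omega))}.
Hypothesis Y_adapted : adapted F theta T (upto tau (fun t omega => complex.Re (Y t omega)))
  /\ adapted F theta T (upto tau (fun t omega => complex.Im (Y t omega))).
Hypothesis Y_start : \forall omega \ae P, Y theta omega = 1.
Hypothesis Y_eq : complex_ito_differential P F theta T w tau y
  (fun t omega => ((0 +i* 1) * Y t omega / (y t omega `^ gamma)%:C)%C) Y.
Local Notation mu := (@lebesgue_measure R).
Local Notation K := (normal_moment R 1).
Local Notation U := (fun t omega => complex.Re (Y t omega)).
Local Notation V := (fun t omega => complex.Im (Y t omega)).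

Let Y_eq_real : exists a beta : R -> Omega -> R,
  [/\ ito_differential P F theta T w tau a beta y,
      ito_differential P F theta T w tau
        (fun t omega => - V t omega / y t omega `^ gamma * a t omega)
        (fun t omega => - V t omega / y t omega `^ gamma * beta t omega) U &
      ito_differential P F theta T w tau
        (fun t omega => U t omega / y t omega `^ gamma * a t omega)
        (fun t omega => U t omega / y t omega `^ gamma * beta t omega) V].
Proof.
have [a [beta [h1 h2 h3]]] := Y_eq; exists a, beta.
have hRe (X : R -> Omega -> R) : (fun t omega => - V t omega / y t omega `^ gamma * X t omega) =
    fun t omega => complex.Re ((0 +i* 1) * Y t omega / (y t omega `^ gamma)%:C)%C * X t omega.
  by apply/funext => t; apply/funext => omega; rewrite complex_drift_coef.
have hIm (X : R -> Omega -> R) : (fun t omega => U t omega / y t omega `^ gamma * X t omega) =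
    fun t omega => complex.Im ((0 +i* 1) * Y t omega / (y t omega `^ gamma)%:C)%C * X t omega.
  by apply/funext => t; apply/funext => omega; rewrite complex_drift_coef.
by rewrite !hRe !hIm.
Qed.

Section fixed_time.
Variable b : R.
Hypotheses (theta_b : theta < b) (bT : b <= T).
Local Notation t := (upart theta b).

(* Up to a null set this is [b <= tau], but its measurability is immediate. *)
Let A := [set omega | 0 < upto tau y b omega].

Let bin : b \in `[theta, T].
Proof. by rewrite in_itv /= (ltW theta_b). Qed.

Let inT s : s \in `[theta, b] -> s \in `[theta, T].
Proof. by rewrite !in_itv /= => /andP[-> h]; exact: le_trans h bT. Qed.

Let mA : measurable A.
Proof.
rewrite -[X in measurable X]setTI; apply: measurable_fun_ltr => //.
exact: measurable_wrtE (filt_event hF bin) (y_adapted bin).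
Qed.

Let A_tau omega : A omega -> b <= tau omega.
Proof. by rewrite /A /= /upto; case: ifP => //; rewrite ltxx. Qed.

Let tin m k : (k <= m.+1)%N -> t m k \in `[theta, b].
Proof. by move=> km; rewrite in_itv /= (grid_itv (upart_grid theta_b m) km). Qed.

Let uU := upto tau U.
Let uV := upto tau V.
(** Used with [gamma] and [- gamma]: writing [1 / y^gamma] as a power treats measurability and
    continuity of both factors at once. *)
Let uG p := fun s omega => upto tau y s omega `^ p.
Let gU s omega : R := - uV s omega * uG (- gamma) s omega.
Let gV s omega := uU s omega * uG (- gamma) s omega.
Let g0 s omega := sigma * uG gamma s omega.
Let N s omega := uU s omega * uU s omega + uV s omega * uV s omega.
Let c m k := (1 + sigma ^+ 2 * K * ((b - theta) / m.+1%:R))^-1 ^+ k.+1.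

Let c01 m k : 0 <= c m k <= 1.
Proof.
apply: invDX_itv; apply: mulr_ge0; first exact: mulr_ge0 (sqr_ge0 _) (normal_moment_ge0 _ _).
by rewrite divr_ge0// subr_ge0 ltW.
Qed.

Let sF s : s \in `[theta, b] -> sigma_algebra setT (F s).
Proof. by move=> /inT sin; exact: (filt_sigma hF sin). Qed.

Let mU s : s \in `[theta, b] -> measurable_wrt (F s) (uU s).
Proof. by move=> /inT sin; exact: (Y_adapted.1 _ sin). Qed.

Let mV s : s \in `[theta, b] -> measurable_wrt (F s) (uV s).
Proof. by move=> /inT sin; exact: (Y_adapted.2 _ sin). Qed.

Let mG p s : s \in `[theta, b] -> measurable_wrt (F s) (uG p s).
Proof.
move=> /inT sin; apply: (measurable_wrt_comp (g := @powR R ^~ p) _ (y_adapted sin)).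
exact: measurable_powR.
Qed.

Let mgU s : s \in `[theta, b] -> measurable_wrt (F s) (gU s).
Proof.
move=> sin; apply: (measurable_wrtM (sF sin)); last exact: mG.
apply: (measurable_wrt_comp (g := fun x : R => - x) _ (mV sin)); exact: measurable_funN.
Qed.

Let mgV s : s \in `[theta, b] -> measurable_wrt (F s) (gV s).
Proof. by move=> sin; apply: (measurable_wrtM (sF sin)); [exact: mU|exact: mG]. Qed.

Let mg0 s : s \in `[theta, b] -> measurable_wrt (F s) (g0 s).
Proof.
move=> sin; apply: (measurable_wrtM (sF sin)); last exact: mG.
exact: measurable_wrt_cst (sF sin) _.
Qed.

Let mN s : s \in `[theta, b] -> measurable_wrt (F s) (N s).
Proof.
move=> sin; apply: (measurable_wrtD (sF sin)); apply: (measurable_wrtM (sF sin));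
  by [exact: mU|exact: mV].
Qed.

Let regular omega :=
  [/\ {within `[theta, b], continuous (y ^~ omega)},
      {within `[theta, b], continuous (U ^~ omega)},
      {within `[theta, b], continuous (V ^~ omega)} &
      forall s, s \in `[theta, b] -> 0 < y s omega].

Let A_regular : \forall omega \ae P, A omega -> regular omega.
Proof.
apply: filterS (filterI y_cont (filterI y_gt0 Y_cont)).
move=> omega [cy [y0 [cU cV]]] /A_tau btau.
have sub : `[theta, b]%classic `<=` `[theta, tau omega]%classic.
  by move=> s /=; rewrite !in_itv /= => /andP[-> h]; exact: le_trans h btau.
split => //.
- exact: continuous_subspaceW sub cy.
- exact: continuous_subspaceW sub cU.
- exact: continuous_subspaceW sub cV.
- by move=> s /sub; exact: y0.
Qed.

Let uptoE X omega s : A omega -> s \in `[theta, b] -> upto tau X s omega = X s omega.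
Proof.
move=> /A_tau btau; rewrite in_itv /= => /andP[_ sb].
by rewrite upto_eq// (le_trans sb).
Qed.

Let cont_upto X omega : A omega -> {within `[theta, b], continuous (X ^~ omega)} ->
  {within `[theta, b], continuous (upto tau X ^~ omega)}.
Proof.
move=> Ao; apply: subspace_eq_continuous => s /set_mem sin.
exact/esym/(uptoE X Ao sin).
Qed.

Let A_cont : \forall omega \ae P, A omega ->
  [/\ {within `[theta, b], continuous (uU ^~ omega)},
      {within `[theta, b], continuous (uV ^~ omega)} &
      forall p, {within `[theta, b], continuous (uG p ^~ omega)}].
Proof.
apply: filterS A_regular => omega h Ao; have [cy cU cV y0] := h Ao; split.
- exact: cont_upto.
- exact: cont_upto.
- move=> p; apply: within_powR; first exact: cont_upto.
  by move=> s sin; rewrite uptoE//; exact: y0.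
Qed.

(** On [A] the integrands of [Iu] and [Iv] are [- V / y^gamma] and [U / y^gamma] times that of [Iy],
    and the integrand of [I0] is [sigma y^gamma] times 1. All these ratios are continuous, so
    [ratio_error_sum_cvg] applies to the three pairs and [weighted_qv_sum_cvg] to [w]; the rest is
    [pathwise_norm]. *)
Lemma sqr_norm_at : \forall omega \ae P, b <= tau omega ->
  U b omega ^+ 2 + V b omega ^+ 2 = expR (sigma ^+ 2 * K * (b - theta)).
Proof.
have [_ [I0 itoI0 eq0]] := y_eq.
have [a [beta [[_ [Iy itoIy eqy]] [_ [Iu itoIu equ]] [_ [Iv itoIv eqv]]]]] := Y_eq_real.
have e_gt0 m : (0 : R) < m.+1%:R ^- 2 by rewrite invr_gt0 exprn_gt0// ltr0n.
have tinT m k : (k < m.+2)%N -> t m k \in `[theta, T] by move=> km; exact/inT/tin.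
have diag H I (h : is_ito_integral P F theta T w H I) :=
  @ito_integral_diagonal _ _ _ _ _ _ _ _ _ _ (fun m => m.+2) t _ hF w_adapted h tinT e_gt0.
have [psi0 [spsi0 psi0_cvg psi0_I]] := diag _ _ itoI0.
have [psiy [spsiy psiy_cvg psiy_I]] := diag _ _ itoIy.
have [psiu [spsiu psiu_cvg psiu_I]] := diag _ _ itoIu.
have [psiv [spsiv psiv_cvg psiv_I]] := diag _ _ itoIv.
have [[_ mH0 _] _ cI0 _] := itoI0.
have [[_ mHy Hy_L2] _ _ _] := itoIy.
have [[_ mHu _] _ _ _] := itoIu.
have [[_ mHv _] _ _ _] := itoIv.
pose psi1 (m : nat) := unit_process Omega theta T.
have spsi1 m : is_simple F theta T (psi1 m) by exact: unit_process_simple hF (ltW hT).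
have mH1 : \forall omega \ae P, measurable_fun `[theta, T] (sp_eval (unit_process Omega theta T) ^~ omega).
  by apply: aeW => omega; exact: sp_eval_measurable.
have H1_L2 : \forall omega \ae P, (\int[mu]_(s in `[theta, T])
    (sp_eval (unit_process Omega theta T) s omega ^+ 2)%:E < +oo)%E.
  by apply: aeW => omega; exact: unit_process_L2.
have psi1_cvg : \forall omega \ae P, (fun m => \int[mu]_(s in `[theta, T])
    ((sp_eval (psi1 m) s omega - sp_eval (unit_process Omega theta T) s omega) ^+ 2)%:E)%E @ \oo --> 0%E.
  apply: aeW => omega.
  under eq_fun => m do under eq_integral => s _ do rewrite subrr expr0n /=.
  by under eq_fun => m do rewrite integral0; exact: cvg_cst.
(* For the pair [w, I0] only the sum of squared errors is wanted, so the weighted row is set to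
   0. *)
pose zero_process (s : R) (omega : Omega) : R := 0.
have mzero s : s \in `[theta, b] -> measurable_wrt (F s) (zero_process s).
  by move=> sin; exact: measurable_wrt_cst (sF sin) _.
pose SU := ratio_error_sum theta w b c psiy psiu gU uU.
pose SV := ratio_error_sum theta w b c psiy psiv gV uV.
pose S0 := ratio_error_sum theta w b c psi1 psi0 g0 zero_process.
pose SQ := weighted_qv_sum theta w b c N.
have mSU m : measurable_fun setT (SU m).
  exact: (ratio_error_sum_measurable hF hw w_adapted w_indep theta_b bT c spsiy spsiu mgU mU).
have mSV m : measurable_fun setT (SV m).
  exact: (ratio_error_sum_measurable hF hw w_adapted w_indep theta_b bT c spsiy spsiv mgV mV).
have mS0 m : measurable_fun setT (S0 m).
  exact: (ratio_error_sum_measurable hF hw w_adapted w_indep theta_b bT c spsi1 spsi0 mg0 mzero).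
have mSQ m : measurable_fun setT (SQ m).
  exact: (weighted_qv_sum_measurable hF hw w_adapted w_indep theta_b bT c mN).
have SU0 eps : 0 < eps -> (fun m => P (A `&` [set omega | eps <= SU m omega])) @ \oo --> 0%E.
  apply: (ratio_error_sum_cvg hF hw w_adapted w_indep theta_b bT mA c01 spsiy spsiu mgU mU
    mHy mHu Hy_L2 psiy_cvg psiu_cvg).
    apply: filterS A_cont => omega h /h[cU cV cG]; split => //.
    by apply: withinM => //; exact: withinN.
  apply: aeW => omega Ao s sin.
  have {}sin : s \in `[theta, b].
    by move: sin; rewrite !in_itv /= => /andP[-> /ltW].
  by rewrite /gU /uV /uG !uptoE// powRN.
have SV0 eps : 0 < eps -> (fun m => P (A `&` [set omega | eps <= SV m omega])) @ \oo --> 0%E.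
  apply: (ratio_error_sum_cvg hF hw w_adapted w_indep theta_b bT mA c01 spsiy spsiv mgV mV
    mHy mHv Hy_L2 psiy_cvg psiv_cvg).
    apply: filterS A_cont => omega h /h[cU cV cG]; split => //.
    exact: withinM.
  apply: aeW => omega Ao s sin.
  have {}sin : s \in `[theta, b].
    by move: sin; rewrite !in_itv /= => /andP[-> /ltW].
  by rewrite /gV /uU /uG !uptoE// powRN.
have S00 eps : 0 < eps -> (fun m => P (A `&` [set omega | eps <= S0 m omega])) @ \oo --> 0%E.
  apply: (ratio_error_sum_cvg hF hw w_adapted w_indep theta_b bT mA c01 spsi1 spsi0 mg0 mzero
    mH1 mH0 H1_L2 psi1_cvg psi0_cvg).
    apply: filterS A_cont => omega h /h[cU cV cG]; split; last exact: within_cst.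
    by apply: withinM => //; exact: within_cst.
  apply: aeW => omega Ao s sin; rewrite unit_process_eval ?mulr1.
    by rewrite /g0 /uG !uptoE//; move: sin; rewrite !in_itv /= => /andP[-> /ltW].
  by move: sin; rewrite !in_itv /= => /andP[-> h]; exact: lt_le_trans h bT.
have SQ0 eps : 0 < eps -> (fun m => P (A `&` [set omega | eps <= SQ m omega])) @ \oo --> 0%E.
  apply: (weighted_qv_sum_cvg hF hw w_adapted w_indep theta_b bT mA c01 mN).
  apply: filterS A_cont => omega h /h[cU cV cG].
  by apply: withinD; exact: withinM.
(* Index 3 falls outside the list and returns the default [SQ]. *)
pose S i := nth SQ [:: SU; SV; S0] i.
have [n ln hn] : exists2 n : nat -> nat, (forall l, (l <= n l)%N) &
    \forall omega \ae P, A omega -> forall i, (i < 4)%N ->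
      (fun l => S i (n l) omega) @ \oo --> (0 : R).
  apply: diagonal_small => //.
  - by case=> [|[|[|[|]]]].
  - case=> [|[|[|[|]]]]// m omega _; rewrite /S /=; first [exact: ratio_error_sum_ge0|exact: weighted_qv_sum_ge0].
  - by case=> [|[|[|[|i]]]] eps // _ eps0; [exact: SU0|exact: SV0|exact: S00|exact: SQ0].
apply: filterS (filterI hn (filterI A_regular (filterI Y_start (filterI cI0 (filterI y_gt0
  (filterI (filterI eq0 (filterI eqy (filterI equ eqv)))
  (filterI (filterI psi0_I psiy_I) (filterI psiu_I psiv_I)))))))).
move=> omega [Sn [reg [Y1 [cI0o [y0 [[e0 [ey [eu ev]]] [[s0 sy] [su sv]]]]]]]] btau.
have Ao : A omega by rewrite /A /= upto_eq//; apply: y0; rewrite in_itv /= (ltW theta_b).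
have {}reg := reg Ao; have {}Sn := Sn Ao.
have sub : `[theta, b]%classic `<=` `[theta, tau omega]%classic.
  by move=> s /=; rewrite !in_itv /= => /andP[-> h]; exact: le_trans h btau.
have intS (X : R -> R) : mu.-integrable `[theta, tau omega] (EFin \o X) ->
    mu.-integrable `[theta, b] (EFin \o X).
  by apply: integrableS => //; exact: measurable_itv.
have small (psi : nat -> simple_process Omega R) (I : R -> Omega -> R) :
    (\forall m \near \oo, forall k, (k < m.+2)%N ->
      `|sp_integral w (psi m) (t m k) omega - I (t m k) omega| < m.+1%:R ^- 2) ->
    small_increment_errors theta b (fun m k => sp_integral w (psi m) (t m k) omega) (I ^~ omega).
  by apply: filterS => m h k km; exact/ltW/h.
have [cy cU cV yb] := reg.
have cI0b : {within `[theta, b], continuous (I0 ^~ omega)}.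
  by apply: continuous_subspaceW cI0o => s; exact: inT.
have G0 s : s \in `[theta, b] -> 0 < y s omega `^ gamma by move=> sin; apply/powR_gt0/yb.
have [hU hU2] := ratio_error_sum_split (Sn 0%N isT).
have [hV hV2] := ratio_error_sum_split (Sn 1%N isT).
have [_ h0] := ratio_error_sum_split (Sn 2%N isT).
have [hq hq1] := weighted_qv_sum_split (Sn 3%N isT).
have := @pathwise_norm R theta b theta_b (U ^~ omega) (V ^~ omega) (y ^~ omega)
  (fun s => y s omega `^ gamma) (a ^~ omega) (phi ^~ omega) (Iu ^~ omega) (Iv ^~ omega)
  (Iy ^~ omega) (I0 ^~ omega) (w ^~ omega) _ _ _ _ sigma K n (normal_moment_ge0 _ _) ln
  cU cV cy (within_powR cy yb) cI0b G0 (intS _ ey.1) (intS _ eu.1) (intS _ ev.1) (intS _ e0.1)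
  (fun s sin => eu.2 s (sub s sin)) (fun s sin => ev.2 s (sub s sin))
  (fun s sin => ey.2 s (sub s sin)) (fun s sin => e0.2 s (sub s sin))
  (small _ _ su) (small _ _ sv) (small _ _ sy) (small _ _ s0).
have tk m k : (k < m.+1)%N -> t m k \in `[theta, b] by move=> km; exact: tin (ltnW km).
have gUE m k : (k < m.+1)%N -> gU (t m k) omega = - V (t m k) omega / y (t m k) omega `^ gamma.
  by move=> /tk ?; rewrite /gU /uV /uG !uptoE// powRN.
have gVE m k : (k < m.+1)%N -> gV (t m k) omega = U (t m k) omega / y (t m k) omega `^ gamma.
  by move=> /tk ?; rewrite /gV /uU /uG !uptoE// powRN.
have UE m k : (k < m.+1)%N -> uU (t m k) omega = U (t m k) omega.
  by move=> /tk ?; rewrite /uU uptoE.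
have VE m k : (k < m.+1)%N -> uV (t m k) omega = V (t m k) omega.
  by move=> /tk ?; rewrite /uV uptoE.
rewrite Y1 /= expr1n expr0n addr0 mul1r; apply.
- apply: cvg_trans hU; apply: near_eq_cvg; apply: nearW => l; apply: eq_bigr => k _.
  by rewrite UE// /increment_error gUE.
- apply: cvg_trans hU2; apply: near_eq_cvg; apply: nearW => l; apply: eq_bigr => k _.
  by rewrite /increment_error gUE.
- apply: cvg_trans hV; apply: near_eq_cvg; apply: nearW => l; apply: eq_bigr => k _.
  by rewrite VE// /increment_error gVE.
- apply: cvg_trans hV2; apply: near_eq_cvg; apply: nearW => l; apply: eq_bigr => k _.
  by rewrite /increment_error gVE.
- apply: cvg_trans h0; apply: near_eq_cvg; apply: nearW => l; apply: eq_bigr => k _.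
  have kn := ltn_ord k; rewrite /increment_error /g0 /uG uptoE; [|by []|exact: tk].
  rewrite !unit_process_integral; [|by apply: tinT; exact: ltnW|exact: tinT].
  by rewrite opprB addrA subrK.
- apply: cvg_trans hq; apply: near_eq_cvg; apply: nearW => l; apply: eq_bigr => k _.
  by rewrite /N UE// VE// !expr2.
- exact: hq1.
Qed.

End fixed_time.
End stochastic_exponential.

(** * From rational times to all times *)

(** If the continuous difference [D] were nonzero at [s], it would be nonzero at a rational close to
    [s]; the rational is taken to the left of [s], hence below [b]. *)
Lemma within_eq_dense (R : realType) (theta b kappa : R) (N : R -> R) :
  theta < b -> {within `[theta, b], continuous N} ->
  (forall q : rat, theta < ratr q <= b -> N (ratr q) = expR (kappa * (ratr q - theta))) ->
  forall s, theta < s <= b -> N s = expR (kappa * (s - theta)).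
Proof.
move=> theta_b cN hq s /andP[ts sb].
pose D u := N u + - expR (kappa * (u - theta)).
have cD : {within `[theta, b], continuous D}.
  apply: withinD => //; apply: withinN; apply: continuous_subspaceT => u.
  apply: (@continuous_comp _ _ _ (fun v => kappa * (v - theta)) expR); last exact: continuous_expR.
  by apply: cvgM; [exact: cvg_cst|apply: cvgB; [exact: cvg_id|exact: cvg_cst]].
apply/eqP; rewrite -subr_eq0 -/(D s); apply/negPn/negP; rewrite -normr_gt0 => Ds.
have [delta d0 hd] := within_unif_continuous cD Ds.
have [q] : exists q : rat, ratr q \in `]Num.max theta (s - delta), s[.
  by apply: rat_in_itvoo; rewrite gt_max ts gtrBl.
rewrite in_itv /= gt_max => /andP[/andP[tq dq] qs].
have Dq : D (ratr q) = 0 by rewrite /D hq ?subrr// tq (le_trans (ltW qs)).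
have : `|D s - D (ratr q)| < `|D s|.
  apply: hd; rewrite ?in_itv /= ?(ltW ts) ?(ltW tq) ?sb ?(le_trans (ltW qs))//.
  by rewrite gtr0_norm ?subr_gt0// ltrBlDr -ltrBlDl.
by rewrite Dq subr0 ltxx.
Qed.

(** The infimum of a set without lower bound is 0 by convention, so a positive infimum is a genuine
    lower bound. *)
Lemma inf_gt0_within (R : realType) (u : R -> R) (a b : R) :
  0 < inf (u @` `[a, b]) -> forall s, s \in `[a, b] -> 0 < u s.
Proof.
move=> inf0 s sin.
have [_ lb] : has_inf (u @` `[a, b]).
  by apply: contrapT => /inf_out inf_eq0; rewrite inf_eq0 ltxx in inf0.
by apply: lt_le_trans inf0 _; apply: ge_inf => //; exists s.
Qed.

Theorem proposition4p2
  (R : realType) (theta T : R) (hT : theta < T)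
  (d : measure_display) (Omega : measurableType d) (P : probability Omega R)
  (P_complete : measure_is_complete P)
  (F : R -> set (set Omega)) (hF : filtration P theta T F)
  (w : R -> Omega -> R) (hw : wiener P theta T w)
  (w_adapted : adapted F theta T w)
  (w_indep : future_increments_independent P theta T F w)
  (gamma sigma : R) (hgamma : 0 <= gamma <= 1) (hsigma : 0 < sigma)
  (f : (R -> R) -> R -> Omega -> R) (hf : drift_functional P theta T F f)
  (tau : Omega -> R) (tau_stop : stopping_time theta T F tau)
  (tau_range : \forall omega \ae P, theta < tau omega <= T)
  (y : R -> Omega -> R)
  (y_cont : \forall omega \ae P,
     {within `[theta, tau omega], continuous (y ^~ omega)})
  (y_adapted : adapted F theta T (upto tau y))
  (y_start : \forall omega \ae P, 0 < y theta omega)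
  (y_pos : \forall omega \ae P, 0 < inf ((y ^~ omega) @` `[theta, tau omega]))
  (y_eq : ito_differential P F theta T w tau
     (fun t omega => f (fun s => y (Num.min s (tau omega)) omega) t omega)
     (fun t omega => sigma * y t omega `^ gamma)
     y)
  (Y : R -> Omega -> R[i])
  (Y_cont : \forall omega \ae P,
     {within `[theta, tau omega], continuous (fun t => complex.Re (Y t omega))} /\
     {within `[theta, tau omega], continuous (fun t => complex.Im (Y t omega))})
  (Y_adapted : adapted F theta T (upto tau (fun t omega => complex.Re (Y t omega)))
     /\ adapted F theta T (upto tau (fun t omega => complex.Im (Y t omega))))
  (Y_start : \forall omega \ae P, Y theta omega = 1)
  (Y_eq : complex_ito_differential P F theta T w tau y
     (fun t omega => ((0 +i* 1) * Y t omega / (y t omega `^ gamma)%:C)%C) Y) :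
  \forall omega \ae P, exists c : R, forall t, theta < t <= T ->
    (Num.min t (tau omega) - theta)^-1
      * ln (Normc.normc (Y (Num.min t (tau omega)) omega)) = c.
Proof.
have y_gt0 : \forall omega \ae P, forall s, s \in `[theta, tau omega] -> 0 < y s omega.
  by apply: filterS y_pos => omega; exact: inf_gt0_within.
pose kappa := sigma ^+ 2 * normal_moment R 1.
pose N s omega := complex.Re (Y s omega) ^+ 2 + complex.Im (Y s omega) ^+ 2.
(* Enumerating the rationals by [unpickle] turns the family into a countable one, so a single null
   set suffices. *)
have at_rat : \forall omega \ae P, forall n (q : rat), unpickle n = Some q ->
    theta < ratr q <= T -> ratr q <= tau omega ->
    N (ratr q) omega = expR (kappa * (ratr q - theta)).
  apply/ae_foralln => n; case: (unpickle n) => [q|]; last by apply: aeW.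
  have [/andP[tq qT]|nq] := boolP (theta < ratr q <= T); last first.
    by apply: aeW => omega _ [<-] h; rewrite h in nq.
  have := sqr_norm_at hT hF hw w_adapted w_indep y_cont y_adapted y_gt0 y_eq
    Y_cont Y_adapted Y_start Y_eq tq qT.
  by apply: filterS => omega h _ [<-] _; exact: h.
apply: filterS (filterI at_rat (filterI tau_range Y_cont)).
move=> omega [hq [/andP[theta_tau tau_T] [cU cV]]].
(* [|Y|] is the square root of [exp (kappa (s - theta))]. Since [s = min(t, tau)] lies in []theta,
   tau]], the division by [s - theta] is legitimate. *)
exists (kappa / 2) => t /andP[theta_t _]; set s := Num.min t (tau omega).
have sin : theta < s <= tau omega by rewrite lt_min theta_t theta_tau ge_min lexx orbT.
have cN : {within `[theta, tau omega], continuous (N ^~ omega)}.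
  by apply: withinD; exact: withinM.
have Ns : N s omega = expR (kappa * (s - theta)).
  apply: (within_eq_dense theta_tau cN) sin => q /andP[tq qtau].
  by apply: (hq _ q (pickleK q)) => //; rewrite tq (le_trans qtau).
have -> : Normc.normc (Y s omega) = Num.sqrt (N s omega).
  by rewrite /N; case: (Y s omega).
have /andP[theta_s _] := sin.
rewrite Ns -powR12_sqrt ?expR_ge0// ln_powR expRK [kappa * _]mulrC [2^-1 * _]mulrCA.
by rewrite mulKf 1?mulrC// subr_eq0 gt_eqF.
Qed.
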